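(* Let $N\ge 1$, let $\Omega\subset\mathbb{R}^N$ be a domain, let $0<T\le\infty$, and let $p,q>0$. Assume that $pq>1$. Let $(u,v)$ be a positive solution of the system $$u_t-\Delta u+v^p=0,\qquad v_t-\Delta v+u^q=0\qquad\text{in }\Omega\times(0,T).$$ Then for any domain $\omega\subset\subset\Omega$ ($\omega=\mathbb{R}^N$ if $\Omega=\mathbb{R}^N$), $$u(x,t)\le C\,t^{-a},\qquad v(x,t)\le C\,t^{-b},\qquad\forall (x,t)\in\omega\times(0,T),$$ for some $C=C(N,p,q,T,\omega)$, where $$a=\frac{p+1}{pq-1},\qquad b=\frac{q+1}{pq-1}.$$
   Context: A positive solution $(u,v)$ of the system in $\Omega\times(0,T)$ is a couple of positive functions such that $u\in L^q_{loc}(\Omega\times(0,T))$, $v\in L^p_{loc}(\Omega\times(0,T))$ and, for every $\varphi\in\mathcal{D}(\Omega\times(0,T))=C_c^\infty(\Omega\times(0,T))$, $$\iint_{\Omega\times(0,T)}(-u\varphi_t-u\Delta\varphi+v^p\varphi)=0,\qquad \iint_{\Omega\times(0,T)}(-v\varphi_t-v\Delta\varphi+u^q\varphi)=0.$$ By standard regularity theory for the heat equation and positivity, $u,v\in C^\infty(\Omega\times(0,T))$. The notation $\omega\subset\subset\Omega$ means that the closure of $\omega$ is a compact subset of $\Omega$.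
   Formalization: For T = ∞ with Ω ≠ ℝ^N the claim is false (stationary solution 6/(x+2)^2 on (-1,1), p=q=2), so there the bounds are proved on ω×(0,τ) for each finite τ, with C depending on τ; C may also depend on the fixed Ω. *)

(* Defs.v *)
From HB Require Import structures.
From mathcomp Require Import all_boot all_order all_algebra.
From mathcomp Require Import all_classical all_reals all_analysis.

Set Implicit Arguments.
Unset Strict Implicit.
Unset Printing Implicit Defensive.

Import Order.TTheory GRing.Theory Num.Theory.
Import numFieldNormedType.Exports.

Local Open Scope classical_set_scope.
Local Open Scope ring_scope.

(* The sigma-algebra generated by the coordinates, as for n.-tuple T; over R it
   is the Borel sigma-algebra of R^n. *)
Definition measure_rV_display : measure_display -> measure_display.
Proof. exact. Qed.

Section measurable_rV.
Context {d} {T : measurableType d}.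
Variable n : nat.

Let coord : 'I_n -> 'rV[T]_n -> T := fun i x => x ord0 i.

Let rV_set0 : g_sigma_preimage coord set0.
Proof. exact: sigma_algebra0. Qed.

Let rV_setC A : g_sigma_preimage coord A -> g_sigma_preimage coord (~` A).
Proof. exact: sigma_algebraC. Qed.

Let rV_bigcup (F : _^nat) : (forall i, g_sigma_preimage coord (F i)) ->
  g_sigma_preimage coord (\bigcup_i (F i)).
Proof. exact: sigma_algebra_bigcup. Qed.

HB.instance Definition _ := @isMeasurable.Build (measure_rV_display d)
  'rV[T]_n (g_sigma_preimage coord) rV_set0 rV_setC rV_bigcup.

End measurable_rV.

Lemma measurable_coord d (T : measurableType d) n (i : 'I_n) :
  measurable_fun [set: 'rV[T]_n] (fun x => x ord0 i).
Proof.
move=> _ Y mY; rewrite setTI; apply: sub_sigma_algebra => /=.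
rewrite -bigcup_seq/=; exists i => /=; first by rewrite mem_index_enum.
by exists Y => //; rewrite setTI.
Qed.

Lemma measurable_fun_coordP d1 d2 (T1 : measurableType d1)
    (T2 : measurableType d2) n (f : T1 -> 'rV[T2]_n) :
  measurable_fun [set: T1] f <->
  forall i, measurable_fun [set: T1] (fun x => f x ord0 i).
Proof.
split=> [mf i|mf].
  exact: (measurableT_comp (measurable_coord i) mf).
apply: (@measurability _ _ _ _ setT f _ erefl) => _ [B + <-].
rewrite -bigcup_seq/= => -[i _ [C mC <-]].
rewrite setTI -[X in measurable X]setTI setTI.
rewrite !setTI -comp_preimage -[X in measurable X]setTI.
exact: (mf i).
Qed.

Definition rV_cons (T : Type) n (xy : T * 'rV[T]_n) : 'rV[T]_n.+1 :=
  \row_i oapp (xy.2 ord0) xy.1 (unlift ord0 i).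

Lemma rV_cons0 (T : Type) n (xy : T * 'rV[T]_n) : rV_cons xy ord0 ord0 = xy.1.
Proof. by rewrite mxE unlift_none. Qed.

Lemma rV_consS (T : Type) n (xy : T * 'rV[T]_n) (i : 'I_n) :
  rV_cons xy ord0 (lift ord0 i) = xy.2 ord0 i.
Proof. by rewrite mxE liftK. Qed.

Lemma measurable_rV_cons d (T : measurableType d) n :
  measurable_fun [set: T * 'rV[T]_n] (@rV_cons T n).
Proof.
apply/measurable_fun_coordP => i; case: (unliftP ord0 i) => [j|] ->.
  under eq_fun do rewrite rV_consS.
  exact: (measurableT_comp (measurable_coord j) measurable_snd).
under eq_fun do rewrite rV_cons0.
exact: measurable_fst.
Qed.

Definition rV_uncons (T : Type) n (x : 'rV[T]_n.+1) : T * 'rV[T]_n :=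
  (x ord0 ord0, \row_i x ord0 (lift ord0 i)).

Lemma rV_consK (T : Type) n : cancel (@rV_cons T n) (@rV_uncons T n).
Proof.
move=> [x y]; rewrite /rV_uncons rV_cons0/=; congr pair.
by apply/rowP => i; rewrite mxE rV_consS.
Qed.

Lemma measurable_rV_uncons d (T : measurableType d) n :
  measurable_fun [set: 'rV[T]_n.+1] (@rV_uncons T n).
Proof.
apply/measurable_fun_pairP; split; first exact: measurable_coord.
apply/measurable_fun_coordP => i /=; under eq_fun do rewrite mxE.
exact: measurable_coord.
Qed.

(* The product of the Lebesgue measure on R and m, carried to R^(n+1). *)
Section lebesgue_rVS.
Local Open Scope ereal_scope.
Context (R : realType) n (m : {sigma_finite_measure set 'rV[R]_n -> \bar R}).

Definition lebesgue_rVS : set 'rV[R]_n.+1 -> \bar R :=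
  pushforward ((@lebesgue_measure R) \x m) (@rV_cons R n).

Let measurable_preimage (A : set 'rV[R]_n.+1) :
  measurable A -> measurable (@rV_cons R n @^-1` A).
Proof. by move=> mA; rewrite -[X in measurable X]setTI; exact: measurable_rV_cons. Qed.

Let lebesgue_rVS0 : lebesgue_rVS set0 = 0.
Proof. by rewrite /lebesgue_rVS/pushforward preimage_set0 measure0. Qed.

Let lebesgue_rVS_ge0 A : 0 <= lebesgue_rVS A.
Proof. by rewrite /lebesgue_rVS/pushforward measure_ge0. Qed.

Let lebesgue_rVS_sigma_additive : semi_sigma_additive lebesgue_rVS.
Proof.
move=> F mF tF mUF; rewrite /lebesgue_rVS/pushforward preimage_bigcup.
apply: measure_semi_sigma_additive.
- by move=> k; exact: measurable_preimage.
- apply/trivIsetP => /= i j _ _ ij; rewrite -preimage_setI.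
  by move/trivIsetP : tF => /(_ _ _ _ _ ij) ->//; rewrite preimage_set0.
- by rewrite -preimage_bigcup; exact: measurable_preimage.
Qed.

HB.instance Definition _ := isMeasure.Build _ _ _ lebesgue_rVS
  lebesgue_rVS0 lebesgue_rVS_ge0 lebesgue_rVS_sigma_additive.

Let lebesgue_rVS_sigma_finite : sigma_finite setT lebesgue_rVS.
Proof.
have /sigma_finiteP[F [TF ndF Foo]] := sigma_finiteT (@lebesgue_measure R).
have /sigma_finiteP[G [TG ndG Goo]] := sigma_finiteT m.
exists (fun k => @rV_uncons R n @^-1` (F k `*` G k)).
  rewrite -preimage_bigcup; apply/esym; rewrite -subTset => x _ /=.
  have [i _ Fi] : (\bigcup_i F i) (rV_uncons x).1 by rewrite -TF.
  have [j _ Gj] : (\bigcup_i G i) (rV_uncons x).2 by rewrite -TG.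
  exists (maxn i j) => //; split.
    by apply: (subsetPset _ _ (ndF _ _ (leq_maxl i j))).
  by apply: (subsetPset _ _ (ndG _ _ (leq_maxr i j))).
move=> k; have [mF Fk] := Foo k; have [mG Gk] := Goo k; split.
  rewrite -[X in measurable X]setTI.
  by apply: measurable_rV_uncons => //; exact: measurableX.
rewrite /lebesgue_rVS/pushforward -comp_preimage.
rewrite (_ : _ \o _ = id); last by apply/funext => x; exact: rV_consK.
by rewrite preimage_id product_measure1E// lte_mul_pinfty// ge0_fin_numE.
Qed.

HB.instance Definition _ := Measure_isSigmaFinite.Build _ _ _ lebesgue_rVS
  lebesgue_rVS_sigma_finite.

End lebesgue_rVS.

Fixpoint lebesgue_rV (R : realType) n :
    {sigma_finite_measure set 'rV[R]_n -> \bar R} :=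
  match n with
  | 0 => \d_(0 : 'rV[R]_0)
  | n'.+1 => lebesgue_rVS (lebesgue_rV R n')
  end.

Lemma lebesgue_rV_box (R : realType) n (A : 'I_n -> set R) :
  (forall i, measurable (A i)) ->
  lebesgue_rV R n [set x | forall i, A i (x ord0 i)] =
    (\prod_(i < n) lebesgue_measure (A i))%E.
Proof.
elim: n A => [|n IH] A mA /=.
  by rewrite big_ord0 diracE mem_set// => -[].
rewrite big_ord_recl.
transitivity (((@lebesgue_measure R) \x lebesgue_rV R n)%E
    (A ord0 `*` [set y : 'rV[R]_n | forall i : 'I_n, A (lift ord0 i) (y ord0 i)])).
  congr (product_measure1 _ _ _); apply/seteqP; split=> -[x y] /=.
    move=> H; split; first by have := H ord0; rewrite rV_cons0.
    by move=> i; have := H (lift ord0 i); rewrite rV_consS.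
  by move=> [A0 AS] i; case: (unliftP ord0 i) => [j|] ->;
    rewrite ?rV_consS ?rV_cons0.
rewrite product_measure1E//; [by congr (_ * _)%E; exact: IH|exact: mA|].
have -> : [set y : 'rV[R]_n | forall i, A (lift ord0 i) (y ord0 i)] =
    \big[setI/setT]_(i < n) ((fun y : 'rV[R]_n => y ord0 i) @^-1` A (lift ord0 i)).
  apply/seteqP; split => y /=.
    by move=> Ay; apply: (big_ind (fun B : set _ => B y)) => // i _; exact: Ay.
  by move=> + i; rewrite (bigD1 i)//= => -[].
apply: big_ind => //; first exact: measurableI.
by move=> i _; rewrite -[X in measurable X]setTI; exact: measurable_coord.
Qed.

Section heat_system.
Context (R : realType) (N : nat).
Implicit Types (Omega omega : set 'rV[R]_N) (T : \bar R).
Implicit Types (Q : set ('rV[R]_N * R)) (u v phi : 'rV[R]_N * R -> R).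

Definition domain Omega := [/\ open Omega, connected Omega & Omega !=set0].

Definition compactly_contained omega Omega :=
  compact (closure omega) /\ closure omega `<=` Omega.

Definition cylinder Omega T : set ('rV[R]_N * R) :=
  [set z | [/\ Omega z.1, 0 < z.2 & (z.2%:E < T)%E]].

Definition lebesgue_spacetime := (lebesgue_rV R N \x @lebesgue_measure R)%E.

Definition ddt phi : 'rV[R]_N * R -> R := 'D_((0, 1) : 'rV[R]_N * R) phi.

Definition ddx (i : 'I_N) phi : 'rV[R]_N * R -> R :=
  'D_((delta_mx ord0 i, 0) : 'rV[R]_N * R) phi.

Definition laplacian phi : 'rV[R]_N * R -> R :=
  fun z => \sum_(i < N) ddx i (ddx i phi) z.

(* foldr iterates directional derivatives: all of them, of every order, exist
   and are continuous. *)
Definition smooth phi := forall s : seq ('rV[R]_N * R),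
  let psi := foldr (fun e f => 'D_e f) phi s in
  continuous psi /\ forall z e, derivable psi z e.

Definition test_function Q phi :=
  [/\ smooth phi, compact (closure [set z | phi z != 0])
    & closure [set z | phi z != 0] `<=` Q].

Definition locally_Lp (r : R) Q u := measurable_fun Q u /\
  forall K, compact K -> K `<=` Q ->
    lebesgue_spacetime.-integrable K (fun z => (`|u z| `^ r)%:E).

(* The weak form of u_t - laplacian u + f = 0 in Q.  The integral has to make
   sense for each phi: integrability is not implied by u in L^q_loc if q < 1. *)
Definition weak_heat_eq Q u (f : 'rV[R]_N * R -> R) := forall phi,
  test_function Q phi ->
  let F := fun z =>
    (- (u z * ddt phi z) - u z * laplacian phi z + f z * phi z)%:E in
  lebesgue_spacetime.-integrable Q F /\
  (\int[lebesgue_spacetime]_(z in Q) F z = 0)%E.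

Definition positive_solution Omega T (p q : R) u v :=
  let Q := cylinder Omega T in
  [/\ forall z, Q z -> 0 < u z /\ 0 < v z,
      locally_Lp q Q u, locally_Lp p Q v,
      weak_heat_eq Q u (fun z => v z `^ p)
    & weak_heat_eq Q v (fun z => u z `^ q)].

End heat_system.

(* Main.v *)
Require Import Defs.
From mathcomp Require Import all_boot all_order all_algebra.
From mathcomp Require Import all_classical all_reals all_analysis.
From mathcomp Require Import measurable_realfun.
From mathcomp Require Import ring lra.

Set Implicit Arguments.
Unset Strict Implicit.
Unset Printing Implicit Defensive.

Import Order.TTheory GRing.Theory Num.Theory.
Import numFieldNormedType.Exports.

Local Open Scope classical_set_scope.
Local Open Scope ring_scope.

(** The proof is a weighted integral argument: it uses neither a comparison
    principle nor any regularization of the solution.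

    Let [u, f >= 0] solve [u_t - Delta u + f = 0] weakly.  Two kinds of test
    functions give two estimates on a parabolic cylinder [C_r] of radius [r].
    - A plain cut-off gives [int_(C_(r/4N)) f <= C r^(-2) int_(C_r) u]
      ([absorption_integral_le]).
    - A cut-off backward heat kernel, with its pole just above a small cell,
      bounds the average of [u] over that cell by [C r^(-N-2) int_(C_r) u],
      uniformly in the cell ([cell_integral_le]); the absorption term has a
      sign and is dropped.  A nonnegative function whose averages over all
      small dyadic cells are at most [K] is at most [K] almost everywhere
      ([ae_le_of_cells]), so [u] is bounded by its average over a larger
      cylinder ([mean_value_le]).

    For the system, exchange the two equations if necessary so that [p <= q],
    whence [q >= 1].  Suppose [v <= m r^(-2b)] on [C_r].  The first estimate
    bounds the average of [u^q] by [C m r^(-2b-2)], and the second one then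
    gives [u <= C m^(1/q) r^(-2a)] on a smaller cylinder, since
    [2b + 2 = 2aq].  The same argument applied to [v^p], where
    [2a + 2 = 2bp], returns to [v] with [v <= C m^theta r^(-2b)] and
    [theta = 1 - rho + rho / (pq)], [rho = min(p, 1)]; when [p < 1] the bound
    already known for [v] is used to pass from [v^p] to [v].  The hypothesis
    [pq > 1] says exactly that [theta < 1] ([system_improve]).

    Because of the scaling [r^(-2b)], the loss of radius costs only constants:
    if [m] is admissible in [v <= m r^(-2b)] for all [r] and all points at
    parabolic distance at least [r] from the parabolic boundary of a fixed
    box, then so is [C m^theta].  Hence every finite admissible constant
    improves to a universal one ([sublinear_iteration], [tube_estimate]); that
    some finite constant is admissible is the qualitative local boundedness of
    the solution ([absorption_locally_bounded]).

    At [(x, t)] with [x] in [omega] there is room for [r = c sqrt t], and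
    [r^(-2a)], [r^(-2b)] become [t^(-a)], [t^(-b)].  The bounds hold near
    each point of the cylinder up to a null set, hence almost everywhere by a
    countable cover with grid cells, and everywhere for continuous
    solutions. *)

(** * Calculus of smooth real functions on a normed space *)

Lemma near_eq_differentiable (R : realType) (V W : normedModType R)
    (f g : V -> W) (z : V) :
  (\near z, f z = g z) -> differentiable f z -> differentiable g z.
Proof.
move=> fg df.
have fgz : f z = g z by exact: nbhs_singleton fg.
have eqg : g \o shift z = cst (g z) + 'd f z +o_ 0 id.
  apply/eqaddoP => _/posnumP[e].
  have /eqaddoP/(_ e%:num (gt0 e)) := diff_locally df.
  apply: filter_app.
  have : \forall h \near (0 : V), f (h + z) = g (h + z).
    move: fg; rewrite (near_shift 0)/=.
    by apply: filterS => h /=; rewrite subr0.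
  by apply: filterS => h /= fgh; rewrite !fctE/= fgh fgz.
have dg : 'd g z = 'd f z :> (V -> W).
  by apply: diff_unique => //; exact: diff_continuous.
apply/diff_locallyP; split; first by rewrite dg; exact: diff_continuous.
by rewrite dg.
Qed.

Section Ck.
Context (R : realType) (V : normedModType R).
Implicit Types (U : set V) (f g : V -> R).

(** Recursion on directional derivatives, instead of on the differential,
    keeps every function real-valued, which is also the form in which [smooth]
    iterates derivatives. *)
Fixpoint Ck n U f : Prop :=
  if n is m.+1 then (forall z, U z -> differentiable f z) /\
                    forall e, Ck m U ('D_e f)
  else True.

Lemma Ck_ext n U f g : open U -> (forall z, U z -> f z = g z) ->
  Ck n U f -> Ck n U g.
Proof.
move=> oU; elim: n f g => [//|n IH] f g fg [df Df]; split.
  move=> z Uz; apply: near_eq_differentiable (df z Uz).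
  by apply: filterS (open_nbhs_nbhs (conj oU Uz)) => y; exact: fg.
move=> e; apply: IH (Df e) => z Uz; apply: near_eq_derive.
by apply: filterS (open_nbhs_nbhs (conj oU Uz)) => y; exact: fg.
Qed.

(** Serves for functions given by different formulas on two overlapping open
    sets, such as a formula singular at [t = 0] that is continued by [0]. *)
Lemma Ck_glue n U W f : Ck n U f -> Ck n W f -> Ck n (U `|` W) f.
Proof.
elim: n f => [//|n IH] f [dU DU] [dW DW]; split.
  by move=> z [/dU|/dW].
by move=> e; exact: IH (DU e) (DW e).
Qed.

Lemma CkW n U f : Ck n.+1 U f -> Ck n U f.
Proof.
elim: n f => [//|n IH] f [df Df]; split => // e.
exact/IH/Df.
Qed.

Lemma Ck_cst n U (c : R) : open U -> Ck n U (fun=> c).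
Proof.
move=> oU; elim: n c => [//|n IH] c; split => [z _|e].
  exact: differentiable_cst.
by apply: Ck_ext (IH 0) => // z _; rewrite derive_cst.
Qed.

Lemma Ck_add n U f g : open U -> Ck n U f -> Ck n U g ->
  Ck n U (fun z => f z + g z).
Proof.
move=> oU; elim: n f g => [//|n IH] f g [df Df] [dg Dg].
split => [z Uz|e]; first by apply: differentiableD; [exact: df|exact: dg].
apply: Ck_ext (IH _ _ (Df e) (Dg e)) => // z Uz.
by rewrite [RHS]deriveD//; apply: diff_derivable; [exact: df|exact: dg].
Qed.

Lemma Ck_mul n U f g : open U -> Ck n U f -> Ck n U g ->
  Ck n U (fun z => f z * g z).
Proof.
move=> oU; elim: n f g => [//|n IH] f g Cf Cg.
have [[df Df] [dg Dg]] := (Cf, Cg).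
split => [z Uz|e]; first by apply: differentiableM; [exact: df|exact: dg].
have := Ck_add oU (IH _ _ (CkW Cf) (Dg e)) (IH _ _ (CkW Cg) (Df e)).
apply: Ck_ext => // z Uz.
by rewrite [RHS]deriveM//; apply: diff_derivable; [exact: df|exact: dg].
Qed.

Lemma Ck_sum n U m (f : 'I_m -> V -> R) : open U ->
  (forall i, Ck n U (f i)) -> Ck n U (fun z => \sum_(i < m) f i z).
Proof.
move=> oU; elim: m f => [|m IH] f Cf.
  by apply: Ck_ext (Ck_cst n 0 oU) => // z _; rewrite big_ord0.
apply: Ck_ext (Ck_add oU (Cf ord0) (IH (fun i => f (lift ord0 i)) _)) => //.
by move=> z _; rewrite big_ord_recl.
Qed.

Lemma derive_comp1 f (z e : V) (F : R -> R) d : differentiable f z ->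
  is_derive (f z) 1 F d ->
  differentiable (F \o f) z /\ 'D_e (F \o f) z = d * 'D_e f z.
Proof.
move=> df [dF Fd]; have dF' : differentiable F (f z) by exact/derivable1_diffP.
split; first exact: differentiable_comp.
rewrite deriveE; last exact: differentiable_comp.
rewrite diff_comp//= deriveE//.
set y : R := ('d f z e : R).
have -> : (y : R^o) = y *: (1 : R^o) by rewrite /GRing.scale/= mulr1.
rewrite linearZ /= -deriveE// Fd /GRing.scale/= mulr1; exact: mulrC.
Qed.

(** The outer function comes with the whole sequence of its derivatives, so
    that the chain rule closes under induction on the order; [f] only has to
    take its values where that sequence is valid. *)
Lemma Ck_comp1 n U f (G : nat -> R -> R) : open U ->
  (forall k z, U z -> is_derive (f z) 1 (G k) (G k.+1 (f z))) ->
  Ck n U f -> forall k, Ck n U (G k \o f).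
Proof.
move=> oU dG; elim: n f dG => [//|n IH] f dG Cf k.
have [df Df] := Cf.
split => [z Uz|e].
  by have [] := derive_comp1 0 (df z Uz) (dG k z Uz).
apply: Ck_ext (Ck_mul oU (IH f dG (CkW Cf) k.+1) (Df e)) => // z Uz.
by have [_ ->] := derive_comp1 e (df z Uz) (dG k z Uz).
Qed.

Lemma Ck_expR n U f : open U -> Ck n U f -> Ck n U (fun z => expR (f z)).
Proof.
move=> oU Cf; apply: (@Ck_comp1 n U f (fun=> expR) oU _ Cf 0).
Qed.

Lemma Ck_inv n U f : open U -> (forall z, U z -> f z != 0) ->
  Ck n U f -> Ck n U (fun z => (f z)^-1).
Proof.
move=> oU f0; elim: n => [//|n IH] Cf; have [df Df] := Cf.
split => [z Uz|e]; first by apply: differentiableV; [exact: df|exact: f0].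
have Ci := IH (CkW Cf).
apply: Ck_ext (Ck_mul oU (Ck_cst n (-1) oU) (Ck_mul oU (Ck_mul oU Ci Ci)
  (Df e))) => // z Uz.
rewrite deriveV; [|exact: f0|by apply: diff_derivable; exact: df].
by rewrite /GRing.scale/= expr2 invfM mulN1r mulNr.
Qed.

Lemma Ck_ln n U f : open U -> (forall z, U z -> 0 < f z) ->
  Ck n U f -> Ck n U (fun z => ln (f z)).
Proof.
move=> oU f0; elim: n => [//|n IH] Cf; have [df Df] := Cf.
have dl z (Uz : U z) : is_derive (f z) 1 (@ln R) (f z)^-1.
  by apply: is_derive1_ln; exact: f0.
split => [z Uz|e].
  by have [] := derive_comp1 0 (df z Uz) (dl z Uz).
have Ci := Ck_inv oU (fun z Uz => lt0r_neq0 (f0 z Uz)) (CkW Cf).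
apply: Ck_ext (Ck_mul oU Ci (Df e)) => // z Uz.
by have [_ ->] := derive_comp1 e (df z Uz) (dl z Uz).
Qed.

End Ck.

Lemma Ck_comp_affine (R : realType) (V : normedModType R) n (f : V -> R)
    (L l : V -> V) :
  (forall z : V, is_diff z L l) -> Ck n setT f -> Ck n setT (f \o L).
Proof.
move=> dL; elim: n f => [//|n IH] f [df Df].
split => [z _|e].
  by apply: differentiable_comp => //; exact: df.
apply: Ck_ext (IH _ (Df (l e))) => [|z _]; first exact: openT.
rewrite [RHS]deriveE; last by apply: differentiable_comp => //; exact: df.
rewrite diff_comp//=; last exact: df.
by rewrite diff_val /= deriveE//; exact: df.
Qed.

Lemma derive_comp_affine (R : realType) (V : normedModType R) (f : V -> R)
    (L l : V -> V) (z e : V) :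
  is_diff z L l -> differentiable f (L z) ->
  'D_e (f \o L) z = 'D_(l e) f (L z).
Proof.
move=> dL df; rewrite deriveE; last exact: differentiable_comp.
by rewrite diff_comp//= diff_val /= deriveE.
Qed.

Lemma deriveZ_dir (R : realType) (V : normedModType R) (f : V -> R) (z e : V) c :
  differentiable f z -> 'D_(c *: e) f z = c * 'D_e f z.
Proof. by move=> df; rewrite !deriveE// linearZ. Qed.

Lemma smooth_Ck (R : realType) N (f : 'rV[R]_N * R -> R) :
  (forall n, Ck n setT f) -> smooth f.
Proof.
move=> Cf s.
have Cs n : Ck n setT (foldr (fun e g => 'D_e g) f s).
  elim: s n => [|e s IH] n; first exact: Cf.
  by have [_ /(_ e)] := IH n.+1.
have [d _] := Cs 1%N; split => z; first exact/differentiable_continuous/d.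
by move=> e; apply: diff_derivable; exact: d.
Qed.

(** * Flat functions and the plateau cut-off *)

Section flat.
Context (R : realType).
Implicit Types (P : {poly R}) (x : R).

(** The class of these functions contains [expR (- x^-1)] extended by [0] and
    is stable under differentiation. *)
Definition flat P x : R := if 0 < x then P.[x^-1] * expR (- x^-1) else 0.

Lemma exprn_expRN n (y : R) : 0 <= y -> y ^+ n * expR (- y) <= n`!%:R.
Proof.
move=> y0; rewrite expRN ler_pdivrMr ?expR_gt0//.
case: n => [|n]; first by rewrite expr0 fact0 mul1r -expR0 ler_expR.
have f0 : 0 < (n.+1)`!%:R :> R by rewrite ltr0n fact_gt0.
have := expR_ge1Dxn n y0; rewrite -(ler_pM2l f0); apply: le_trans.
by rewrite mulrDr mulr1 [_ * (_ / _)]mulrC divfK ?gt_eqF// lerDr ltW.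
Qed.

(** The exponential beats every power of [x^-1]. The bound by [x ^+ 2] is what
    makes the derivative at the origin vanish. *)
Lemma flat_bound P : exists2 C, 0 <= C & forall x,
  `|flat P x| <= C /\ `|flat P x| <= C * x ^+ 2.
Proof.
pose C : R := \sum_(i < size P) `|P`_i| * ((i`!)%:R + (i.+2`!)%:R).
have C0 : 0 <= C by apply: sumr_ge0 => i _; rewrite mulr_ge0// addr_ge0.
exists C => // x; rewrite /flat; case: ifPn => x0; last first.
  by rewrite normr0 mulr_ge0 ?sqr_ge0.
set y := x^-1; have y0 : 0 < y by rewrite invr_gt0.
have PE : `|P.[y] * expR (- y)| <=
    \sum_(i < size P) `|P`_i| * (y ^+ i * expR (- y)).
  rewrite horner_coef mulr_suml; apply: (le_trans (ler_norm_sum _ _ _)).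
  apply: ler_sum => i _; rewrite -mulrA normrM ler_wpM2l//.
  by rewrite ger0_norm// mulr_ge0 ?expR_ge0// exprn_ge0// ltW.
split; apply: (le_trans PE).
  apply: ler_sum => i _; rewrite ler_wpM2l//.
  by rewrite (le_trans (exprn_expRN _ (ltW y0)))// lerDl.
rewrite mulr_suml; apply: ler_sum => i _; rewrite -mulrA ler_wpM2l//.
have -> : y ^+ i * expR (- y) = (y ^+ i.+2 * expR (- y)) * x ^+ 2.
  by rewrite -addn2 exprD /y; field; rewrite gt_eqF.
rewrite ler_wpM2r ?sqr_ge0//.
by rewrite (le_trans (exprn_expRN _ (ltW y0)))// lerDr.
Qed.

(** On polynomials in [x^-1], differentiation is [P |-> X^2 (P - P')]; at the
    origin the quadratic bound takes over. *)
Lemma is_derive_flat P x : is_derive x 1 (flat P) (flat ('X^2 * (P - P^`())) x).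
Proof.
case: (ltgtP x 0) => [x0|x0|->].
- apply: (@near_eq_is_derive _ _ _ (cst 0)).
    near=> y; rewrite /flat ifF//; apply/negbTE; rewrite -leNgt ltW//.
    by near: y; exact: lt_nbhsl.
  by rewrite {1}/flat ltNge ltW//=; exact: is_derive_cst.
- apply: (@near_eq_is_derive _ _ _ (fun y : R => (P.[y^-1] * expR (- y^-1) : R))).
    near=> y; rewrite /flat ifT//.
    by near: y; exact: lt_nbhsr.
  rewrite {1}/flat x0.
  have dV : is_derive x 1 (fun y : R => y^-1) (- x ^- 2).
    apply: is_derive_eq; first by apply: is_deriveV; rewrite gt_eqF.
    by rewrite /GRing.scale/= mulr1.
  have dP := is_derive1_comp (is_derive_poly P x^-1) dV.
  have dE := @is_derive1_comp _ expR (fun y : R => - y^-1) x _ _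
    (is_derive_expR (- x^-1)) (is_deriveN dV).
  have dM := is_deriveM dP dE.
  apply: (is_derive_eq dM).
  rewrite /GRing.scale/= hornerM hornerD hornerN hornerXn.
  have := gt_eqF x0; move: (P.[_]) (P^`().[_]) (expR _) => a b c xn0.
  by field; rewrite xn0.
- have -> : flat ('X^2 * (P - P^`())) 0 = 0 by rewrite /flat ltxx.
  have [C C0 CE] := flat_bound P.
  have f0 : flat P 0 = 0 by rewrite /flat ltxx.
  have cv : (fun h : R => h^-1 *: ((flat P \o shift 0) (h *: 1) - flat P 0)) @ 0^'
      --> (0 : R).
    apply/cvgrPdist_le => e e0; near=> h.
    rewrite sub0r normrN /= f0 subr0 addr0 /GRing.scale/= mulr1 normrM.
    have h0 : h != 0 by near: h; exact: nbhs_dnbhs_neq.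
    have [_ H] := CE h.
    apply: (le_trans (ler_wpM2l (normr_ge0 _) H)).
    rewrite -(real_normK (num_real h)) expr2 normfV mulrCA mulKf ?normr_eq0//.
    have h1 : `|h| <= e / (C + 1).
      by near: h; apply: dnbhs0_le; rewrite divr_gt0// ltr_wpDl.
    rewrite (le_trans (ler_wpM2l C0 h1))// mulrA ler_pdivrMr ?ltr_wpDl//.
    by rewrite mulrC ler_pM2l// lerDl.
  by split; [apply/cvg_ex; exists 0|exact: cvg_lim cv].
Unshelve. all: by end_near. Qed.

End flat.

Section bump.
Context (R : realType).
Implicit Types x : R.

(** [flat_exp k] is the [k]-th derivative of the flat function [flat_exp 0]. *)
Definition flat_exp (k : nat) : R -> R :=
    flat (iter k (fun P => 'X^2 * (P - P^`())) 1).
Notation g := (flat_exp 0).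

Lemma is_derive_flat_exp k x : is_derive x 1 (flat_exp k) (flat_exp k.+1 x).
Proof. exact: is_derive_flat. Qed.

Lemma flat_expE x : 0 < x -> g x = expR (- x^-1).
Proof. by move=> x0; rewrite /flat_exp/= /flat x0 hornerC mul1r. Qed.

Lemma flat_exp_le0 k x : x <= 0 -> flat_exp k x = 0.
Proof. by move=> x0; rewrite /flat_exp /flat ltNge x0. Qed.

Lemma flat_exp_ge0 x : 0 <= g x.
Proof.
case: (ltP 0 x) => x0; last by rewrite flat_exp_le0.
by rewrite flat_expE// expR_ge0.
Qed.

Lemma flat_exp_gt0 x : 0 < x -> 0 < g x.
Proof. by move=> x0; rewrite flat_expE// expR_gt0. Qed.

Lemma flat_exp_le1 x : g x <= 1.
Proof.
case: (ltP 0 x) => x0; last by rewrite flat_exp_le0.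
by rewrite flat_expE// -expR0 ler_expR oppr_le0 invr_ge0 ltW.
Qed.

Lemma flat_exp_mono x y : x <= y -> g x <= g y.
Proof.
move=> xy; case: (ltP 0 x) => x0; last by rewrite flat_exp_le0// flat_exp_ge0.
have y0 := lt_le_trans x0 xy.
by rewrite !flat_expE// ler_expR lerN2 lef_pV2.
Qed.

Lemma flat_exp1E x : 0 < x -> flat_exp 1 x = (x^-1) ^+ 2 * expR (- x^-1).
Proof.
move=> x0; rewrite /flat_exp/= /flat x0 derivC subr0 mulr1.
by rewrite hornerXn.
Qed.

Lemma flat_exp1_ge0 x : 0 <= flat_exp 1 x.
Proof.
case: (ltP 0 x) => x0; last by rewrite flat_exp_le0.
by rewrite flat_exp1E// mulr_ge0 ?sqr_ge0 ?expR_ge0.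
Qed.

Lemma flat_exp_bounded k : exists2 C, 0 <= C & forall x, `|flat_exp k x| <= C.
Proof.
by have [C C0 H] := flat_bound (iter k (fun P : {poly R} => 'X^2 * (P - P^`())) 1);
  exists C => // x; have [] := H x.
Qed.

Lemma Ck_flat_exp (V : normedModType R) n (U : set V) (f : V -> R) k : open U ->
  Ck n U f -> Ck n U (fun z => flat_exp k (f z)).
Proof.
move=> oU Cf; apply: (@Ck_comp1 _ _ n U f flat_exp oU _ Cf k) => j z _.
exact: is_derive_flat_exp.
Qed.

(** The inner [g x] is [0] for [x <= 0] and at least [g 1] for [x >= 1], so
    this smooth function is constant before [0] and vanishes after [1];
    [plateau1] and [plateau2] are its first two derivatives. *)
Definition plateau x : R := g (g 1 - g x).
Definition plateau1 x : R := - (flat_exp 1 (g 1 - g x) * flat_exp 1 x).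
Definition plateau2 x : R := flat_exp 2 (g 1 - g x) * flat_exp 1 x ^+ 2
    - flat_exp 1 (g 1 - g x) * flat_exp 2 x.

Lemma is_derive_plateau x : is_derive x 1 plateau (plateau1 x).
Proof.
have dg : is_derive x 1 (fun y => g 1 - g y) (0 - flat_exp 1 x).
  by apply: is_deriveB; exact: is_derive_flat_exp.
have H := @is_derive1_comp _ g (fun y => g 1 - g y) x _ _
    (is_derive_flat_exp 0 (g 1 - g x)) dg.
by apply: (is_derive_eq H); rewrite sub0r mulrN.
Qed.

Lemma is_derive_plateau1 x : is_derive x 1 plateau1 (plateau2 x).
Proof.
have dg : is_derive x 1 (fun y => g 1 - g y) (0 - flat_exp 1 x).
  by apply: is_deriveB; exact: is_derive_flat_exp.
have H := is_deriveN
  (is_deriveM (@is_derive1_comp _ (flat_exp 1) (fun y => g 1 - g y)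
  x _ _ (is_derive_flat_exp 1 (g 1 - g x)) dg) (is_derive_flat_exp 1 x)).
by apply: (is_derive_eq H); rewrite /plateau2/= /GRing.scale/=; ring.
Qed.

Lemma plateau_le0 x : x <= 0 -> plateau x = g (g 1).
Proof. by move=> x0; rewrite /plateau (flat_exp_le0 0 x0) subr0. Qed.

Lemma plateau_ge1 x : 1 <= x -> plateau x = 0.
Proof. by move=> x1; rewrite /plateau flat_exp_le0// subr_le0 flat_exp_mono. Qed.

Lemma plateau_gt0 : 0 < g (g 1).
Proof. by rewrite !flat_exp_gt0. Qed.

Lemma plateau_ge0 x : 0 <= plateau x. Proof. exact: flat_exp_ge0. Qed.
Lemma plateau_le1 x : plateau x <= 1. Proof. exact: flat_exp_le1. Qed.

Lemma plateau1_out x : x <= 0 \/ 1 <= x -> plateau1 x = 0.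
Proof.
move=> [x0|x1]; rewrite /plateau1;
  first by rewrite (@flat_exp_le0 1 x)// mulr0 oppr0.
by rewrite flat_exp_le0 ?subr_le0 ?flat_exp_mono// mul0r oppr0.
Qed.

Lemma plateau2_out x : x <= 0 \/ 1 <= x -> plateau2 x = 0.
Proof.
move=> [x0|x1]; rewrite /plateau2;
  first by rewrite !(@flat_exp_le0 _ x)// expr0n/= !mulr0 subrr.
by rewrite !(@flat_exp_le0 _ (_ - _)) ?subr_le0 ?flat_exp_mono// !mul0r subrr.
Qed.

Lemma plateau_bounded : exists2 C, 0 <= C &
    forall x, `|plateau1 x| <= C /\ `|plateau2 x| <= C.
Proof.
have [C1 C10 H1] := flat_exp_bounded 1; have [C2 C20 H2] := flat_exp_bounded 2.
exists (C1 * C1 + C2 * C1 ^+ 2 + C1 * C2) => [|x].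
  by rewrite !addr_ge0// ?mulr_ge0 ?sqr_ge0.
split; rewrite /plateau1 /plateau2 ?normrN.
  by rewrite normrM -addrA ler_wpDr ?ler_pM// addr_ge0// ?mulr_ge0 ?sqr_ge0.
rewrite (le_trans (ler_normB _ _))// -addrA ler_wpDl ?mulr_ge0// !normrM.
by rewrite lerD ?ler_pM// normrX lerXn2r ?nnegrE.
Qed.

Lemma Ck_plateau (V : normedModType R) n (U : set V) (f : V -> R) : open U ->
  Ck n U f -> Ck n U (fun z => plateau (f z)).
Proof.
move=> oU Cf; apply: Ck_flat_exp => //.
apply: Ck_ext (Ck_add oU (Ck_cst n (g 1) oU)
  (Ck_mul oU (Ck_cst n (-1) oU) (Ck_flat_exp 0 oU Cf))) => // z _.
by rewrite mulN1r.
Qed.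

End bump.

(** * Space-time functions of |x|^2 and t *)

(** Reduces directional derivatives to derivatives along a line, where the
    one-variable rules apply. *)
Lemma is_derive_dirP (R : realType) (V : normedModType R) (f : V -> R) (z e : V) d :
  is_derive z e f d <-> is_derive (0 : R) 1 (fun h : R => f (h *: e + z)) d.
Proof.
have E : 'D_e f z = 'D_1 (fun h : R => f (h *: e + z)) 0.
  rewrite /derive; suff -> : (fun h : R => h^-1 *: (((fun h : R => f (h *: e + z))
      \o shift 0) (h *: 1) - f (0 *: e + z))) =
      (fun h : R => h^-1 *: ((f \o shift z) (h *: e) - f z)) by [].
  apply/funext => h /=.
  by rewrite addr0 scale0r add0r /GRing.scale/= mulr1.
split=> -[df fd]; split.
- by apply: (derivable1P _ _ _).1.
- exact: etrans (esym E) fd.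
- by apply: (derivable1P _ _ _).2.
- exact: etrans E fd.
Qed.

Lemma is_derive_chain (R : realType) (V : normedModType R) (F : R -> R)
    (f : V -> R) (z e : V) a b :
  is_derive (f z) 1 F a -> is_derive z e f b ->
  is_derive z e (fun y => F (f y)) (a * b).
Proof.
move=> dF /is_derive_dirP df; apply/is_derive_dirP.
have E : f z = (fun h : R => f (h *: e + z)) 0 by rewrite scale0r add0r.
by rewrite E in dF; exact: (is_derive1_comp dF df).
Qed.

Section spacetime.
Context (R : realType) (N : nat).
Local Notation ST := ('rV[R]_N * R)%type.
Implicit Types (z e : ST).

Lemma is_derive_time z e : is_derive z e (fun y : ST => y.2) e.2.
Proof.
apply/is_derive_dirP => /=.
have H := is_deriveD (is_deriveM (is_derive_id (0:R) 1) (is_derive_cst e.2 (0:R) 1))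
  (is_derive_cst z.2 (0:R) 1).
apply: (is_derive_eq H); rewrite /GRing.scale/= mulr0 mulr1; ring.
Qed.

Lemma is_derive_coord i z e : is_derive z e (fun y : ST => y.1 ord0 i) (e.1 ord0 i).
Proof.
apply/is_derive_dirP => /=.
under eq_fun do rewrite !mxE.
have H := is_deriveD (is_deriveM (is_derive_id (0:R) 1)
  (is_derive_cst (e.1 ord0 i) (0:R) 1)) (is_derive_cst (z.1 ord0 i) (0:R) 1).
apply: (is_derive_eq H); rewrite /GRing.scale/= mulr0 mulr1; ring.
Qed.

Lemma Ck_affine n (U : set ST) (f : ST -> R) (c : ST -> R) : open U ->
  (forall z, differentiable f z) -> (forall z e, is_derive z e f (c e)) ->
  Ck n U f.
Proof.
move=> oU df fc; case: n => [//|n]; split => // e.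
apply: Ck_ext (Ck_cst n (c e) oU) => // z _.
by apply/esym; have [_] := fc z e.
Qed.

Lemma Ck_time n U : open U -> Ck n U (fun y : ST => y.2).
Proof.
move=> oU; apply: (Ck_affine n oU (c := fun e => e.2)); last exact: is_derive_time.
by move=> z; apply: linear_differentiable => x; exact: cvg_snd.
Qed.

Lemma Ck_coord n U i : open U -> Ck n U (fun y : ST => y.1 ord0 i).
Proof.
move=> oU; apply: (Ck_affine n oU (c := fun e => e.1 ord0 i));
  last exact: is_derive_coord.
move=> z; apply: (@differentiable_comp _ _ _ _ fst (fun x : 'rV[R]_N => x ord0 i)).
  by apply: linear_differentiable => x; exact: cvg_fst.
exact: differentiable_coord.
Qed.

Definition sq z : R := \sum_(i < N) z.1 ord0 i ^+ 2.

Lemma Ck_sq n U : open U -> Ck n U sq.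
Proof.
move=> oU; apply: Ck_sum => // i; have C := Ck_coord n i oU.
by apply: Ck_ext (Ck_mul oU C C) => // z _; rewrite expr2.
Qed.

Lemma sq_ge0 z : 0 <= sq z.
Proof. by apply: sumr_ge0 => i _; rewrite sqr_ge0. Qed.

Lemma is_derive_sq z e :
  is_derive z e sq (\sum_(i < N) 2 * z.1 ord0 i * e.1 ord0 i).
Proof.
have H := is_derive_sum (fun i : 'I_N => is_deriveM (is_derive_coord i z e)
  (is_derive_coord i z e)).
have -> : sq = \sum_(i < N) ((fun y : ST => y.1 ord0 i) * (fun y : ST =>
  y.1 ord0 i)).
  by apply/funext => y; rewrite fct_sumE; apply: eq_bigr => i _; rewrite expr2.
apply: (is_derive_eq H).
by apply: eq_bigr => i _; rewrite /GRing.scale/=; ring.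
Qed.

Definition dt : ST := (0, 1).
Definition dx (i : 'I_N) : ST := (delta_mx ord0 i, 0).

Lemma is_derive_sq_dt z : is_derive z dt sq 0.
Proof.
by apply: (is_derive_eq (is_derive_sq z dt)); apply: big1 => i _; rewrite mxE mulr0.
Qed.

Lemma is_derive_sq_dx i z : is_derive z (dx i) sq (2 * z.1 ord0 i).
Proof.
apply: (is_derive_eq (is_derive_sq z (dx i)));
  rewrite (bigD1 i)//= !mxE !eqxx mulr1.
by rewrite big1 ?addr0// => j ji; rewrite mxE eqxx/= (negbTE ji) mulr0.
Qed.

(** The common shape of all the test functions: a Gaussian whose width depends
    on time, with a cut-off in [t] and one in [|x|^2]. Since [x] enters
    through [|x|^2] only, the Laplacian is explicit. *)
Definition profile (A B k : R -> R) z : R :=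
  A z.2 * (k (sq z) * expR (- (sq z * B z.2))).

Lemma ddt_profile (A B k : R -> R) A' B' k' z : is_derive z.2 1 A A' ->
  is_derive z.2 1 B B' -> is_derive (sq z) 1 k k' ->
  ddt (profile A B k) z =
  (A' - sq z * A z.2 * B') * k (sq z) * expR (- (sq z * B z.2)).
Proof.
move=> dA dB dk.
have dt2 : is_derive z dt (fun y : ST => y.2) 1 := is_derive_time z dt.
have dAz := is_derive_chain dA dt2.
have dBz := is_derive_chain dB dt2.
have ds := is_derive_sq_dt z.
have dkz := is_derive_chain dk ds.
have dE := @is_derive_chain _ _ expR (fun y => - (sq y * B y.2)) z dt _ _
  (is_derive_expR _) (is_deriveN (is_deriveM ds dBz)).
have H := is_deriveM dAz (is_deriveM dkz dE).
apply: etrans (derive_val (is_derive := H)) _.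
by rewrite /GRing.scale/= !mulrfctE; ring.
Qed.

Lemma is_derive_profile_dx (A B k : R -> R) k' i z : is_derive (sq z) 1 k k' ->
  is_derive z (dx i) (profile A B k)
    (2 * z.1 ord0 i * (A z.2 * ((k' - B z.2 * k (sq z)) *
      expR (- (sq z * B z.2))))).
Proof.
move=> dk.
have dcst (F : R -> R) : is_derive z (dx i) (fun y : ST => F y.2) 0.
  apply/is_derive_dirP; have -> : (fun h : R => F (h *: dx i + z).2) = cst (F z.2).
    by apply/funext => h /=; rewrite scaler0 add0r.
  exact: is_derive_cst.
have dAz := dcst A.
have dBz := dcst B.
have ds := is_derive_sq_dx i z.
have dkz := is_derive_chain dk ds.
have dE := @is_derive_chain _ _ expR (fun y => - (sq y * B y.2)) z (dx i) _ _
  (is_derive_expR _) (is_deriveN (is_deriveM ds dBz)).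
have H := is_deriveM dAz (is_deriveM dkz dE).
apply: (is_derive_eq H).
by rewrite /GRing.scale/= !mulrfctE; ring.
Qed.

Lemma ddx_profile (A B k k1 : R -> R) i : (forall s : R, is_derive s 1 k (k1 s)) ->
  ddx i (profile A B k) = (fun z => 2 * z.1 ord0 i *
    (profile A B k1 z - profile (fun t => A t * B t) B k z)).
Proof.
move=> dk; apply/funext => z.
apply: etrans (derive_val (is_derive := is_derive_profile_dx A B i (dk (sq z)))) _.
by rewrite /profile; ring.
Qed.

Lemma laplacian_profile (A B k k1 k2 : R -> R) z :
  (forall s : R, is_derive s 1 k (k1 s)) ->
    (forall s : R, is_derive s 1 k1 (k2 s)) ->
  laplacian (profile A B k) z = A z.2 * expR (- (sq z * B z.2)) *
   (2 * N%:R * (k1 (sq z) - B z.2 * k (sq z)) +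
    4 * sq z * (k2 (sq z) - 2 * B z.2 * k1 (sq z) + B z.2 ^+ 2 * k (sq z))).
Proof.
move=> dk dk1; rewrite /laplacian.
set E := expR _; set s := sq z; set a := A z.2; set b := B z.2.
pose P := 2 * (k1 s - b * k s); pose Q := 4 * (k2 s - 2 * b * k1 s + b ^+ 2 * k s).
transitivity (\sum_(i < N) (a * E * P + a * E * Q * z.1 ord0 i ^+ 2)).
  apply: eq_bigr => i _; rewrite (ddx_profile _ _ _ dk).
  have d1 := is_derive_profile_dx A B i (dk1 (sq z)).
  have d2 := is_derive_profile_dx (fun t => A t * B t) B i (dk (sq z)).
  have dz := is_deriveM (is_derive_cst (2:R) z (dx i)) (is_derive_coord i z (dx i)).
  have H := is_deriveM dz (is_deriveB d1 d2).
  apply: etrans (derive_val (is_derive := H)) _.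
  rewrite /GRing.scale/= !mxE !eqxx/= /profile !fctE/= -/s -/a -/b -/E /P /Q.
  by ring.
rewrite big_split/= sumr_const card_ord -mulr_sumr -/s /P /Q -/(sq z) -/s
  -mulr_natl.
ring.
Qed.

Lemma Ck_profile n U (A B k : R -> R) : open U ->
  Ck n U (fun z : ST => A z.2) -> Ck n U (fun z : ST => B z.2) ->
  Ck n U (fun z : ST => k (sq z)) -> Ck n U (profile A B k).
Proof.
move=> oU CA CB Ck'; apply: Ck_mul => //; apply: Ck_mul => //.
apply: Ck_expR => //.
apply: Ck_ext (Ck_mul oU (Ck_cst n (-1) oU) (Ck_mul oU (Ck_sq n oU) CB)) => // z _.
by rewrite mulN1r.
Qed.

(** The factors may be negative: a negative [d] reverses time and turns a
    forward kernel into a backward one. *)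
Definition rescale (c d : R) (z0 z : ST) : ST :=
  (c *: (z.1 - z0.1), d * (z.2 - z0.2)).

Lemma is_diff_rescale c d z0 z :
  is_diff z (rescale c d z0) (fun e => (c *: e.1, d * e.2)).
Proof.
have df : is_diff z (fun y : ST => y.1) (fun e => e.1).
  split; last by rewrite diff_lin// => x; exact: cvg_fst.
  by apply: linear_differentiable => x; exact: cvg_fst.
have ds : is_diff z (fun y : ST => y.2) (fun e => e.2).
  split; last by rewrite diff_lin// => x; exact: cvg_snd.
  by apply: linear_differentiable => x; exact: cvg_snd.
have H := is_diff_pair (is_diffZ c (is_diffB df (is_diff_cst z0.1 z)))
  (is_diffZ d (is_diffB ds (is_diff_cst z0.2 z))).
have -> : (fun e : ST => (c *: e.1, d * e.2)) =
  (fun e : ST => (c *: (e.1 - 0), d *: (e.2 - 0))).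
  by apply/funext => e; rewrite !subr0.
exact: H.
Qed.

Lemma ddt_rescale f c d z0 z : differentiable f (rescale c d z0 z) ->
  ddt (f \o rescale c d z0) z = d * ddt f (rescale c d z0 z).
Proof.
move=> df; rewrite /ddt (derive_comp_affine _ (is_diff_rescale c d z0 z))//=.
have -> : c *: (0 : 'rV[R]_N) = d *: 0 by rewrite !scaler0.
exact: (@deriveZ_dir _ _ _ _ ((0, 1) : ST) d df).
Qed.

Lemma ddx_rescale f c d z0 i z : differentiable f (rescale c d z0 z) ->
  ddx i (f \o rescale c d z0) z = c * ddx i f (rescale c d z0 z).
Proof.
move=> df; rewrite /ddx (derive_comp_affine _ (is_diff_rescale c d z0 z))//=.
have -> : d * 0 = c * 0 by rewrite !mulr0.
exact: (@deriveZ_dir _ _ _ _ ((delta_mx ord0 i, 0) : ST) c df).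
Qed.

Lemma laplacian_rescale f c d z0 z : Ck 2 setT f ->
  laplacian (f \o rescale c d z0) z = c ^+ 2 * laplacian f (rescale c d z0 z).
Proof.
move=> [df Df]; rewrite /laplacian mulr_sumr; apply: eq_bigr => i _.
have -> : ddx i (f \o rescale c d z0) = (fun y => c * y) \o
  (ddx i f \o rescale c d z0).
  by apply/funext => y /=; rewrite ddx_rescale//; exact: df.
have [d2 _] := Df (delta_mx ord0 i, 0).
have dd : differentiable (ddx i f \o rescale c d z0) z.
  apply: differentiable_comp; last exact: d2.
  by have [] := is_diff_rescale c d z0 z.
have := @deriveZ _ _ _ (ddx i f \o rescale c d z0) c z (delta_mx ord0 i, 0)
  (diff_derivable dd).
rewrite {1}/ddx => E; apply: etrans E _.
have := @ddx_rescale (ddx i f) c d z0 i z (d2 _ I).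
rewrite {1}/ddx => ->.
by rewrite /GRing.scale/= expr2 mulrA.
Qed.

Lemma Ck_rescale n f c d z0 : Ck n setT f -> Ck n setT (f \o rescale c d z0).
Proof. by apply: Ck_comp_affine => z; exact: is_diff_rescale. Qed.

End spacetime.

(** * The cut-off heat kernel *)

Section testfun.
Context (R : realType) (N : nat).
Local Notation ST := ('rV[R]_N * R)%type.
Local Notation g := (@flat_exp R 0).
Implicit Types (z : ST) (t s d : R).

(** This is [t^(-N/2)], written so that its smoothness for [t > 0] is that of
    [expR] and [ln]. *)
Definition heat_pow t : R := expR (- (N%:R / 2) * ln t).

Lemma heat_pow_sqr d : 0 < d -> heat_pow (d ^+ 2) = (d ^+ N)^-1.
Proof.
move=> d0; rewrite /heat_pow lnXn// mulNr expRN; congr (_^-1).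
rewrite -(mulr_natl (ln d)) mulrA divfK ?pnatr_eq0//.
by rewrite expRM_natl lnK.
Qed.

Lemma heat_pow_anti s t : 0 < s -> s <= t -> heat_pow t <= heat_pow s.
Proof.
move=> s0 st; rewrite ler_expR !mulNr lerN2 ler_wpM2l ?divr_ge0//.
by rewrite ler_ln ?posrE// (lt_le_trans s0).
Qed.

Lemma heat_pow_le t : 0 < t -> t <= 1 -> heat_pow t <= t^-1 ^+ N.
Proof.
move=> t0 t1; rewrite exprVn -heat_pow_sqr//; apply: heat_pow_anti.
  exact: exprn_gt0.
by rewrite expr2 ler_piMl// ltW.
Qed.

(** Meant for [s = |x|^2]: constant inside the ball of squared radius [1/2],
    zero outside the unit ball. *)
Definition spatial_cut s : R := plateau (2 * s - 1).

Lemma is_derive_double_sub1 s : is_derive s 1 (fun x => 2 * x - 1) (2 : R).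
Proof.
have H := is_deriveB (is_deriveM (is_derive_cst (2:R) s 1) (is_derive_id s 1))
  (is_derive_cst (1:R) s 1).
by apply: (is_derive_eq H); rewrite /GRing.scale/=; ring.
Qed.

Lemma is_derive_spatial_cut s :
  is_derive s 1 spatial_cut (2 * plateau1 (2 * s - 1)).
Proof.
by apply: (is_derive_eq (is_derive_chain (is_derive_plateau _)
  (is_derive_double_sub1 s)));
  rewrite mulrC.
Qed.

Lemma is_derive_spatial_cut1 s :
  is_derive s 1 (fun x : R => 2 * plateau1 (2 * x - 1)) (4 * plateau2 (2 * s - 1)).
Proof.
have H := is_deriveM (is_derive_cst (2:R) s 1)
  (is_derive_chain (is_derive_plateau1 _) (is_derive_double_sub1 s)).
by apply: (is_derive_eq H); rewrite /GRing.scale/=; ring.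
Qed.

Lemma Ck_double_sub1 n (U : set ST) (f : ST -> R) : open U -> Ck n U f ->
  Ck n U (fun z => 2 * f z - 1).
Proof.
move=> oU Cf.
exact: (Ck_add oU (Ck_mul oU (Ck_cst n 2 oU) Cf) (Ck_cst n (-1) oU)).
Qed.

Lemma Ck_spatial_cut n (U : set ST) : open U ->
  Ck n U (fun z => spatial_cut (sq z)).
Proof. by move=> oU; apply: Ck_plateau => //; apply: Ck_double_sub1 => //;
  exact: Ck_sq. Qed.

Lemma coord_sq z i : z.1 ord0 i ^+ 2 <= sq z.
Proof. by rewrite /sq (bigD1 i)//= lerDl sumr_ge0// => j _; rewrite sqr_ge0. Qed.

Lemma spatial_cut_supp z : spatial_cut (sq z) != 0 -> forall i, `|z.1 ord0 i| <= 1.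
Proof.
move=> c0 i; rewrite -(@ler_pXn2r _ 2)// ?nnegrE// expr1n real_normK ?num_real//.
rewrite (le_trans (coord_sq z i))// leNgt; apply: contra c0 => s1.
by rewrite /spatial_cut plateau_ge1//; lra.
Qed.

Lemma sq_le z (e : R) : (forall i, z.1 ord0 i ^+ 2 <= e) -> sq z <= N%:R * e.
Proof.
move=> H; apply: (le_trans (ler_sum _ (fun i _ => H i))).
by rewrite sumr_const card_ord mulr_natl.
Qed.

Section heat_test.
Context (d : R) (d0 : 0 < d).
Let e := d ^+ 2.
Let e0 : 0 < e. Proof. exact: exprn_gt0. Qed.

Definition heat_time t : R := g (t / d ^+ 2 - 1) * plateau (2 * t - 1) * heat_pow t.
Definition heat_arg t : R := (4 * t)^-1.
(** The heat kernel with a cut-off in space and one in time, switched on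
    around time [d ^+ 2]. This regularizes the pole at the scale [d], and the
    switching on is the source that a small cell of size [d] will feel. *)
Definition heat_test : ST -> R := profile heat_time heat_arg spatial_cut.

Lemma heat_time_out t : t <= e \/ 1 <= t -> heat_time t = 0.
Proof.
move=> [te|t1]; rewrite /heat_time -/e.
  by rewrite flat_exp_le0 ?mul0r// subr_le0 ler_pdivrMr// mul1r.
by rewrite plateau_ge1 ?mulr0 ?mul0r//; lra.
Qed.

Lemma heat_test_ge0 z : 0 <= heat_test z.
Proof. by rewrite /heat_test /profile /spatial_cut !mulr_ge0 ?flat_exp_ge0
  ?plateau_ge0 ?expR_ge0. Qed.

Lemma heat_test_supp z : heat_test z != 0 ->
  (forall i, `|z.1 ord0 i| <= 1) /\ e <= z.2 <= 1.
Proof.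
rewrite /heat_test /profile mulf_eq0 [X in _ || X]mulf_eq0 !negb_or =>
  /andP[A0 /andP[k0 _]].
split; first exact: spatial_cut_supp.
apply/andP; split; rewrite leNgt; apply: contra A0 => /ltW t0; apply/eqP.
  by apply: heat_time_out; left.
by apply: heat_time_out; right.
Qed.

Lemma heat_test_le z : heat_test z <= (d ^+ N)^-1.
Proof.
have [->|/heat_test_supp[_ /andP[t0 t1]]] := eqVneq (heat_test z) 0.
  by rewrite invr_ge0 exprn_ge0 ?ltW.
have zt : 0 < z.2 := lt_le_trans e0 t0.
rewrite -heat_pow_sqr// -/e /heat_test /profile /heat_time.
rewrite -[leRHS]mulr1; apply: ler_pM; rewrite ?mulr_ge0 ?flat_exp_ge0 ?expR_ge0//.
  rewrite -[leRHS]mul1r; apply: ler_pM; rewrite ?mulr_ge0 ?flat_exp_ge0 ?expR_ge0//.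
    by rewrite mulr_ile1 ?flat_exp_ge0 ?flat_exp_le1.
  exact: heat_pow_anti.
rewrite mulr_ile1 ?plateau_ge0 ?plateau_le1 ?expR_ge0//.
rewrite -expR0 ler_expR oppr_le0 mulr_ge0 ?sq_ge0//.
by rewrite /heat_arg invr_ge0 mulr_ge0// ltW.
Qed.

Lemma open_sublevel (f : ST -> R) c : continuous f -> open [set z | f z < c].
Proof. by move=> cf; exact: (open_comp (fun x _ => cf x) (@open_lt _ c)). Qed.

Lemma open_superlevel (f : ST -> R) c : continuous f -> open [set z | c < f z].
Proof. by move=> cf; exact: (open_comp (fun x _ => cf x) (@open_gt _ c)). Qed.

Lemma heat_test_smooth n : Ck n setT heat_test.
Proof.
have ct : continuous (fun z : ST => z.2) by move=> x; exact: cvg_snd.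
have -> : setT = [set z : ST | 0 < z.2] `|` [set z : ST | z.2 < e].
  apply/esym; rewrite -subTset => z _ /=.
  by case: (ltP 0 z.2) => z2; [left|right; exact: le_lt_trans z2 e0].
have oU := open_superlevel (c := 0) ct; have oW := open_sublevel (c := e) ct.
apply: Ck_glue; last first.
  apply: Ck_ext (Ck_cst n 0 oW) => // z /= ze.
  by rewrite /heat_test /profile heat_time_out ?mul0r//; left; exact: ltW.
have Ct := Ck_time n oU.
apply: Ck_profile => //; last exact: Ck_spatial_cut.
  apply: Ck_mul => //; last first.
    by apply: Ck_expR => //; apply: Ck_mul => //; [exact: Ck_cst|exact: Ck_ln].
  apply: Ck_mul => //; last by apply: Ck_plateau => //; exact: Ck_double_sub1.
  apply: Ck_flat_exp => //; apply: (Ck_add oU _ (Ck_cst n (-1) oU)).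
  by apply: Ck_mul => //; exact: Ck_cst.
apply: Ck_inv => // [z /= z0|]; first by rewrite mulf_neq0 ?pnatr_eq0// gt_eqF.
by apply: Ck_mul => //; exact: Ck_cst.
Qed.

(** The Gaussian solves the heat equation, so the terms in which no cut-off is
    differentiated cancel. *)
Lemma heat_test_heatE z : 0 < z.2 ->
  ddt heat_test z - laplacian heat_test z =
  expR (- (sq z * heat_arg z.2)) * heat_pow z.2 *
  ((flat_exp 1 (z.2 / e - 1) / e * plateau (2 * z.2 - 1) +
    g (z.2 / e - 1) * (2 * plateau1 (2 * z.2 - 1))) * spatial_cut (sq z)
   - g (z.2 / e - 1) * plateau (2 * z.2 - 1) *
     (4 * N%:R * plateau1 (2 * sq z - 1) + 16 * sq z * plateau2 (2 * sq z - 1)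
      - 4 * sq z * plateau1 (2 * sq z - 1) / z.2)).
Proof.
case: z => x t /= t0; set z := (x, t).
have dg : is_derive t 1 (fun t => g (t / e - 1)) (flat_exp 1 (t / e - 1) / e).
  have H := is_deriveB (is_deriveM (is_derive_id t 1) (is_derive_cst (e^-1) t 1))
    (is_derive_cst (1:R) t 1).
  apply: (is_derive_eq (is_derive_chain (is_derive_flat_exp 0 _) H)).
  by rewrite /GRing.scale/=; ring.
have dp : is_derive t 1 (fun t => plateau (2 * t - 1)) (2 * plateau1 (2 * t - 1)).
  exact: is_derive_spatial_cut.
have dh : is_derive t 1 heat_pow (- (N%:R / 2) / t * heat_pow t).
  have H := is_deriveM (is_derive_cst (- (N%:R / 2) : R) t 1) (is_derive1_ln t0).
  apply: (is_derive_eq (is_derive_chain (is_derive_expR _) H)).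
  by rewrite /GRing.scale/= /cst/= -/(heat_pow t); ring.
have dA := is_deriveM (is_deriveM dg dp) dh.
have dB : is_derive t 1 heat_arg (- (4 * t ^+ 2)^-1).
  have H := is_deriveM (is_derive_cst (4:R) t 1) (is_derive_id t 1).
  apply: (is_derive_eq (is_deriveV _ H));
    first by rewrite /= mulf_neq0 ?pnatr_eq0// gt_eqF.
  rewrite /GRing.scale/= !fctE /cst/=; field.
  by rewrite gt_eqF.
have := @ddt_profile _ _ heat_time heat_arg spatial_cut _ _ _ z dA dB
  (is_derive_spatial_cut (sq z)).
rewrite -/heat_test => ->.
rewrite (laplacian_profile _ _ _ is_derive_spatial_cut is_derive_spatial_cut1).
rewrite /GRing.scale/= !fctE /heat_time -/e /heat_arg.
field.
by rewrite !gt_eqF.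
Qed.

End heat_test.

Lemma near_eq0_derive (f : ST -> R) z : (\near z, f z = 0) ->
  ddt f z = 0 /\ laplacian f z = 0.
Proof.
move=> f0; split.
  by rewrite /ddt (@near_eq_derive _ _ _ f (cst 0))// derive_cst.
rewrite /laplacian big1// => i _; rewrite {1}/ddx.
rewrite (@near_eq_derive _ _ _ (ddx i f) (cst 0)) ?derive_cst//.
have := near_join f0; apply: filterS => y fy.
by rewrite /ddx (@near_eq_derive _ _ _ f (cst 0))// derive_cst.
Qed.

(** The derivative of the switch at time [d ^+ 2] is nonnegative, hence
    harmless for a lower bound, and on the core it has size [d^(-2)] while the
    kernel has size [d^(-N)]. The derivatives of the other two cut-offs live
    either at [t >= 1/2] or at [|x|^2 >= 1/2], where the kernel and its
    gradient are bounded independently of [d]. The condition on [d] puts the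
    core where these two cut-offs are constant. *)
Lemma heat_test_heat_lb (N1 : (1 <= N)%N) :
  exists C c : R, [/\ 0 <= C, 0 < c & forall d, 0 < d -> 12 * N%:R * d ^+ 2 <= 1 ->
    (forall z, - C <= ddt (heat_test d) z - laplacian (heat_test d) z) /\
    (forall z, (forall i, `|z.1 ord0 i| <= d) -> 2 * d ^+ 2 <= z.2 <= 3 * d ^+ 2 ->
      c * (d ^+ N.+2)^-1 <= ddt (heat_test d) z - laplacian (heat_test d) z)].
Proof.
have [M M0 MB] := plateau_bounded R.
pose C := 2 * M * 2 ^+ N + (4 * N%:R + 20) * M * (8 ^+ N.+1 * (N.+1)`!%:R).
pose k0 := g (g 1); have k00 : 0 < k0 by exact: plateau_gt0.
pose c := expR (- N%:R) * (2 ^+ N)^-1 * (4^-1 * expR (- 1)) * k0 ^+ 2.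
have NR : 1 <= N%:R :> R by rewrite ler1n.
have C0 : 0 <= C.
  by rewrite addr_ge0 ?mulr_ge0 ?addr_ge0 ?mulr_ge0 ?exprn_ge0 ?ler0n.
exists C, c; split=> //.
  by rewrite !mulr_gt0 ?expR_gt0 ?invr_gt0 ?exprn_gt0.
move=> d d0 d1; have e0 : 0 < d ^+ 2 by exact: exprn_gt0.
split=> z.
  have [z0|z0] := leP z.2 (d ^+ 2 / 2).
    have [-> ->] : ddt (heat_test d) z = 0 /\ laplacian (heat_test d) z = 0.
      apply: near_eq0_derive.
      have ct : continuous (fun z : ST => z.2) by move=> x; exact: cvg_snd.
      have oW := open_sublevel (c := d ^+ 2) ct.
      have zW : [set z : ST | z.2 < d ^+ 2] z by rewrite /=; lra.
      apply: filterS (open_nbhs_nbhs (conj oW zW)) => y /= ye.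
      by rewrite /heat_test /profile heat_time_out ?mul0r//; left; exact: ltW.
    by rewrite subr0 oppr_le0.
  have t0 : 0 < z.2 by lra.
  rewrite heat_test_heatE//.
  set E := expR _; set h := heat_pow _; set t := z.2 in t0 z0 *; set s := sq z.
  have E0 : 0 <= E by exact: expR_ge0.
  have E1 : E <= 1.
    rewrite -expR0 ler_expR oppr_le0 mulr_ge0 ?sq_ge0//.
    by rewrite /heat_arg invr_ge0 mulr_ge0// ltW.
  have h0 : 0 <= h by exact: expR_ge0.
  have g0 := flat_exp_ge0 (t / d ^+ 2 - 1);
    have g1 := flat_exp_le1 (t / d ^+ 2 - 1).
  set G := g _ in g0 g1 *.
  have p0 := plateau_ge0 (2 * t - 1); have p1 := plateau_le1 (2 * t - 1).
  set P := plateau _ in p0 p1 *.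
  have k1 := plateau_ge0 (2 * s - 1); have k2 := plateau_le1 (2 * s - 1).
  rewrite -/(spatial_cut s) in k1 k2.
  have s0 := sq_ge0 z; rewrite -/s in s0.
  (* The switch at time [d ^+ 2] contributes with a favourable sign. *)
  have T1 : 0 <= E * h * (flat_exp 1 (t / d ^+ 2 - 1) / d ^+ 2 * P * spatial_cut s).
    exact: (mulr_ge0 (mulr_ge0 E0 h0) (mulr_ge0 (mulr_ge0
      (divr_ge0 (flat_exp1_ge0 _) (ltW e0)) p0) k1)).
  (* The cut-off in time varies only for [t >= 1/2], where [t^(-N/2) <= 2^N].
     *)
  have T2 : - (2 * M * 2 ^+ N) <=
      E * h * (G * (2 * plateau1 (2 * t - 1)) * spatial_cut s).
    rewrite lerNl -mulrN; apply: le_trans (ler_norm _) _.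
    have [t2|t2] := leP t (1/2).
      rewrite plateau1_out ?mulr0 ?mul0r ?oppr0 ?mulr0 ?normr0; last by left; lra.
      by rewrite !mulr_ge0 ?exprn_ge0.
    have hl : h <= 2 ^+ N.
      have -> : 2 ^+ N = heat_pow ((1/2) ^+ 2) :> R.
        by rewrite heat_pow_sqr// div1r exprVn invrK.
      by apply: heat_pow_anti => //; rewrite expr2; lra.
    rewrite normrM normrN !normrM [2 * M * _]mulrC.
    rewrite (ger0_norm E0) (ger0_norm h0) (ger0_norm g0) (ger0_norm k1)
      (ger0_norm (ler0n _ 2)).
    apply: ler_pM; rewrite ?mulr_ge0//.
      by rewrite -[leRHS]mul1r; apply: ler_pM.
    rewrite -[leRHS]mulr1; apply: ler_pM; rewrite ?mulr_ge0//.
    rewrite -[leRHS]mul1r; apply: ler_pM; rewrite ?mulr_ge0//.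
    by rewrite ler_pM2l//; have [] := MB (2 * t - 1).
  (* The spatial cut-off varies only for [|x|^2 >= 1/2], where the Gaussian is
     at most [exp(-1/(8t))] and beats [t^(-N-1)]. *)
  have T3 : E * h * (G * P *
     (4 * N%:R * plateau1 (2 * s - 1) + 16 * s * plateau2 (2 * s - 1)
      - 4 * s * plateau1 (2 * s - 1) / t)) <=
     (4 * N%:R + 20) * M * (8 ^+ N.+1 * (N.+1)`!%:R).
    have rhs0 : 0 <= (4 * N%:R + 20) * M * (8 ^+ N.+1 * (N.+1)`!%:R) :> R.
      by rewrite !mulr_ge0 ?addr_ge0 ?mulr_ge0 ?exprn_ge0 ?ler0n.
    have [so|so] := pselect (2 * s - 1 <= 0 \/ 1 <= 2 * s - 1).
      by rewrite plateau1_out// plateau2_out// !mulr0 !mul0r subr0 addr0 !mulr0.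
    have [t1|t1] := leP 1 t.
      by rewrite [P]plateau_ge1 ?mulr0 ?mul0r ?mulr0//; lra.
    have {so} [s1 s2] : 1 / 2 <= s /\ s <= 1.
      by split; rewrite leNgt; apply/negP => ?; apply: so; [left|right]; lra.
    have := MB (2 * s - 1).
    move: (plateau1 (2 * s - 1)) (plateau2 (2 * s - 1)) => k' k''.
    move=> [/ler_normlP[M1a M1b] /ler_normlP[M2a M2b]].
    have ti : 1 <= t^-1 by rewrite invf_ge1// ltW.
    have br : 4 * N%:R * k' + 16 * s * k'' - 4 * s * k' / t <=
      (4 * N%:R + 20) * M * t^-1.
      have a1 : 4 * N%:R * k' <= 4 * N%:R * M * t^-1.
        rewrite (@le_trans _ _ (4 * N%:R * M))//;
          first by rewrite ler_wpM2l ?mulr_ge0 ?ler0n.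
        by rewrite ler_peMr// !mulr_ge0.
      have a2 : 16 * s * k'' <= 16 * M * t^-1.
        rewrite (@le_trans _ _ (16 * M))//; last by rewrite ler_peMr// !mulr_ge0.
        rewrite -mulrA ler_pM2l// (@le_trans _ _ (s * M))// ?ler_wpM2l//.
        by rewrite ler_piMl.
      have a3 : - (4 * s * k' / t) <= 4 * M * t^-1.
        rewrite -mulNr ler_wpM2r ?invr_ge0 ?(ltW t0)//.
        rewrite -mulrN -mulrA ler_pM2l// (@le_trans _ _ (s * M))// ?ler_wpM2l//;
          last first.
          by rewrite ler_piMl.
      by lra.
    have ht : E * h * t^-1 <= 8 ^+ N.+1 * (N.+1)`!%:R.
      have hl : h <= t^-1 ^+ N by apply: heat_pow_le => //; exact: ltW.
      have El : E <= expR (- (t^-1 / 8)).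
        rewrite ler_expR lerN2 /heat_arg -/s -/t.
        have -> : s * (4 * t)^-1 = s / 4 * t^-1 by field; rewrite gt_eqF.
        by rewrite mulrC ler_wpM2r ?invr_ge0 ?(ltW t0)//; lra.
      have y0 : 0 <= t^-1 / 8 by rewrite divr_ge0// invr_ge0 ltW.
      have := exprn_expRN N.+1 y0.
      rewrite -(@ler_pM2l _ (8 ^+ N.+1)) ?exprn_gt0// mulrA -exprMn.
      rewrite mulrCA divff ?mulr1//; apply: le_trans.
      have -> : t^-1 ^+ N.+1 * expR (- (t^-1 / 8)) = expR (- (t^-1 / 8)) * t^-1
        ^+ N * t^-1.
        by rewrite exprSr; ring.
      rewrite ler_wpM2r ?invr_ge0 ?(ltW t0)//.
      by apply: ler_pM.
    rewrite mulrCA.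
    apply: (@le_trans _ _ (G * P * (E * h * ((4 * N%:R + 20) * M * t^-1)))).
      exact: (ler_wpM2l (mulr_ge0 g0 p0) (ler_wpM2l (mulr_ge0 E0 h0) br)).
    have X0 : 0 <= E * h * ((4 * N%:R + 20) * M * t^-1).
      by rewrite !mulr_ge0 ?addr_ge0 ?mulr_ge0 ?invr_ge0 ?(ltW t0)// ler0n.
    apply: (@le_trans _ _ (E * h * ((4 * N%:R + 20) * M * t^-1))).
      exact: (ler_piMl X0 (mulr_ile1 g0 p0 g1 p1)).
    have -> : E * h * ((4 * N%:R + 20) * M * t^-1) = (4 * N%:R + 20) * M
      * (E * h * t^-1).
      by ring.
    by rewrite ler_wpM2l// mulr_ge0 ?addr_ge0 ?mulr_ge0.
  have dist (a u v k w : R) : a * ((u + v) * k - w) = a * (u * k) + a * (v * k)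
    - a * w.
    by ring.
  rewrite dist /C opprD; apply: lerB => //.
  by apply: le_trans T2 _; rewrite lerDr.
move=> zd /andP[t2 t3]; have t0 : 0 < z.2 by apply: lt_le_trans t2;
  rewrite mulr_gt0.
rewrite heat_test_heatE//.
have N0 : 0 < N%:R :> R by rewrite ltr0n.
have de : 12 * d ^+ 2 <= 1.
  by apply: le_trans d1; rewrite -[leRHS]mulrA ler_pM2l// ler_peMl// ltW.
have sN : sq z <= N%:R * d ^+ 2.
  apply: sq_le => i; rewrite -[leLHS](real_normK (num_real _)).
  by rewrite lerXn2r ?nnegrE// ltW.
have so : 2 * sq z - 1 <= 0 by lra.
have to : 2 * z.2 - 1 <= 0 by lra.
rewrite (plateau1_out (or_introl so)) (plateau2_out (or_introl so))
  (plateau1_out (or_introl to)).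
rewrite /spatial_cut !plateau_le0// -/k0 !(mulr0, mul0r) !addr0 subr0 mulr0 subr0.
set x := z.2 / d ^+ 2 - 1.
have [x1 x2] : 1 <= x /\ x <= 2.
  rewrite /x lerBrDr lerBlDr ler_pdivlMr// ler_pdivrMr//; split; lra.
have x0 : 0 < x by lra.
have gx : 4^-1 * expR (- 1) <= flat_exp 1 x.
  rewrite flat_exp1E//; apply: ler_pM => //; rewrite ?expR_ge0//.
    have -> : (4^-1 : R) = (2^-1) ^+ 2 by rewrite expr2; field.
    by rewrite lerXn2r ?nnegrE ?invr_ge0 ?(ltW x0)// lef_pV2 ?posrE.
  by rewrite ler_expR lerN2 invf_le1.
have Ez : expR (- N%:R) <= expR (- (sq z * heat_arg z.2)).
  rewrite ler_expR lerN2 /heat_arg ler_pdivrMr ?mulr_gt0//.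
  apply: le_trans sN _; rewrite ler_pM2l//; lra.
have hz : (2 ^+ N)^-1 * (d ^+ N)^-1 <= heat_pow z.2.
  rewrite -invfM -exprMn -heat_pow_sqr ?mulr_gt0//; apply: heat_pow_anti => //.
  by rewrite exprMn; lra.
have -> : c * (d ^+ N.+2)^-1 = expR (- N%:R) * ((2 ^+ N)^-1 * (d ^+ N)^-1) *
    (4^-1 * expR (- 1) / d ^+ 2 * k0 * k0).
  have -> : d ^+ N.+2 = d ^+ N * d ^+ 2 by rewrite -exprD addn2.
  by rewrite /c invfM; ring.
apply: ler_pM; rewrite ?mulr_ge0 ?expR_ge0 ?invr_ge0 ?exprn_ge0 ?(ltW k00)
  ?(ltW d0)//.
  by apply: ler_pM => //; rewrite ?mulr_ge0 ?expR_ge0 ?invr_ge0 ?exprn_ge0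
    ?(ltW k00) ?(ltW d0).
by rewrite !ler_pM2r ?invr_gt0.
Qed.

End testfun.

(** * The cut-off that measures the absorbed mass *)

Section absorption_test.
Context (R : realType) (N : nat).
Local Notation ST := ('rV[R]_N * R)%type.
Local Notation g := (@flat_exp R 0).
Implicit Types (z : ST) (t s h : R).

(** The first factor switches on at [t = -1], the second one switches off when
    [t] reaches [- h]. *)
Definition window h t : R := g (1 + t) * g (- 1 - t / h).
Definition window_test h : ST -> R := profile (window h) (fun=> 0) (@spatial_cut R).

Lemma window_test_ge0 h z : 0 <= window_test h z.
Proof. by rewrite /window_test /profile !mulr_ge0 ?flat_exp_ge0 ?plateau_ge0
  ?expR_ge0. Qed.

Lemma window_test_supp h z : 0 < h -> window_test h z != 0 ->
  (forall i, `|z.1 ord0 i| <= 1) /\ - 1 <= z.2 <= - h.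
Proof.
move=> h0; rewrite /window_test /profile mulf_eq0 [X in _ || X]mulf_eq0 !negb_or.
move=> /andP[w0 /andP[k0 _]]; split; first exact: spatial_cut_supp.
apply/andP; split; rewrite leNgt; apply: contra w0 => t0; rewrite /window.
  by rewrite flat_exp_le0 ?mul0r//; lra.
rewrite (@flat_exp_le0 _ 0 (- 1 - _)) ?mulr0// subr_le0 ler_pdivlMr// mulN1r;
  exact: ltW.
Qed.

Lemma window_test_smooth h n : Ck n setT (window_test h).
Proof.
have oT : open [set: ST] by exact: openT.
have Ct := Ck_time n oT.
apply: Ck_profile => //; [|exact: Ck_cst|exact: Ck_spatial_cut].
apply: Ck_mul => //; apply: Ck_flat_exp => //.
  by apply: Ck_add => //; exact: Ck_cst.
apply: Ck_ext (Ck_add oT (Ck_cst n (-1) oT) (Ck_mul oT (Ck_cst n (- h^-1) oT)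
  Ct)) => // z _.
by rewrite mulNr mulrC.
Qed.

(** The factor that switches off is nonincreasing in time, so its derivative
    has the good sign for an upper bound, however steep it is. This is why the
    constants do not depend on [h] and [h] can tend to [0]. *)
Lemma window_test_bounds : (1 <= N)%N -> exists C c : R,
    [/\ 0 <= C, 0 < c & forall h, 0 < h ->
    (forall z, ddt (window_test h) z + laplacian (window_test h) z <= C) /\
    (forall z, (forall i, `|z.1 ord0 i| <= (2 * N%:R)^-1) ->
      - 4^-1 <= z.2 <= - 2 * h ->
      c <= window_test h z)].
Proof.
move=> N1; have [M M0 MB] := plateau_bounded R.
have [M1 M10 MB1] := flat_exp_bounded R 1.
pose C := M1 + (4 * N%:R + 16) * M.
pose c := g (3 / 4) * g 1 * g (g 1).
have N0 : 0 < N%:R :> R by rewrite ltr0n.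
have NR : 1 <= N%:R :> R by rewrite ler1n.
exists C, c; split.
- by rewrite addr_ge0 ?mulr_ge0 ?addr_ge0 ?mulr_ge0// ler0n.
- by rewrite !mulr_gt0 ?flat_exp_gt0//; lra.
move=> h h0; split=> [[x t]|[x t] /= xd /andP[t1 t2]].
  set z := (x, t).
  have d1 : is_derive t 1 (fun t => g (1 + t)) (flat_exp 1 (1 + t)).
    have H := is_deriveD (is_derive_cst (1:R) t 1) (is_derive_id t 1).
    apply: (is_derive_eq (is_derive_chain (is_derive_flat_exp 0 _) H)).
    by rewrite add0r mulr1.
  have d2 : is_derive t 1 (fun t => g (- 1 - t / h))
    (- (flat_exp 1 (- 1 - t / h) / h)).
    have H := is_deriveB (is_derive_cst (-1:R) t 1)
      (is_deriveM (is_derive_id t 1) (is_derive_cst (h^-1) t 1)).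
    apply: (is_derive_eq (is_derive_chain (is_derive_flat_exp 0 _) H)).
    by rewrite /GRing.scale/= /cst/=; ring.
  have dA := is_deriveM d1 d2.
  have dB := is_derive_cst (0:R) t 1.
  have := @ddt_profile _ _ (window h) (fun=> 0) (@spatial_cut R) _ _ _ z dA dB
    (is_derive_spatial_cut (sq z)).
  rewrite -/(window_test h) => ->.
  rewrite (laplacian_profile _ _ _ (@is_derive_spatial_cut R)
    (@is_derive_spatial_cut1 R)).
  rewrite /GRing.scale/= !mulr0 !oppr0 !expR0 !(mulr1, mul0r, mulr0, subr0, addr0).
  rewrite ?expr0n/= ?mul0r ?addr0 /window.
  set s := sq z; have s0 : 0 <= s by exact: sq_ge0.
  have := flat_exp_ge0 (1 + t); have := flat_exp_le1 (1 + t).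
  have := flat_exp_ge0 (- 1 - t / h); have := flat_exp_le1 (- 1 - t / h).
  have := flat_exp1_ge0 (- 1 - t / h).
  have := ler_normlW (MB1 (1 + t)); have := flat_exp1_ge0 (1 + t).
  have := plateau_ge0 (2 * s - 1); have := plateau_le1 (2 * s - 1).
  rewrite -/(spatial_cut s).
  set k := spatial_cut s; set a := g (1 + t); set b := g (- 1 - _).
  set a' := flat_exp 1 (1 + t); set b' := flat_exp 1 (- 1 - _).
  move=> k1 k0 a'0 a'1 b'0 b1 b0 a1 a0.
  apply: lerD.
    apply: (@le_trans _ _ (b * a' * k)).
      rewrite ler_wpM2r// -[leRHS]add0r lerD2r mulrN oppr_le0.
      by rewrite !mulr_ge0// invr_ge0 ltW.
    rewrite -[leRHS]mulr1; apply: ler_pM; rewrite ?mulr_ge0//.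
    by rewrite -[leRHS]mul1r; apply: ler_pM.
  have rhs0 : 0 <= (4 * N%:R + 16) * M by rewrite mulr_ge0 ?addr_ge0 ?mulr_ge0
    ?ler0n.
  have [so|so] := pselect (2 * s - 1 <= 0 \/ 1 <= 2 * s - 1).
    by rewrite plateau1_out// plateau2_out// !mulr0 addr0 mulr0.
  have {so} [s1 s2] : 1 / 2 <= s /\ s <= 1.
    by split; rewrite leNgt; apply/negP => ?; apply: so; [left|right]; lra.
  have := MB (2 * s - 1).
  move: (plateau1 (2 * s - 1)) (plateau2 (2 * s - 1)) => k' k''.
  move=> [/ler_normlP[M1a M1b] /ler_normlP[M2a M2b]].
  apply: (@le_trans _ _ (a * b * ((4 * N%:R + 16) * M))).
    rewrite ler_wpM2l ?mulr_ge0//.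
    have a1' : 2 * N%:R * (2 * k') <= 4 * N%:R * M by nra.
    have a2' : 4 * s * (4 * k'') <= 16 * M.
      have : s * k'' <= M.
        by rewrite (@le_trans _ _ (s * M))// ?ler_wpM2l// ler_piMl.
      by lra.
    by lra.
  by rewrite ler_piMl// mulr_ile1.
have sN : sq (x, t) <= N%:R * (2 * N%:R)^-1 ^+ 2.
  apply: sq_le => i; rewrite -[leLHS](real_normK (num_real _)).
  by rewrite lerXn2r ?nnegrE// invr_ge0 mulr_ge0.
have sN' : sq (x, t) <= 4^-1.
  apply: le_trans sN _.
  have -> : N%:R * (2 * N%:R)^-1 ^+ 2 = 4^-1 * N%:R^-1 :> R by field;
    rewrite gt_eqF.
  by rewrite ler_piMr// invf_le1.
rewrite /window_test /profile/= mulr0 oppr0 expR0 mulr1 /window /spatial_cut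
  plateau_le0; last lra.
rewrite ler_pM2r; last by exact: plateau_gt0.
apply: ler_pM; rewrite ?flat_exp_ge0//; apply: flat_exp_mono; first lra.
have : t / h <= - 2 by rewrite ler_pdivrMr//; lra.
lra.
Qed.

End absorption_test.

(** * Parabolic boxes and the dyadic parabolic grid *)

(** The same carrier as the space-time, with the time axis typed so that the
    product sigma-algebra is found. *)
Local Notation measurableST R N := ('rV[R]_N * measurableTypeR R)%type.

Definition spacetime_measure (R : realType) (N : nat) :
    {measure set (measurableST R N) -> \bar R} :=
  (lebesgue_rV R N \x @lebesgue_measure R)%E.
Arguments spacetime_measure : clear implicits.

Section grid.
Context (R : realType) (N : nat).
Local Notation ST := ('rV[R]_N * R)%type.
Local Notation mu := (spacetime_measure R N).
Local Notation M A := (measurable (A : set (measurableST R N))).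
Implicit Types (z y : ST).

Definition parabolic_box (x : ST) (l : R) : set ST :=
  [set z : ST | (forall i, x.1 ord0 i <= z.1 ord0 i < x.1 ord0 i + l) /\
           x.2 <= z.2 < x.2 + l ^+ 2].

Let colset (x : 'rV[R]_N) (l : R) : set 'rV[R]_N :=
  [set y | forall i : 'I_N, `[x ord0 i, x ord0 i + l[%classic (y ord0 i)].

Lemma measurable_forall_coord (A : 'I_N -> set R) : (forall i, measurable (A i)) ->
  measurable [set y : 'rV[R]_N | forall i : 'I_N, A i (y ord0 i)].
Proof.
move=> mA.
have -> : [set y : 'rV[R]_N | forall i : 'I_N, A i (y ord0 i)] =
    \big[setI/setT]_(i < N) ((fun y : 'rV[R]_N => y ord0 i) @^-1` A i).
  apply/seteqP; split => y /=.
    by move=> Ay; apply: (big_ind (fun B : set _ => B y)) => // i _; exact: Ay.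
  by move=> + i; rewrite (bigD1 i)//= => -[].
apply: big_ind => //; first exact: measurableI.
by move=> i _; rewrite -[X in measurable X]setTI; exact: measurable_coord.
Qed.

Lemma parabolic_boxE x l : parabolic_box x l =
    colset x.1 l `*` `[x.2, x.2 + l ^+ 2[%classic.
Proof.
apply/seteqP; split => -[a b]; rewrite /parabolic_box /colset/=.
  by move=> [H1 H2]; split => [i|]; rewrite in_itv//=.
by move=> [H1 H2]; split => [i|]; [have := H1 i|move: H2]; rewrite in_itv/=.
Qed.

Lemma measurable_parabolic_box x l : M (parabolic_box x l).
Proof.
rewrite parabolic_boxE; apply: measurableX; last exact: measurable_itv.
exact: (measurable_forall_coord (fun i => measurable_itv _)).
Qed.

Lemma mu_parabolic_box x l : 0 <= l -> mu (parabolic_box x l) = (l ^+ N.+2)%:E.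
Proof.
move=> l0; rewrite parabolic_boxE /spacetime_measure/= product_measure1E//;
  last first.
  exact: (measurable_forall_coord (fun i => measurable_itv _)).
have E (a b : R) : 0 <= b -> lebesgue_measure `[a, a + b[%classic = b%:E.
  move=> b0; rewrite lebesgue_measure_itv/= lte_fin ltrDl.
  by case: (ltgtP 0 b) b0 => // [b0 _|<- _]//; rewrite -EFinD addrAC subrr add0r.
have B := @lebesgue_rV_box R N (fun i => `[x.1 ord0 i, x.1 ord0 i + l[%classic)
  (fun i => measurable_itv _).
transitivity ((l ^+ N)%:E * (l ^+ 2)%:E)%E; last by rewrite -EFinM -exprD addn2.
congr (_ * _)%E; last by apply: E; rewrite exprn_ge0.
rewrite [LHS]B; under eq_bigr do rewrite E//.
by rewrite prodEFin prodr_const card_ord.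
Qed.

(** Space steps [2^(-n)] and time steps [4^(-n)] make the cells parabolic. *)
Definition grid n z : 'rV[int]_N * int :=
  (\row_i Num.floor (2 ^+ n * z.1 ord0 i), Num.floor (4 ^+ n * z.2)).

Definition cell n z : set ST := [set y : ST | grid n y = grid n z].

Definition corner n z : ST :=
  (\row_i ((Num.floor (2 ^+ n * z.1 ord0 i))%:~R / 2 ^+ n),
   (Num.floor (4 ^+ n * z.2))%:~R / 4 ^+ n).

Lemma floor_box (q x y : R) : 0 < q -> (Num.floor (q * y) = Num.floor (q * x)) <->
  (Num.floor (q * x))%:~R / q <= y < (Num.floor (q * x))%:~R / q + q^-1.
Proof.
move=> q0; rewrite ler_pdivrMr// -[X in _ < _ + X]div1r -mulrDl ltr_pdivlMr//.
rewrite [y * q]mulrC; split=> [<-|H].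
  by have := floor_itv (q * y); rewrite intrD.
by apply: floor_def; rewrite intrD.
Qed.

(** Cells are boxes of the shape on which the heat kernel estimate is stated. *)
Lemma cell_parabolic_box n z : cell n z = parabolic_box (corner n z) (2^-1 ^+ n).
Proof.
have E : (2^-1 ^+ n) ^+ 2 = (4 ^+ n)^-1 :> R.
  by rewrite exprAC -[RHS]exprVn; congr (_ ^+ _); field.
apply/seteqP; split => y.
  move=> [/rowP Hx Ht]; split => [i|]; rewrite /corner/=.
    by rewrite mxE exprVn; apply/(floor_box _ _ _).1; [|have := Hx i; rewrite !mxE].
  by rewrite E; apply/(floor_box _ _ _).1.
move=> [Hx Ht]; rewrite /cell/= /grid; congr (_, _).
  apply/rowP => i; rewrite !mxE; apply/(floor_box _ _ _).2 => //.
  by have := Hx i; rewrite mxE exprVn.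
by apply/(floor_box _ _ _).2 => //; move: Ht; rewrite E.
Qed.

Lemma cell_le m n y z : (m <= n)%N -> grid n y = grid n z -> grid m y = grid m z.
Proof.
have H q j (a b : R) : (0 < q)%N ->
    Num.floor (q%:R ^+ (j + m) * a) = Num.floor (q%:R ^+ (j + m) * b) ->
    Num.floor (q%:R ^+ m * a) = Num.floor (q%:R ^+ m * b).
  move=> q0; elim: j => [//|j IH] E; apply: IH; move: E.
  rewrite addSn !exprS -!mulrA; move: (_ * a) (_ * b) => {}a {}b E.
  apply: floor_def; have := floor_itv b; have qR : 0 < q%:R :> R by rewrite ltr0n.
  move=> /andP[b1 b2]; apply/andP; split.
    rewrite -(ler_pM2l qR) -[q%:R]/(q%:Z%:~R) -intrM -floor_ge_int E floor_ge_int.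
    by rewrite intrM ler_pM2l.
  rewrite -(ltr_pM2l qR) -[q%:R]/(q%:Z%:~R) -intrM -floor_lt_int E floor_lt_int.
  by rewrite intrM ltr_pM2l.
move=> mn [/rowP Hx Ht]; congr (_, _).
  apply/rowP => i; have := Hx i; rewrite !mxE -(subnK mn); exact: (@H 2).
by move: Ht; rewrite -(subnK mn); exact: (@H 4).
Qed.

Lemma measurable_cell n z : M (cell n z).
Proof. by rewrite cell_parabolic_box; exact: measurable_parabolic_box. Qed.

Lemma half_exp_lt (e : R) : (0 < e) -> exists n0, forall n, (n0 <= n)%N ->
    (2^-1 ^+ n < e).
Proof.
move=> e0; have := @cvg_expr R 2^-1; rewrite ger0_norm// invf_lt1// ltr1n =>
  /(_ isT).
move=> /cvgrPdist_lt/(_ e e0)[n0 _ H]; exists n0 => n nn0.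
by have := H n nn0; rewrite /= sub0r normrN ger0_norm.
Qed.

Lemma corner_cell n z : cell n z (corner n z).
Proof.
rewrite cell_parabolic_box; have l0 : (0 < 2^-1 ^+ n :> R) by rewrite exprn_gt0.
by split => [i|]; rewrite lexx/= ltrDl ?exprn_gt0.
Qed.

Lemma nbhs_cell z (U : set ST) : nbhs z U -> exists n0, forall n, (n0 <= n)%N ->
  cell n z `<=` U.
Proof.
move=> /nbhs_ballP[e/= e0 eU].
have [n0 n0e] := half_exp_lt e0.
exists n0 => n /n0e ne y; rewrite cell_parabolic_box => -[Hx Ht]; apply: eU.
have [Hx' Ht'] : parabolic_box (corner n z) (2^-1 ^+ n) z
  by rewrite -cell_parabolic_box.
have l0 : 0 < 2^-1 ^+ n :> R by exact: exprn_gt0.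
have l1 : 2^-1 ^+ n <= 1 :> R by rewrite exprn_ile1// invf_le1// ler1n.
split => /=.
  split => // i j; rewrite ord1 /ball/=.
  have := Hx j; have := Hx' j; move: (corner _ _).1 => c.
  by move=> /andP[? ?] /andP[? ?]; rewrite ltr_norml; apply/andP; split; lra.
rewrite /ball/=; move: Ht Ht' => /andP[? ?] /andP[? ?].
have : (2^-1 ^+ n) ^+ 2 <= 2^-1 ^+ n :> R by rewrite expr2 ler_piMl// ltW.
by rewrite ltr_norml => ?; apply/andP; split; lra.
Qed.

End grid.

(** * Approximation of measurable sets by unions of cells *)

Section gridset.
Context (R : realType) (N : nat).
Local Notation ST := ('rV[R]_N * R)%type.
Local Notation mu := (spacetime_measure R N).
Local Notation M A := (measurable (A : set (measurableST R N))).
Implicit Types (z y : ST) (A B E U : set ST).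

(** These are the unions of cells of level [n]; saturation under [grid] avoids
    indexing the cells. *)
Definition gridset n A := forall y z : ST, grid n y = grid n z -> A y -> A z.

Lemma gridset_le m n A : (m <= n)%N -> gridset m A -> gridset n A.
Proof. by move=> mn gA y z /(cell_le mn); exact: gA. Qed.

Lemma gridsetU n A B : gridset n A -> gridset n B -> gridset n (A `|` B).
Proof. by move=> gA gB y z e [/(gA _ _ e)|/(gB _ _ e)]; [left|right]. Qed.

Lemma gridsetI n A B : gridset n A -> gridset n B -> gridset n (A `&` B).
Proof. by move=> gA gB y z e [/(gA _ _ e) ? /(gB _ _ e)]. Qed.

Lemma gridsetC n A : gridset n A -> gridset n (~` A).
Proof. by move=> gA y z e nA Az; apply: nA; exact: gA (esym e) Az. Qed.

Lemma gridset_cell n z : gridset n (cell n z).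
Proof. by move=> y y' e; rewrite /cell/= => <-. Qed.

Lemma gridset0 n : gridset n (set0 : set ST).
Proof. by move=> y z _ []. Qed.

(** Numbering the cells by the code of their grid index writes a grid set as a
    countable disjoint union, with empty terms for the unused numbers. *)
Definition nth_cell n A m : set ST :=
  [set z | A z /\ choice.pickle (grid n z) = m].

Lemma nth_cell_bigcup n A : \bigcup_m nth_cell n A m = A.
Proof.
apply/seteqP; split => z; first by move=> [m _ []].
by move=> Az; exists (choice.pickle (grid n z)).
Qed.

Lemma nth_cellP n A m : gridset n A ->
  nth_cell n A m = set0 \/ exists2 z, A z & nth_cell n A m = cell n z.
Proof.
move=> gA; have [->|/set0P[z [Az zm]]] := eqVneq (nth_cell n A m) set0;
  first by left.
right; exists z => //; apply/seteqP; split => y.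
  by move=> [Ay ym]; apply: (pcan_inj choice.pickleK); rewrite ym.
by rewrite /cell/= => yz; split; [exact: gA (esym yz) Az|rewrite yz].
Qed.

Lemma trivIset_nth_cell n A : trivIset setT (nth_cell n A).
Proof. by apply/trivIsetP => i j _ _ /eqP ij; apply/seteqP;
  split => // z [[_ zi] [_ zj]]; case: ij; rewrite -zi -zj. Qed.

Lemma measurable_nth_cell n A m : gridset n A -> M (nth_cell n A m).
Proof.
by move=> /(nth_cellP m)[->|[z _ ->]]; [exact: measurable0|exact: measurable_cell].
Qed.

Lemma measurable_gridset n A : gridset n A -> M A.
Proof.
move=> gA; rewrite -(nth_cell_bigcup n A); apply: bigcup_measurable => m _.
exact: measurable_nth_cell.
Qed.

Definition grid_core n U : set ST := [set z | cell n z `<=` U].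

Lemma gridset_core n U : gridset n (grid_core n U).
Proof. by move=> y z e; rewrite /grid_core /cell/= e. Qed.

Lemma open_bigcup_core U : open U -> U = \bigcup_n grid_core n U.
Proof.
move=> oU; apply/seteqP; split => z.
  move=> Uz; have [n H] := nbhs_cell (open_nbhs_nbhs (conj oU Uz)).
  by exists n => //; exact: H.
by move=> [n _]; apply.
Qed.

Lemma open_measurable_st U : open U -> M U.
Proof.
move=> /open_bigcup_core ->; apply: bigcup_measurable => n _.
exact: measurable_gridset (@gridset_core n U).
Qed.

Lemma ae_imply (P Q : ST -> Prop) : (forall y, P y -> Q y) ->
  {ae mu, forall y, P y} -> {ae mu, forall y, Q y}.
Proof. by move=> PQ; apply: negligibleS => y /= nQ Py; apply: nQ; exact: PQ. Qed.

Lemma ae_and (P Q : ST -> Prop) : {ae mu, forall y, P y} ->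
    {ae mu, forall y, Q y} ->
  {ae mu, forall y, P y /\ Q y}.
Proof.
move=> HP HQ; have := negligibleU HP HQ; apply: negligibleS =>
  y /= /not_andP[nP|nQ].
  by left.
by right.
Qed.

(** The points of [A] may be uncountably many, but there are only countably
    many cells, each of which contributes a null set. *)
Lemma ae_cell_cover A (P : ST -> Prop) :
  (forall z, A z -> exists n, {ae mu, forall y, cell n z y -> P y}) ->
  {ae mu, forall y, A y -> P y}.
Proof.
move=> H.
pose good n := [set z : ST | {ae mu, forall y, cell n z y -> P y}].
have gg n : gridset n (good n) by move=> y z e; rewrite /good /cell/= e.
pose F n := ~` [set y | good n y -> P y].
suff : mu.-negligible (\bigcup_n F n).
  apply: negligibleS => z /= /not_implyP[Az nP].
  by have [n gz] := H z Az; exists n => //= /(_ gz).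
apply: negligible_bigcup => n; rewrite /F.
suff : mu.-negligible (\bigcup_m (nth_cell n (good n) m `&` ~` [set y | P y])).
  apply: negligibleS => z /= /not_implyP[Gz nP].
  by exists (choice.pickle (grid n z)).
apply: negligible_bigcup => m.
have [->|[z gz ->]] := nth_cellP m (gg n);
  first by rewrite set0I; exact: negligible_set0.
by apply: negligibleS gz => y [] /= yz nP /(_ yz).
Qed.

Lemma ae_nbhs_cover A (P : ST -> Prop) :
  (forall z, A z -> exists2 U, nbhs z U & {ae mu, forall y, U y -> P y}) ->
  {ae mu, forall y, A y -> P y}.
Proof.
move=> H; apply: ae_cell_cover => z /H[U zU UP].
have [n Hn] := nbhs_cell zU; exists n; apply: ae_imply UP => y + ny; apply.
exact: Hn ny.
Qed.

(** Cells have positive measure, so a nonempty open set is not null. *)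
Lemma ae_st_exists U (P : ST -> Prop) : open U -> U !=set0 ->
  {ae mu, forall y, U y -> P y} -> exists2 y, U y & P y.
Proof.
move=> oU [z Uz] UP; apply: contrapT => nE.
have [n Hn] := nbhs_cell (open_nbhs_nbhs (conj oU Uz)).
have cU : cell n z `<=` U by exact: Hn.
have nc : mu.-negligible (cell n z).
  apply: negligibleS UP => y ny /= H; apply: nE; exists y; first exact: cU.
  by apply: H; exact: cU.
have : mu (cell n z) = 0%E := (negligibleP mu (measurable_cell n z)).1 nc.
rewrite cell_parabolic_box mu_parabolic_box ?exprn_ge0// => -[] /eqP.
by rewrite gt_eqF// !exprn_gt0.
Qed.

(** Approximation in measure, inside [U], by unions of cells of one level. *)
Definition approx U E := forall e : R, 0 < e -> exists n, exists2 A,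
  gridset n A & (mu (U `&` ((E `\` A) `|` (A `\` E))) < e%:E)%E.

(** Complements exchange the two halves of the symmetric difference, finite
    unions add the errors, and the tail of a countable union is small by
    continuity from above, which is where the finiteness of the measure of [U]
    enters. *)
Lemma sigma_approx U : M U -> (mu U < +oo)%E ->
  sigma_algebra setT [set E : set ST | M E /\ approx U E].
Proof.
move=> mU Uoo.
have mg n A : gridset n A -> M A by exact: measurable_gridset.
have approxU E F : M E -> M F -> approx U E -> approx U F ->
    approx U (E `|` F).
  move=> mE mF aE aF e e0; have e2 : 0 < e / 2 by rewrite divr_gt0.
  have [n [A gA HA]] := aE _ e2; have [m [B gB HB]] := aF _ e2.
  exists (maxn n m), (A `|` B).
    by apply: gridsetU; [apply: gridset_le gA; exact: leq_maxl|
      apply: gridset_le gB; exact: leq_maxr].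
  have mA := mg _ _ gA; have mB := mg _ _ gB.
  have mX : M (U `&` ((E `\` A) `|` (A `\` E))).
    by apply: measurableI => //; apply: measurableU; apply: measurableD.
  have mY : M (U `&` ((F `\` B) `|` (B `\` F))).
    by apply: measurableI => //; apply: measurableU; apply: measurableD.
  rewrite (splitr e) EFinD; apply: le_lt_trans (lteD HA HB).
  apply: (@le_trans _ _
    (mu ((U `&` ((E `\` A) `|` (A `\` E))) `|`
    (U `&` ((F `\` B) `|` (B `\` F)))))); last exact: measureU2.
  apply: le_measure; rewrite ?inE//.
  - by apply: measurableI => //; apply: measurableU; apply: measurableD => //;
    apply: measurableU.
  - exact: measurableU.
  - by move=> z /=; tauto.
split.
- split; first exact: measurable0.
  move=> e e0; exists 0%N, set0; first exact: gridset0.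
  by rewrite !setD0 setU0 setI0 measure0 lte_fin.
- move=> E [mE aE]; split; first exact: measurableD.
  move=> e e0; have [n [A gA HA]] := aE e e0.
  exists n, (~` A); first exact: gridsetC.
  rewrite setTD; have -> : (~` E `\` ~` A) `|` (~` A `\` ~` E) =
    (E `\` A) `|` (A `\` E).
    by apply/seteqP; split => z /=; rewrite !notK; tauto.
  by [].
- move=> F HF; split; first by apply: bigcup_measurable => k _; have [] := HF k.
  pose G m := \big[setU/set0]_(k < m) F k.
  have mG m : M (G m) /\ approx U (G m).
    rewrite /G; elim: m => [|m [IH1 IH2]].
      rewrite big_ord0; split; first exact: measurable0.
      move=> e e0; exists 0%N, set0; first exact: gridset0.
      by rewrite !setD0 setU0 setI0 measure0 lte_fin.
    have [F1 F2] := HF m.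
    by rewrite big_ord_recr/=; split; [exact: measurableU|exact: approxU].
  move=> e e0; have e2 : 0 < e / 2 by rewrite divr_gt0.
  set E := \bigcup_k F k.
  have mE : M E by apply: bigcup_measurable => k _; have [] := HF k.
  have EG : E = \bigcup_m G m.
    apply/seteqP; split => z.
      by move=> [k _ Fz]; exists k.+1 => //; rewrite /G -bigcup_mkord;
        exists k => /=.
    by move=> [m _]; rewrite /G -bigcup_mkord => -[k _ Fz]; exists k.
  pose H m := U `&` (E `\` G m).
  have mH m : M (H m) by apply: measurableI => //; apply: measurableD => //;
    exact: (mG m).1.
  have H0 : \bigcap_m H m = set0.
    apply/seteqP; split => // z Hz.
    have [_ [Ez _]] := Hz 0%N I; rewrite EG in Ez; have [m _ Gz] := Ez.
    by have [_ [_]] := Hz m I.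
  have cH : mu \o H @ \oo --> (0 : \bar R)%E.
    rewrite -(measure0 mu) -H0; apply: nonincreasing_cvg_mu => //.
    - apply: le_lt_trans Uoo; apply: le_measure; rewrite ?inE//.
      by move=> z [].
    - by rewrite H0; exact: measurable0.
    - move=> m n mn; apply/subsetPset => z [Uz [Ez nG]]; split => //;
      split => // Gz.
      apply: nG; move: Gz; rewrite /G -!bigcup_mkord => -[k /= km Fk].
      by exists k => //=; exact: leq_trans km mn.
  have [m HmE] : exists m, (mu (H m) < (e / 2)%:E)%E.
    have lt0 : (0 < (e / 2)%:E :> \bar R)%E by rewrite lte_fin.
    by have [k _ /(_ k (leqnn k))] := cH _ (open_ereal_lt' lt0); exists k.
  have [n [A gA HA]] := (mG m).2 _ e2; exists n, A => //.
  have mA := mg _ _ gA; have [mGm _] := mG m.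
  have mY : M (U `&` ((G m `\` A) `|` (A `\` G m))).
    by apply: measurableI => //; apply: measurableU; apply: measurableD.
  rewrite (splitr e) EFinD; apply: le_lt_trans (lteD HmE HA).
  apply: (@le_trans _ _ (mu (H m `|` (U `&` ((G m `\` A) `|` (A `\` G m))))));
    last exact: measureU2.
  apply: le_measure; rewrite ?inE//.
  - by apply: measurableI => //; apply: measurableU; apply: measurableD.
  - exact: measurableU.
  - move=> z [Uz [[Ez nA]|[Az nE]]].
      by have [Gz|nG] := pselect (G m z); [right|left]; split => //; left.
    right; split => //; right; split => // Gz; apply: nE; rewrite EG.
    by exists m.
Qed.

(** The approximable sets form a sigma-algebra that contains the open sets,
    since these are unions of cells. The coordinates, being continuous, are
    measurable for it, and so is the identity. *)
Lemma measurable_approx U E : M U -> (mu U < +oo)%E -> M E ->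
  approx U E.
Proof.
move=> mU Uoo mE.
pose D := [set E : set ST | M E /\ approx U E].
have sD : sigma_algebra setT D by exact: sigma_approx.
have DE : <<s D >> = D by exact: sigma_algebra_id.
have Dgrid n A : gridset n A -> D A.
  move=> gA; split; first exact: measurable_gridset gA.
  move=> e e0; exists n, A => //; by rewrite setDv setU0 setI0 measure0 lte_fin.
have Dopen O : open O -> D O.
  move=> /open_bigcup_core ->; case: sD => _ _; apply => n.
  exact: Dgrid (@gridset_core n O).
have mid : measurable_fun setT (id : g_sigma_algebraType D -> measurableST R N).
  have mcont (f : ST -> R) : continuous f ->
      measurable_fun setT (f : g_sigma_algebraType D -> measurableTypeR R).
    move=> cf; apply: (measurability _
      (measurable_realfun.RGenOInfty.measurableE R)).
    move=> _ [_ [c ->] <-]; rewrite setTI; apply: sub_sigma_algebra.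
    apply: Dopen; apply: open_comp; first by move=> x _; exact: cf.
    by rewrite set_itvE; exact: open_gt.
  apply/measurable_fun_pairP; split.
    apply/measurable_fun_coordP => i; apply: mcont => x.
    apply: (@continuous_comp _ _ _ fst (fun y : 'rV[R]_N => y ord0 i)).
      exact: cvg_fst.
    exact: coord_continuous.
  by apply: mcont => x; exact: cvg_snd.
have := mid measurableT _ mE; rewrite setTI preimage_id.
rewrite /measurable/= DE => -[_]; exact.
Qed.

End gridset.

(** * Pointwise bounds from averages over cells *)

Section generic.
Context d (T : measurableType d) (R : realType) (mu : {measure set T -> \bar R}).
Implicit Types (U A E : set T) (w : T -> R).
Local Open Scope ereal_scope.

(** Absolute continuity of the integral. *)
Lemma integral_small U w (e : R) : measurable U -> measurable_fun U w ->
  (forall z, U z -> (0 <= w z)%R) -> \int[mu]_(z in U) (w z)%:E < +oo ->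
    (0 < e)%R ->
  exists2 s : R, (0 < s)%R & forall A, measurable A -> A `<=` U -> mu A < s%:E ->
    \int[mu]_(z in A) (w z)%:E <= e%:E.
Proof.
move=> mU mw w0 wfin e0.
have iw : mu.-integrable U (EFin \o w).
  apply/integrableP; split; first exact/measurable_EFinP.
  by under eq_integral => z /set_mem Uz do rewrite /= ger0_norm ?w0//.
have iwU : mu.-integrable setT (EFin \o (w \_ U)).
  by rewrite -restrict_EFin; exact: (integrable_mkcond _ mU).1 iw.
have [s [s0 Hs]] := integral_normr_continuous iwU e0; exists s => // A mA AU As.
have := Hs A mA As; rewrite /Rintegral => Hlt.
have E : \int[mu]_(z in A) `|(w \_ U) z|%:E = \int[mu]_(z in A) (w z)%:E.
  apply: eq_integral => z /set_mem Az; rewrite patchE mem_set; last exact: AU.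
  by rewrite ger0_norm// w0//; exact: AU.
rewrite E in Hlt.
have Afin : \int[mu]_(z in A) (w z)%:E \is a fin_num.
  by apply: integrable_fin_num => //; exact: integrableS iw.
by rewrite -(fineK Afin) lee_fin ltW.
Qed.

(** Applied to [E = {w >= K + 1/n}], the hypothesis forces [E] to be null. *)
Lemma ae_le_of_integral_le U w (K : R) : measurable U -> measurable_fun U w ->
  mu U < +oo -> (forall z, U z -> (0 <= w z)%R) -> (0 <= K)%R ->
  (forall E, measurable E -> E `<=` U ->
    \int[mu]_(z in E) (w z)%:E <= K%:E * mu E) ->
  {ae mu, forall z, U z -> (w z <= K)%R}.
Proof.
move=> mU mw Ufin w0 K0 H.
pose E n := U `&` w @^-1` `[(K + n.+1%:R^-1)%R, +oo[%classic.
have mE n : measurable (E n) by apply: mw => //; exact: measurable_itv.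
suff : mu.-negligible (\bigcup_n E n).
  apply: negligibleS => z /= /not_implyP[Uz /negP]; rewrite -ltNge => Kw.
  have [n Hn] := ltr_add_invr Kw.
  by exists n => //; split => //=; rewrite in_itv/= andbT ltW.
apply: negligible_bigcup => n; apply/(negligibleP _ (mE n)).
have EU : E n `<=` U by move=> z [].
have mwE : measurable_fun (E n) (EFin \o w).
  by apply/measurable_EFinP; exact: measurable_funS mw.
have Efin : mu (E n) \is a fin_num.
  rewrite ge0_fin_numE ?measure_ge0//; apply: le_lt_trans Ufin.
  by apply: le_measure; rewrite ?inE.
have := H (E n) (mE n) EU.
have : (K + n.+1%:R^-1)%:E * mu (E n) <= \int[mu]_(z in E n) (w z)%:E.
  rewrite -integral_cst//; apply: ge0_le_integral => //.
    by move=> z _; rewrite lee_fin addr_ge0// invr_ge0.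
  by move=> z [_ /=]; rewrite in_itv/= andbT lee_fin.
move=> /le_trans /[apply].
rewrite -(fineK Efin) -!EFinM lee_fin mulrDl -[leRHS]addr0 lerD2l => le0.
apply: etrans (esym (fineK Efin)) _; congr (_%:E); apply/eqP;
  rewrite eq_le fine_ge0 ?measure_ge0// andbT.
by move: le0; rewrite pmulr_rle0// invr_gt0.
Qed.

End generic.

Section cell_means.
Context (R : realType) (N : nat).
Local Notation ST := ('rV[R]_N * R)%type.
Local Notation mu := (spacetime_measure R N).
Local Notation M A := (measurable (A : set (measurableST R N))).
Implicit Types (z y : ST) (A B E U : set ST).
Local Open Scope ereal_scope.

(** This plays the role of the Lebesgue differentiation theorem. The
    inequality between integral and measure passes from cells to unions of
    cells by additivity, and from these to all measurable sets by
    approximation and absolute continuity. *)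
Lemma ae_le_of_cells n0 z0 (w : ST -> R) (K : R) :
  let U := cell n0 z0 in
  measurable_fun (U : set (measurableST R N)) w ->
    (forall z, U z -> (0 <= w z)%R) ->
  \int[mu]_(z in U) (w z)%:E < +oo -> (0 <= K)%R ->
  (forall n z, (n0 <= n)%N -> cell n z `<=` U ->
    \int[mu]_(y in cell n z) (w y)%:E <= K%:E * mu (cell n z)) ->
  {ae mu, forall z, U z -> (w z <= K)%R}.
Proof.
move=> U mw w0 wfin K0 H.
have mU : M U by exact: measurable_cell.
have Ufin : mu U < +oo by rewrite /U cell_parabolic_box mu_parabolic_box
  ?exprn_ge0// ltry.
have mwE A : A `<=` U -> measurable_fun (A : set (measurableST R N))
  (fun z => (w z)%:E).
  by move=> AU; apply/measurable_EFinP; exact: measurable_funS mw.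
have step1 n A : (n0 <= n)%N -> gridset n A -> A `<=` U ->
    \int[mu]_(y in A) (w y)%:E <= K%:E * mu A.
  move=> n0n gA AU.
  have mF m : M (nth_cell n A m) by exact: measurable_nth_cell.
  have tF := @trivIset_nth_cell R N n A.
  rewrite -{1 2}(nth_cell_bigcup n A) (measure_bigcup mu setT)//.
  rewrite ge0_integral_bigcup//; last 2 first.
  - by rewrite nth_cell_bigcup; exact: mwE.
  - by move=> z; rewrite nth_cell_bigcup lee_fin => /AU; exact: w0.
  under [X in _ <= _ * X]eq_eseriesl do rewrite in_setT.
  rewrite -nneseriesZl//; apply: lee_nneseries => [m _ _|m _].
    by apply: integral_ge0 => z [/AU Uz _]; rewrite lee_fin w0.
  have [->|[z Az E]] := nth_cellP m gA.
    by rewrite integral_set0 measure0 mule0.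
  rewrite E; apply: H => // y cy; apply: AU.
  by exact: gA (esym cy) Az.
apply: (ae_le_of_integral_le mU mw Ufin w0 K0) => E mE EU.
apply/lee_addgt0Pr => e e0.
have e2 : (0 < e / 2)%R by rewrite divr_gt0.
have [s s0 Hs] := integral_small mU mw w0 wfin e2.
have d0 : (0 < Num.min s (e / 2 / (K + 1)))%R.
  by rewrite lt_min s0/= divr_gt0// ltr_wpDl.
have [n [A gA HA]] := measurable_approx mU Ufin mE d0.
(* Intersecting with [U], itself a cell, keeps a union of cells. *)
pose B := A `&` U.
have gB : gridset (maxn n n0) B.
  apply: gridsetI; first by apply: gridset_le gA; exact: leq_maxl.
  by apply: gridset_le (@gridset_cell R N n0 z0); exact: leq_maxr.
have BU : B `<=` U by move=> z [].
have mA : M A by exact: measurable_gridset gA.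
have mB : M B by exact: measurable_gridset gB.
have mEA : M (E `\` B) by exact: measurableD.
have mBE : M (B `\` E) by exact: measurableD.
set X := U `&` _ in HA.
have mX : M X by apply: measurableI => //; apply: measurableU; apply: measurableD.
have le1 : mu (E `\` B) <= mu X.
  apply: le_measure; rewrite ?inE// => z [Ez nB]; split; first exact: EU.
  by left; split => // Az; apply: nB; split => //; exact: EU.
have le2 : mu (B `\` E) <= mu X.
  apply: le_measure; rewrite ?inE// => z [[Az Uz] nE]; split => //.
  by right.
have I1 : \int[mu]_(z in E `\` B) (w z)%:E <= (e / 2)%:E.
  apply: Hs => //; first by move=> z [/EU].
  by apply: le_lt_trans le1 _; apply: lt_le_trans HA _; rewrite lee_fin ge_min lexx.
have K2 : K%:E * mu (B `\` E) <= (e / 2)%:E.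
  apply: (@le_trans _ _ (K%:E * (e / 2 / (K + 1))%:E)).
    apply: lee_wpmul2l; first by rewrite lee_fin.
    apply: (le_trans le2); apply: le_trans (ltW HA) _.
    by rewrite lee_fin ge_min lexx orbT.
  rewrite -EFinM lee_fin mulrCA -[leRHS]mulr1 ler_wpM2l ?(ltW e2)//.
  by rewrite ler_pdivrMr ?ltr_wpDl// mul1r lerDl.
apply: (@le_trans _ _ (\int[mu]_(z in B `|` (E `\` B)) (w z)%:E)).
  apply: ge0_subset_integral => //.
  - exact: measurableU.
  - by apply: mwE => z [/BU//|[/EU]].
  - by move=> z [/BU Uz|[/EU Uz _]]; rewrite lee_fin w0.
  - by move=> z Ez; have [Bz|nB] := pselect (B z); [left|right].
rewrite ge0_integral_setU//; last 3 first.
- by apply: mwE => z [/BU//|[/EU]].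
- by move=> z [/BU Uz|[/EU Uz _]]; rewrite lee_fin w0.
- by apply/disj_setPS => z [Bz [_ nB]].
rewrite (splitr e) EFinD [leRHS]addeA; apply: leeD => //.
apply: le_trans; first exact: (step1 _ _ (leq_maxr n n0) gB BU).
apply: (@le_trans _ _ (K%:E * (mu E + mu (B `\` E)))).
  apply: lee_wpmul2l; first by rewrite lee_fin.
  apply: (@le_trans _ _ (mu (E `|` (B `\` E)))); last exact: measureU2.
  apply: le_measure; rewrite ?inE//.
    exact: measurableU.
  by move=> z Bz; have [Ez|nE] := pselect (E z); [left|right].
by rewrite ge0_muleDr ?measure_ge0// leeD2l.
Qed.

End cell_means.

(** * Test functions placed in a space-time domain *)

Section testing.
Context d (T : measurableType d) (R : realType) (mu : {measure set T -> \bar R}).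
Implicit Types (Q A B : set T).
Local Open Scope ereal_scope.

(** The form in which the weak equation is exploited: its integrand [F] has
    integral [0] and is bounded below by the difference of the two sides. *)
Lemma integral_le_of_test Q A B (F f1 f2 : T -> R) :
  measurable Q -> measurable A -> measurable B -> A `<=` Q -> B `<=` Q ->
  mu.-integrable Q (EFin \o F) -> \int[mu]_(z in Q) (F z)%:E = 0 ->
  measurable_fun A f1 -> (forall z, A z -> (0 <= f1 z)%R) ->
  measurable_fun B f2 -> (forall z, B z -> (0 <= f2 z)%R) ->
  (forall z, Q z -> ((f1 \_ A) z - (f2 \_ B) z <= F z)%R) ->
  \int[mu]_(z in A) (f1 z)%:E <= \int[mu]_(z in B) (f2 z)%:E.
Proof.
move=> mQ mA mB AQ BQ iF F0 mf1 f10 mf2 f20 H.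
have [Boo|Bfin] := eqVneq (\int[mu]_(z in B) (f2 z)%:E) +oo.
  by rewrite Boo leey.
have ext C (f : T -> R) : measurable C -> C `<=` Q ->
    \int[mu]_(z in C) (f z)%:E = \int[mu]_(z in Q) ((f \_ C) z)%:E.
  move=> mC CQ; rewrite -[in LHS](setIidr CQ) integral_mkcondr.
  by apply: eq_integral => z _; rewrite !patchE; case: ifP.
have mext C (f : T -> R) : measurable C -> C `<=` Q -> measurable_fun C f ->
  measurable_fun Q (f \_ C).
  move=> mC CQ mf; apply: (measurable_restrict f mC mQ).1.
  by rewrite setIidr.
have p0 C (f : T -> R) z : (forall z, C z -> (0 <= f z)%R) -> (0 <= (f \_ C) z)%R.
  by move=> f0; rewrite patchE; case: ifPn => // /set_mem; exact: f0.
have i2 : mu.-integrable Q (EFin \o (f2 \_ B)).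
  apply/integrableP; split; first by apply/measurable_EFinP; exact: mext.
  under eq_integral do rewrite /= ger0_norm ?p0//.
  by rewrite -ext// ltey.
rewrite (ext A)// (ext B)//.
rewrite -[leRHS]add0e -F0 -integralD//.
apply: ge0_le_integral => //.
- by move=> z _; rewrite lee_fin p0.
- by apply/measurable_EFinP; exact: mext.
- by apply: emeasurable_funD; [have /integrableP[] := iF|have /integrableP[] := i2].
- by move=> z Qz; rewrite -EFinD lee_fin -lerBlDr; exact: H.
Qed.

End testing.

Section boxes.
Context (R : realType) (N : nat).
Local Notation ST := ('rV[R]_N * R)%type.
Local Notation mu := (spacetime_measure R N).
Local Notation M A := (measurable (A : set (measurableST R N))).
Implicit Types (z y : ST) (A B E U Q : set ST) (u f phi : ST -> R).

Definition closed_box z0 (rho a b : R) : set ST :=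
  [set z : ST | (forall i, `|z.1 ord0 i - z0.1 ord0 i| <= rho) /\ a <= z.2 <= b].

Lemma closed_box_compact z0 rho a b : compact (closed_box z0 rho a b).
Proof.
have -> : closed_box z0 rho a b =
    [set x : 'rV[R]_N | forall i,
      `[z0.1 ord0 i - rho, z0.1 ord0 i + rho]%classic (x ord0 i)]
    `*` `[a, b]%classic.
  apply/seteqP; split => -[x t]; rewrite /closed_box/= => -[Hx Ht].
    by split => [i|]; rewrite in_itv/=//; have := Hx i; rewrite ler_distl.
  by split => [i|]; [rewrite ler_distl; have := Hx i|move: Ht]; rewrite in_itv.
apply: compact_setX; last exact: segment_compact.
by apply: (@rV_compact _ _
  (fun i => `[z0.1 ord0 i - rho, z0.1 ord0 i + rho]%classic)) => i;
  exact: segment_compact.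
Qed.

Lemma closed_box_closed z0 rho a b : closed (closed_box z0 rho a b).
Proof. by apply: compact_closed;
  [exact: norm_hausdorff|exact: closed_box_compact]. Qed.

Lemma measurable_closed_box z0 rho a b : M (closed_box z0 rho a b).
Proof.
rewrite -[closed_box _ _ _ _]setCK; apply: measurableC; apply: open_measurable_st.
exact/closed_openC/closed_box_closed.
Qed.

Lemma test_of_box Q phi z0 rho a b : (forall n, Ck n setT phi) ->
  (forall z, phi z != 0 -> closed_box z0 rho a b z) ->
  closed_box z0 rho a b `<=` Q ->
  test_function Q phi.
Proof.
move=> Cphi supp KQ.
have clK : closure [set z | phi z != 0] `<=` closed_box z0 rho a b.
  rewrite [X in _ `<=` X](closure_id _).1; last exact: closed_box_closed.
  by apply: closure_subset => z; exact: supp.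
split; first exact: smooth_Ck.
  apply: (subclosed_compact _ (@closed_box_compact z0 rho a b)) => //.
  exact: closed_closure.
exact: subset_trans clK KQ.
Qed.

Lemma heat_out_box phi z0 rho a b z :
  (forall z, phi z != 0 -> closed_box z0 rho a b z) -> ~ closed_box z0 rho a b z ->
  [/\ phi z = 0, ddt phi z = 0 & laplacian phi z = 0].
Proof.
move=> supp nK.
have o : open (~` closed_box z0 rho a b) by exact/closed_openC/closed_box_closed.
have n0 : \near z, phi z = 0.
  apply: filterS (open_nbhs_nbhs (conj o nK)) => y /= nKy.
  by apply: contrapT => /eqP p; apply: nKy; exact: supp.
have [-> ->] := near_eq0_derive n0; split => //; exact: nbhs_singleton n0.
Qed.

(** Seen from the pole backwards in time, [parabolic_box x l] lies between [2
    l^2] and [3 l^2], the core where the cut-off kernel has a large source. *)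
Definition pole (x : ST) (l : R) : ST := (x.1, x.2 + 3 * l ^+ 2).
Definition kernel_support (x : ST) (l rho : R) : set ST :=
  closed_box (pole x l) rho ((pole x l).2 - rho ^+ 2) ((pole x l).2 - l ^+ 2).
Definition kernel_test (x : ST) (l rho : R) : ST -> R :=
  @heat_test R N (l / rho) \o rescale (- rho^-1) (- (rho ^+ 2)^-1) (pole x l).

(** The estimates of [heat_test] with [d = l / rho], after rescaling to radius
    [rho] and reversing time, which exchanges [ddt - laplacian] with [- (ddt +
    laplacian)]. *)
Lemma kernel_test_props : (1 <= N)%N -> exists C c : R, [/\ 0 < C, 0 < c &
  forall x l rho Q, 0 < l -> 0 < rho -> 12 * N%:R * l ^+ 2 <= rho ^+ 2 ->
  kernel_support x l rho `<=` Q ->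
  let phi := kernel_test x l rho in
  [/\ test_function Q phi,
      forall z, 0 <= phi z <= (rho / l) ^+ N,
      forall z, ~ kernel_support x l rho z ->
        [/\ phi z = 0, ddt phi z = 0 & laplacian phi z = 0],
      forall z, ddt phi z + laplacian phi z <= C / rho ^+ 2 &
      forall z, parabolic_box x l z ->
        ddt phi z + laplacian phi z <= - (c * (rho / l) ^+ N.+2 / rho ^+ 2)]].
Proof.
move=> N1; have [C [c [C0 c0 H]]] := heat_test_heat_lb R N1.
exists (C + 1), c; split => //; first by rewrite ltr_wpDl.
move=> x l rho Q l0 r0 lr KQ phi.
set d := l / rho; have d0 : 0 < d by rewrite divr_gt0.
have r20 : 0 < rho ^+ 2 by rewrite exprn_gt0.
have d1 : 12 * N%:R * d ^+ 2 <= 1.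
  by rewrite /d expr_div_n mulrA ler_pdivrMr// mul1r.
have [H1 H2] := H d d0 d1.
have Cpsi := @heat_test_smooth R N d d0.
have Cphi n : Ck n setT phi by apply: Ck_rescale; exact: Cpsi.
have dl : rho ^+ 2 * d ^+ 2 = l ^+ 2.
  by rewrite /d expr_div_n mulrC divfK// gt_eqF.
set L := rescale (- rho^-1) (- (rho ^+ 2)^-1) (pole x l).
have L1 z i : (L z).1 ord0 i = (x.1 ord0 i - z.1 ord0 i) / rho.
  by rewrite /L/= !mxE mulNr -mulrN opprB mulrC.
have L2 z : (L z).2 = ((pole x l).2 - z.2) / rho ^+ 2.
  by rewrite /L/= mulNr -mulrN opprB mulrC.
have supp z : phi z != 0 -> kernel_support x l rho z.
  move=> /(heat_test_supp d0); rewrite -/L => -[Hx /andP[t1 t2]]; split.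
    move=> i; have := Hx i; rewrite L1 normrM normfV (gtr0_norm r0).
    by rewrite ler_pdivrMr// mul1r distrC.
  move: t1 t2; rewrite L2 ler_pdivlMr// ler_pdivrMr// mulrC dl mul1r => t1 t2.
  by apply/andP; split; lra.
have heat z : ddt phi z + laplacian phi z =
    - ((ddt (heat_test d) (L z) - laplacian (heat_test d) (L z)) / rho ^+ 2).
  have [df _] := Cpsi 1%N.
  rewrite /phi /kernel_test -/d ddt_rescale; last exact: df.
  rewrite laplacian_rescale; last exact: Cpsi.
  by rewrite -/L sqrrN exprVn; ring.
split.
- exact: test_of_box Cphi supp KQ.
- move=> z; rewrite heat_test_ge0//=.
  have -> : (rho / l) ^+ N = (d ^+ N)^-1 by rewrite -exprVn /d invf_div.
  exact: heat_test_le.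
- by move=> z; exact: heat_out_box.
- move=> z; rewrite heat -mulNr ler_wpM2r// ?invr_ge0 ?(ltW r20)//.
  by have := H1 (L z); lra.
- move=> z [zx /andP[zt1 zt2]]; rewrite heat lerN2 ler_wpM2r ?invr_ge0 ?(ltW r20)//.
  have -> : (rho / l) ^+ N.+2 = (d ^+ N.+2)^-1 by rewrite -exprVn /d invf_div.
  apply: H2 => [i|].
    rewrite L1 normrM normfV (gtr0_norm r0) /d ler_pM2r ?invr_gt0//.
    by have /andP[z1 z2] := zx i; rewrite ler_norml; apply/andP; split; lra.
  move: (d ^+ 2) dl zt1 zt2 => e dl zt1 zt2.
  by rewrite L2 ler_pdivlMr// ler_pdivrMr// /pole/=; apply/andP; split; lra.
Qed.

(** The reference point is on the top, as is usual for backward parabolic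
    cylinders. *)
Definition parabolic_cyl z0 (r : R) : set ST :=
  [set z : ST | (forall i, `|z.1 ord0 i - z0.1 ord0 i| < r) /\ z0.2 - r ^+ 2 <
    z.2 < z0.2].

Definition absorb_test z0 (r h : R) : ST -> R :=
  @window_test R N h \o rescale (r / 2)^-1 ((r / 2) ^+ 2)^-1 z0.

(** The cut-offs are Euclidean while cylinders are cubes in space: dividing
    the radius by [4 * N] puts the small cylinder inside the region where the
    spatial cut-off is constant. *)
Lemma absorb_test_props : (1 <= N)%N -> exists C c : R, [/\ 0 < C, 0 < c &
  forall z0 r h Q, 0 < r -> 0 < h -> parabolic_cyl z0 r `<=` Q ->
  let phi := absorb_test z0 r h in
  [/\ test_function Q phi,
      forall z, 0 <= phi z,
      forall z, ~ parabolic_cyl z0 r z ->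
        [/\ phi z = 0, ddt phi z = 0 & laplacian phi z = 0],
      forall z, ddt phi z + laplacian phi z <= C / r ^+ 2 &
      forall z, parabolic_cyl z0 (r / (4 * N%:R)) z ->
        z.2 <= z0.2 - h * r ^+ 2 -> c <= phi z]].
Proof.
move=> N1; have [C [c [C0 c0 H]]] := window_test_bounds R N1.
exists (4 * C + 1), c; split => //; first by rewrite ltr_wpDl ?mulr_ge0.
move=> z0 r h Q r0 h0 KQ phi.
have NR : 1 <= N%:R :> R by rewrite ler1n.
have N0 : 0 < N%:R :> R by lra.
have [H1 H2] := H h h0.
set rho := r / 2; have rho0 : 0 < rho by rewrite divr_gt0.
have rho20 : 0 < rho ^+ 2 by rewrite exprn_gt0.
have r2 : r ^+ 2 = 4 * rho ^+ 2 by rewrite /rho; field.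
have Cphi n : Ck n setT phi by apply: Ck_rescale; exact: window_test_smooth.
set L := rescale rho^-1 (rho ^+ 2)^-1 z0.
have L1 z i : (L z).1 ord0 i = (z.1 ord0 i - z0.1 ord0 i) / rho.
  by rewrite /L/= !mxE mulrC.
have L2 z : (L z).2 = (z.2 - z0.2) / rho ^+ 2 by rewrite /L/= mulrC.
have supp z : phi z != 0 -> closed_box z0 rho (z0.2 - rho ^+ 2)
  (z0.2 - h * rho ^+ 2) z.
  move=> /(window_test_supp h0); rewrite -/rho -/L => -[Hx /andP[t1 t2]]; split.
    move=> i; have := Hx i; rewrite L1 normrM normfV (gtr0_norm rho0).
    by rewrite ler_pdivrMr// mul1r.
  move: t1 t2; rewrite L2 ler_pdivlMr// ler_pdivrMr// mulN1r mulNr => t1 t2.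
  by apply/andP; split; lra.
have sub : closed_box z0 rho (z0.2 - rho ^+ 2) (z0.2 - h * rho ^+ 2) `<=`
  parabolic_cyl z0 r.
  move=> z [Hx /andP[t1 t2]]; split => [i|].
    by apply: le_lt_trans (Hx i) _; rewrite /rho; lra.
  have : 0 < h * rho ^+ 2 by rewrite mulr_gt0.
  by rewrite r2 => ?; apply/andP; split; lra.
have heat z : ddt phi z + laplacian phi z =
    (ddt (window_test h) (L z) + laplacian (window_test h) (L z)) / rho ^+ 2.
  have [df _] := @window_test_smooth R N h 1%N.
  rewrite /phi /absorb_test -/rho ddt_rescale; last exact: df.
  rewrite laplacian_rescale; last exact: window_test_smooth.
  by rewrite -/L exprVn; ring.
split.
- by apply: (test_of_box Cphi supp); exact: subset_trans KQ.
- by move=> z; exact: window_test_ge0.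
- by move=> z nz; apply: (heat_out_box supp) => Kz; apply: nz; exact: sub.
- move=> z; have -> : (4 * C + 1) / r ^+ 2 = (C + 1 / 4) / rho ^+ 2.
    by rewrite r2; field; rewrite gt_eqF.
  rewrite heat ler_wpM2r ?invr_ge0 ?(ltW rho20)//.
  by have := H1 (L z); lra.
- move=> z [zx /andP[zt1 zt2]] zh; apply: H2 => [i|].
    rewrite -/rho -/L L1 normrM normfV (gtr0_norm rho0) ler_pdivrMr//.
    apply: le_trans (ltW (zx i)) _; rewrite /rho le_eqVlt; apply/orP; left;
      apply/eqP.
    by field; rewrite gt_eqF.
  rewrite -/rho -/L L2 ler_pdivlMr// ler_pdivrMr//; apply/andP; split; last first.
    have hr : 0 < h * rho ^+ 2 by rewrite mulr_gt0.
    by move: zh; rewrite r2; lra.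
  have : (r / (4 * N%:R)) ^+ 2 <= 4^-1 * rho ^+ 2.
    have -> : (r / (4 * N%:R)) ^+ 2 = 4^-1 * rho ^+ 2 * (N%:R ^+ 2)^-1.
      by rewrite /rho; field; rewrite gt_eqF.
    apply: ler_piMr; first by rewrite mulr_ge0 ?(ltW rho20).
    rewrite invf_le1 ?exprn_gt0//.
    by rewrite exprn_ege1.
  by lra.
Qed.

End boxes.

(** * The mass absorbed in a cylinder *)

Section heat_absorption.
Context (R : realType) (N : nat).
Local Notation ST := ('rV[R]_N * R)%type.
Local Notation mu := (spacetime_measure R N).
Local Notation M A := (measurable (A : set (measurableST R N))).
Implicit Types (z y : ST) (A B E U Q : set ST) (u f phi : ST -> R).
Local Open Scope ereal_scope.

Lemma integralZ_fin A u (c : R) : M A ->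
    measurable_fun (A : set (measurableST R N)) u ->
  (forall z, A z -> 0 <= u z)%R -> (0 <= c)%R ->
  \int[mu]_(z in A) (c * u z)%:E = c%:E * \int[mu]_(z in A) (u z)%:E.
Proof.
move=> mA mu' u0 c0; under eq_integral do rewrite EFinM.
by apply: ge0_integralZl => //; exact/measurable_EFinP.
Qed.

(** Nonnegative weak solutions of the heat equation with a nonnegative
    absorption term. *)
Definition heat_absorption Q u f :=
  [/\ M Q, measurable_fun (Q : set (measurableST R N)) u,
    measurable_fun (Q : set (measurableST R N)) f,
      (forall z, Q z -> 0 <= u z /\ 0 <= f z)%R & weak_heat_eq Q u f].

Lemma parabolic_cyl_open z0 r : open (parabolic_cyl z0 r).
Proof.
have -> : parabolic_cyl z0 r =
  \bigcap_(i in [set: 'I_N]) ([set z : ST | z0.1 ord0 i - r < z.1 ord0 i] `&`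
     [set z : ST | z.1 ord0 i < z0.1 ord0 i + r])%R `&`
   ([set z : ST | z0.2 - r ^+ 2 < z.2] `&` [set z : ST | z.2 < z0.2])%R.
  apply/seteqP; split => z.
    move=> [Hx /andP[t1 t2]]; split => // i _.
    by have := Hx i; rewrite ltr_distl => /andP[].
  move=> [Hx [t1 t2]]; split => [i|]; last by apply/andP.
  by have [x1 x2] := Hx i I; rewrite ltr_distl; apply/andP.
have cc i : continuous (fun z : ST => z.1 ord0 i).
  move=> x; apply: (@continuous_comp _ _ _ fst (fun y : 'rV[R]_N => y ord0 i)).
    exact: cvg_fst.
  exact: coord_continuous.
have ct : continuous (fun z : ST => z.2) by move=> x; exact: cvg_snd.
apply: openI; last by apply: openI; [exact: open_superlevel|exact: open_sublevel].
have oi i : open ([set z : ST | z0.1 ord0 i - r < z.1 ord0 i] `&`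
     [set z : ST | z.1 ord0 i < z0.1 ord0 i + r])%R.
  by apply: openI; [exact: open_superlevel|exact: open_sublevel].
have -> : \bigcap_(i in [set: 'I_N])
  ([set z : ST | z0.1 ord0 i - r < z.1 ord0 i] `&`
     [set z : ST | z.1 ord0 i < z0.1 ord0 i + r])%R =
  \big[setI/setT]_(i < N) ([set z : ST | z0.1 ord0 i - r < z.1 ord0 i] `&`
     [set z : ST | z.1 ord0 i < z0.1 ord0 i + r])%R.
  apply/seteqP; split => z.
    move=> Hz; apply: (big_ind (fun B : set _ => B z)) => // i _; exact: Hz.
  by move=> + i _; rewrite (bigD1 i)//= => -[].
by apply: big_ind => //; [exact: openT|exact: openI].
Qed.

Lemma measurable_parabolic_cyl z0 r : M (parabolic_cyl z0 r).
Proof. by apply: open_measurable_st; exact: parabolic_cyl_open. Qed.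

Lemma parabolic_cyl_le z0 (r s : R) : (0 <= r <= s)%R ->
  parabolic_cyl z0 r `<=` parabolic_cyl z0 s.
Proof.
move=> /andP[r0 rs] z [Hx /andP[t1 t2]]; split => [i|].
  exact: lt_le_trans (Hx i) rs.
rewrite t2 andbT; apply: le_lt_trans t1; rewrite lerD2l lerN2.
by rewrite lerXn2r ?nnegrE// (le_trans r0).
Qed.

Lemma absorption_restrict Q u f A : heat_absorption Q u f -> A `<=` Q ->
  [/\ measurable_fun (A : set (measurableST R N)) u,
    measurable_fun (A : set (measurableST R N)) f,
   (forall z, A z -> 0 <= u z)%R & (forall z, A z -> 0 <= f z)%R].
Proof.
move=> [mQ mu' mf p0 _] AQ; split.
- exact: measurable_funS mu'.
- exact: measurable_funS mf.
- by move=> z /AQ/p0[].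
- by move=> z /AQ/p0[].
Qed.

(** Testing with a cut-off [phi] gives [int f phi = int u (phi_t + Delta
    phi)], where [phi] is bounded below on the small cylinder and [phi_t +
    Delta phi <= C / r^2]. Test functions vanish near the top, so the estimate
    first stops at height [h r^2] below it and [h] then tends to [0]. *)
Lemma absorption_integral_le : (1 <= N)%N -> exists2 C : R, (0 < C)%R &
  forall Q u f, heat_absorption Q u f -> forall z0 r, (0 < r)%R ->
    parabolic_cyl z0 r `<=` Q ->
  \int[mu]_(z in parabolic_cyl z0 (r / (4 * N%:R))%R) (f z)%:E <=
    (C / r ^+ 2)%:E * \int[mu]_(z in parabolic_cyl z0 r) (u z)%:E.
Proof.
move=> N1; have [C [c [C0 c0 H]]] := absorb_test_props R N1.
exists (C / c)%R; first by rewrite divr_gt0.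
move=> Q u f S z0 r r0 KQ.
have [mQ _ _ p0 wk] := S.
have r20 : (0 < r ^+ 2)%R by rewrite exprn_gt0.
set k := (r / (4 * N%:R))%R.
have NR : (1 <= N%:R :> R)%R by rewrite ler1n.
have kr : (0 <= k <= r)%R.
  have N4 : (0 < 4 * N%:R :> R)%R by lra.
  apply/andP; split; first by rewrite /k divr_ge0// ltW.
  by rewrite /k ler_pdivrMr//; nra.
have kQ : parabolic_cyl z0 k `<=` Q by apply: subset_trans KQ;
  exact: parabolic_cyl_le.
have [mu1 _ u0 _] := absorption_restrict S KQ.
have [_ mf1 _ f0] := absorption_restrict S kQ.
(* The part of the small cylinder where the test function with [h = 1 / n.+1]
   is bounded below. *)
pose A n := parabolic_cyl z0 k `&`
  [set z : ST | (z.2 < z0.2 - n.+1%:R^-1 * r ^+ 2)%R].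
have mA n : M (A n).
  apply: measurableI; first exact: measurable_parabolic_cyl.
  apply: open_measurable_st; apply: open_sublevel => x; exact: cvg_snd.
have AE : \bigcup_n A n = parabolic_cyl z0 k.
  apply/seteqP; split => z; first by move=> [n _ []].
  move=> kz; have [_ /andP[_ zt]] := kz.
  have : (0 < (z0.2 - z.2) / r ^+ 2)%R by rewrite divr_gt0// subr_gt0.
  move=> /ltr_add_invr[n]; rewrite add0r ltr_pdivlMr// => Hn.
  have Hn' : (z.2 < z0.2 - n.+1%:R^-1 * r ^+ 2)%R by rewrite ltrBrDr -ltrBrDl.
  by exists n.
have bound n : \int[mu]_(z in A n) (f z)%:E <=
    (C / c / r ^+ 2)%:E * \int[mu]_(z in parabolic_cyl z0 r) (u z)%:E.
  have h0 : (0 < n.+1%:R^-1 :> R)%R by rewrite invr_gt0.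
  have [tphi phi0 out up low] := H z0 r _ Q r0 h0 KQ.
  have [iF F0] := wk _ tphi.
  have AQ : A n `<=` Q by apply: subset_trans kQ => z [].
  have [_ mfA _ fA] := absorption_restrict S AQ.
  have T : \int[mu]_(z in A n) (c * f z)%:E <=
    \int[mu]_(z in parabolic_cyl z0 r) (C / r ^+ 2 * u z)%:E.
    apply: (integral_le_of_test mQ (mA n) (measurable_parabolic_cyl z0 r) AQ KQ
      iF F0).
    - by apply: measurable_funM.
    - by move=> z Az; apply: mulr_ge0; [exact: ltW|exact: fA].
    - by apply: measurable_funM.
    - by move=> z Kz; apply: mulr_ge0; [rewrite divr_ge0 ?ltW|exact: u0].
    move=> z Qz; have [uz fz] := p0 _ Qz; rewrite !patchE.
    have [Kz|nK] := pselect (parabolic_cyl z0 r z); last first.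
      have [-> -> ->] := out _ nK.
      have -> : (z \in parabolic_cyl z0 r) = false by exact: memNset.
      have -> : (z \in A n) = false.
        by apply: memNset => -[kz _]; apply: nK; exact: parabolic_cyl_le kz.
      by rewrite !mulr0 oppr0 !addr0.
    have -> : (z \in parabolic_cyl z0 r) = true by exact: mem_set.
    have P1 : ((if z \in A n then c * f z else 0) <= f z * absorb_test z0 r
      n.+1%:R^-1 z)%R.
      case: ifPn => [/set_mem[kz At]|_]; last by rewrite mulr_ge0.
      by rewrite mulrC ler_wpM2l// low//; exact: ltW.
    have P2 : (u z * (ddt (absorb_test z0 r n.+1%:R^-1) z +
        laplacian (absorb_test z0 r n.+1%:R^-1) z) <= C / r ^+ 2 * u z)%R.
      by rewrite mulrC ler_wpM2r.
    move: P1 P2; rewrite mulrDr; set a := (if _ then _ else _).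
    set b := (C / r ^+ 2 * u z)%R; move: (f z * _)%R (u z * _)%R (u z * _)%R =>
      x1 x2 x3.
    by move: a b => a b P1 P2; lra.
  rewrite (integralZ_fin (mA n) mfA fA (ltW c0)) in T.
  rewrite (integralZ_fin (measurable_parabolic_cyl z0 r) mu1 u0) in T; last first.
    by rewrite divr_ge0 ?ltW.
  move: T.
  have ci : (0 <= (c^-1)%:E :> \bar R) by rewrite lee_fin invr_ge0 ltW.
  move=> /(lee_wpmul2l ci); rewrite !muleA -!EFinM mulVf ?gt_eqF// mul1e.
  by rewrite mulrCA mulrA.
have ndA : {homo A : n m / (n <= m)%N >-> (n <= m)%O}.
  move=> n m nm; apply/subsetPset => z [kz /= tz]; split => //=.
  apply: lt_le_trans tz _; rewrite lerD2l lerN2 ler_wpM2r ?(ltW r20)//.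
  by rewrite lef_pV2 ?posrE// ler_nat ltnS.
have cv := @ge0_nondecreasing_set_cvg_integral _ (measurableST R N) _ A
  (fun z => (f z)%:E) mu ndA mA.
rewrite -AE -(cvg_lim _ (cv _ _))//; last 2 first.
- move=> n; apply/measurable_EFinP; apply: measurable_funS mf1;
  first exact: measurable_parabolic_cyl.
  by move=> z [].
- by move=> n z [kz _]; rewrite lee_fin f0.
apply: lime_le; last by apply: nearW.
apply/cvg_ex; eexists; apply: cv.
- move=> n; apply/measurable_EFinP; apply: measurable_funS mf1;
  first exact: measurable_parabolic_cyl.
  by move=> z [].
- by move=> n z [kz _]; rewrite lee_fin f0.
Qed.

End heat_absorption.

(** * The mean value inequality *)

Section mean_value.
Context (R : realType) (N : nat).
Local Notation ST := ('rV[R]_N * R)%type.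
Local Notation mu := (spacetime_measure R N).
Local Notation M A := (measurable (A : set (measurableST R N))).
Implicit Types (z y : ST) (A B E U Q : set ST) (u f phi : ST -> R).
Local Open Scope ereal_scope.

Lemma parabolic_box_kernel_support (x : ST) (l rho : R) : (0 < l)%R ->
    (0 < rho)%R ->
  (3 * l ^+ 2 <= rho ^+ 2)%R -> parabolic_box x l `<=` kernel_support x l rho.
Proof.
move=> l0 r0 lr z [Hx /andP[t1 t2]]; have lr' : (l <= rho)%R.
  rewrite -(@ler_pXn2r _ 2)// ?nnegrE ?(ltW l0) ?(ltW r0)//.
  by apply: le_trans lr; have := exprn_gt0 2 l0; lra.
split => [i|].
  by have /andP[x1 x2] := Hx i; rewrite /pole/= ler_norml; apply/andP; split; lra.
by rewrite /pole/=; apply/andP; split; lra.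
Qed.

(** Testing with the kernel whose pole is above the box: the absorption term
    is nonnegative, [phi_t + Delta phi] is at most [C / rho^2] everywhere and
    at most [- c (rho/l)^(N+2) / rho^2] on the box. The factor [(l/rho)^(N+2)]
    is the ratio of volumes, so this compares averages, uniformly in [l]. *)
Lemma cell_integral_le : (1 <= N)%N -> exists2 C : R, (0 < C)%R &
  forall Q u f, heat_absorption Q u f -> forall x l rho B, (0 < l)%R ->
    (0 < rho)%R ->
  (12 * N%:R * l ^+ 2 <= rho ^+ 2)%R -> kernel_support x l rho `<=` B ->
  M B -> B `<=` Q ->
  \int[mu]_(z in parabolic_box x l) (u z)%:E <=
    (C * (l / rho) ^+ N.+2)%:E * \int[mu]_(z in B) (u z)%:E.
Proof.
move=> N1; have [C [c [C0 c0 H]]] := kernel_test_props R N1.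
exists (C / c)%R; first by rewrite divr_gt0.
move=> Q u f S x l rho B l0 r0 lr KB mB BQ.
have [mQ _ _ p0 wk] := S.
have r20 : (0 < rho ^+ 2)%R by rewrite exprn_gt0.
have NR : (1 <= N%:R :> R)%R by rewrite ler1n.
have lr3 : (3 * l ^+ 2 <= rho ^+ 2)%R by have := exprn_gt0 2 l0; nra.
have pB : parabolic_box x l `<=` B :=
  subset_trans (parabolic_box_kernel_support l0 r0 lr3) KB.
have pQ : parabolic_box x l `<=` Q := subset_trans pB BQ.
have [mup _ up _] := absorption_restrict S pQ.
have [muB _ uB _] := absorption_restrict S BQ.
have [tphi phi0 out H1 H2] := H x l rho Q l0 r0 lr (subset_trans KB BQ).
have [iF F0] := wk _ tphi.
set k := (c * (rho / l) ^+ N.+2 / rho ^+ 2)%R.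
have k0 : (0 < k)%R.
  by apply: divr_gt0 => //; apply: mulr_gt0 => //; apply: exprn_gt0;
    exact: divr_gt0.
have mp := @measurable_parabolic_box R N x l.
have C20 : (0 <= C / rho ^+ 2)%R by rewrite divr_ge0 ?ltW.
have T : \int[mu]_(z in parabolic_box x l) (k * u z)%:E <= \int[mu]_(z in B)
  (C / rho ^+ 2 * u z)%:E.
  apply: (integral_le_of_test mQ mp mB pQ BQ iF F0).
  - by apply: measurable_funM.
  - by move=> z Az; apply: mulr_ge0; [exact: ltW|exact: up].
  - by apply: measurable_funM.
  - by move=> z Kz; apply: mulr_ge0; [|exact: uB].
  move=> z Qz; have [uz fz] := p0 _ Qz; rewrite !patchE.
  have [Kz|nK] := pselect (kernel_support x l rho z); last first.
    have [-> -> ->] := out _ nK.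
    have -> : (z \in parabolic_box x l) = false.
      by apply: memNset => kz; apply: nK; exact: parabolic_box_kernel_support kz.
    rewrite !mulr0 oppr0 !addr0 sub0r oppr_le0; case: ifPn => // _.
    by rewrite mulr_ge0.
  have -> : (z \in B) = true by apply: mem_set; exact: KB.
  have fp : (0 <= f z * kernel_test x l rho z)%R.
    by rewrite mulr_ge0//; have /andP[] := phi0 z.
  have : (u z * (ddt (kernel_test x l rho) z + laplacian (kernel_test x l rho) z) <=
     C / rho ^+ 2 * u z - (if z \in parabolic_box x l then k * u z else 0))%R.
    case: ifPn => [/set_mem pz|_].
      have h2 := H2 _ pz; rewrite -/k in h2.
      rewrite (@le_trans _ _ (u z * - k))%R ?ler_wpM2l//.
      by rewrite mulrN mulrC lerDr mulr_ge0.
    by rewrite subr0 mulrC ler_wpM2r.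
  rewrite mulrDr; set a := (if _ then _ else _).
  set b := (C / rho ^+ 2 * u z)%R.
  move: (f z * _)%R fp (u z * _)%R (u z * _)%R => x1 x10 x2 x3.
  by move: a b => a b; lra.
rewrite (integralZ_fin mp mup up (ltW k0)) (integralZ_fin mB muB uB C20) in T.
have ci : (0 <= (k^-1)%:E :> \bar R) by rewrite lee_fin invr_ge0 ltW.
move: T => /(lee_wpmul2l ci); rewrite !muleA -!EFinM mulVf ?gt_eqF// mul1e.
move/le_trans; apply; rewrite le_eqVlt; apply/orP; left; apply/eqP.
congr ((_%:E) * _)%E; rewrite /k.
have -> : ((l / rho) ^+ N.+2 = ((rho / l) ^+ N.+2)^-1)%R by rewrite -exprVn
  invf_div.
have := exprn_gt0 N.+2 (divr_gt0 r0 l0); move: (_ ^+ _)%R => X X0.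
by field; rewrite !gt_eqF.
Qed.

(** A solution is only known to have integrable powers, possibly with an
    exponent below [1]. Integrability of [u] itself comes from the weak
    equation: its integrand is integrable, and on the box its absolute value
    is at least a positive multiple of [u] minus a multiple of [f]. *)
Lemma cell_integral_lty : (1 <= N)%N ->
  forall Q u f, heat_absorption Q u f -> forall x l rho, (0 < l)%R -> (0 < rho)%R ->
  (12 * N%:R * l ^+ 2 <= rho ^+ 2)%R -> kernel_support x l rho `<=` Q ->
  \int[mu]_(z in kernel_support x l rho) (f z)%:E < +oo ->
  \int[mu]_(z in parabolic_box x l) (u z)%:E < +oo.
Proof.
move=> N1; have [C [c [C0 c0 H]]] := kernel_test_props R N1.
move=> Q u f S x l rho l0 r0 lr KQ ffin.
have [mQ _ _ p0 wk] := S.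
have r20 : (0 < rho ^+ 2)%R by rewrite exprn_gt0.
have NR : (1 <= N%:R :> R)%R by rewrite ler1n.
have lr3 : (3 * l ^+ 2 <= rho ^+ 2)%R by have := exprn_gt0 2 l0; nra.
have pK : parabolic_box x l `<=` kernel_support x l rho
  by exact: parabolic_box_kernel_support.
have pQ : parabolic_box x l `<=` Q := subset_trans pK KQ.
have [mup mfp up fp] := absorption_restrict S pQ.
have [_ mfK _ fK] := absorption_restrict S KQ.
have [tphi phi0 out H1 H2] := H x l rho Q l0 r0 lr KQ.
have [iF F0] := wk _ tphi.
set k := (c * (rho / l) ^+ N.+2 / rho ^+ 2)%R in H2.
have k0 : (0 < k)%R.
  by apply: divr_gt0 => //; apply: mulr_gt0 => //; apply: exprn_gt0;
    exact: divr_gt0.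
have mp := @measurable_parabolic_box R N x l.
have mK : M (kernel_support x l rho) by exact: measurable_closed_box.
set F := (fun z => _) in iF F0.
set D := ((rho / l) ^+ N)%R in phi0.
have D0 : (0 <= D)%R by rewrite exprn_ge0// divr_ge0 ?ltW.
have iFp : mu.-integrable (parabolic_box x l) F by apply: integrableS iF.
have /integrableP[mFp Ffin] := iFp.
have : \int[mu]_(z in parabolic_box x l) (k * u z)%:E <=
    \int[mu]_(z in parabolic_box x l) (`|F z| + (D * f z)%:E).
  apply: ge0_le_integral => //.
  - by move=> z pz; rewrite lee_fin mulr_ge0 ?up// ltW.
  - by apply/measurable_EFinP; apply: measurable_funM.
  - apply: emeasurable_funD; first exact: measurableT_comp.
    by apply/measurable_EFinP; apply: measurable_funM.
  move=> z pz; have [uz fz] := p0 _ (pQ _ pz).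
  rewrite /F -EFinD lee_fin.
  have := H2 z pz; set a := ddt _ z; set b := laplacian _ z => ab.
  have kab : (k * u z <= - (u z * (a + b)))%R.
    by rewrite -mulrN mulrC ler_wpM2l// lerNr.
  have /andP[g0 g1] := phi0 z; set g := kernel_test _ _ _ z in g0 g1 *.
  have fg : (f z * g <= D * f z)%R by rewrite mulrC ler_wpM2r.
  have := ler_norm (- (u z * a) - u z * b + f z * g)%R.
  rewrite mulrDr in kab.
  have fg0 : (0 <= f z * g)%R by rewrite mulr_ge0.
  move: kab fg fg0; move: (u z * a)%R (u z * b)%R (f z * g)%R => xa xb xg.
  by move: (k * u z)%R (D * f z)%R `|_|%R => kk dd nn; lra.
rewrite (integralZ_fin mp mup up (ltW k0)) ge0_integralD//; last 3 first.
- exact: measurableT_comp.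
- by move=> z pz; rewrite lee_fin mulr_ge0// fp.
- by apply/measurable_EFinP; apply: measurable_funM.
rewrite (integralZ_fin mp mfp fp D0) => T.
have ffp : \int[mu]_(z in parabolic_box x l) (f z)%:E < +oo.
  apply: le_lt_trans ffin; apply: ge0_subset_integral => //.
  exact/measurable_EFinP.
have : k%:E * \int[mu]_(z in parabolic_box x l) (u z)%:E < +oo.
  apply: le_lt_trans T _; apply: lte_add_pinfty => //.
  by apply: lte_mul_pinfty => //; rewrite ?lee_fin ?fin_numE.
have i0 : 0 <= \int[mu]_(z in parabolic_box x l) (u z)%:E.
  by apply: integral_ge0 => z pz; rewrite lee_fin up.
move: i0; case: (\int[mu]_(z in parabolic_box x l) (u z)%:E) => [s _ _|_|//].
  exact: ltry.
by rewrite gt0_muley ?lte_fin.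
Qed.

(** [cell_integral_le] bounds the averages over all small cells by the same
    constant, and [ae_le_of_cells] turns this into an almost everywhere bound. *)
Lemma mean_value_le : (1 <= N)%N -> exists2 C : R, (0 < C)%R &
  forall Q u f, heat_absorption Q u f -> forall z0 (r B : R), (0 < r)%R ->
    parabolic_cyl z0 r `<=` Q ->
  \int[mu]_(z in parabolic_cyl z0 r) (u z)%:E <= B%:E ->
  {ae mu, forall z, parabolic_cyl z0 (r / (4 * N%:R))%R z ->
    (u z <= C * B / r ^+ N.+2)%R}.
Proof.
move=> N1; have [C C0 H] := cell_integral_le N1.
exists (C * 2 ^+ N.+2)%R; first by rewrite mulr_gt0 ?exprn_gt0.
move=> Q u f S z0 r B r0 KQ HB.
have [mQ _ _ p0 wk] := S.
have NR : (1 <= N%:R :> R)%R by rewrite ler1n.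
have [mu1 _ u0 _] := absorption_restrict S KQ.
have B0 : (0 <= B)%R.
  by rewrite -lee_fin; apply: le_trans HB; apply: integral_ge0 => z /u0;
    rewrite lee_fin.
set s := (r / (4 * N%:R))%R.
have r20 : (0 < r ^+ 2)%R by rewrite exprn_gt0.
have N4 : (0 < 4 * N%:R :> R)%R by lra.
have s0 : (0 < s)%R by rewrite divr_gt0.
have s4 : (s <= r / 4)%R.
  by rewrite /s ler_pdivrMr//; nra.
have sr : (0 <= s <= r)%R by apply/andP; split; lra.
have s2 : (s ^+ 2 <= r ^+ 2 / 16)%R.
  have -> : (r ^+ 2 / 16 = (r / 4) ^+ 2)%R by field.
  by rewrite lerXn2r ?nnegrE ?divr_ge0// ltW.
apply: ae_cell_cover => z sz.
have [_ /andP[zt1 zt2]] := sz.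
have [n1 Hn1] := nbhs_cell
  (open_nbhs_nbhs (conj (@parabolic_cyl_open R N z0 s) sz)).
(* The cells have to be small compared with [r] and with the distance of [z]
   to the top: the support of a kernel with pole above a cell must stay in the
   cylinder of radius [r]. *)
pose e := (Num.min (r / (8 * N%:R)) (Num.min 1 ((z0.2 - z.2) / 4)))%R.
have e0 : (0 < e)%R.
  rewrite /e !lt_min; apply/and3P; split => //.
    by apply: divr_gt0 => //; lra.
  by apply: divr_gt0 => //; rewrite subr_gt0.
have [n2 Hn2] := half_exp_lt e0.
pose n0 := maxn n1 n2; exists n0.
have cs : cell n0 z `<=` parabolic_cyl z0 s by apply: Hn1; exact: leq_maxl.
have cr : cell n0 z `<=` parabolic_cyl z0 r by apply: subset_trans cs _;
  exact: parabolic_cyl_le.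
have cQ := subset_trans cr KQ.
have [mc _ uc _] := absorption_restrict S cQ.
apply: ae_le_of_cells => //.
- apply: le_lt_trans (ltry B); apply: le_trans HB; apply: ge0_subset_integral => //.
  + exact: measurable_cell.
  + exact: measurable_parabolic_cyl.
  + exact/measurable_EFinP.
- apply: divr_ge0; last by apply: exprn_ge0; exact: ltW.
  by apply: mulr_ge0 => //; apply: mulr_ge0; [exact: ltW|exact: exprn_ge0].
move=> n y n0n cy.
have yx := cy _ (corner_cell n y).
set x := corner n y in yx *; set l := (2^-1 ^+ n : R)%R.
have l0 : (0 < l)%R by rewrite exprn_gt0.
have l1 : (l < e)%R by apply: Hn2; apply: leq_trans n0n; exact: leq_maxr.
move: l1; rewrite !lt_min => /and3P[l1 l2 l3].
have lsq : (l ^+ 2 <= l)%R by rewrite expr2 ler_piMr// ltW.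
rewrite cell_parabolic_box -/x -/l mu_parabolic_box ?(ltW l0)//.
have [Hxc xt] : parabolic_box (corner n0 z) (2^-1 ^+ n0)%R x
  by rewrite -cell_parabolic_box.
have [Hzc zt] : parabolic_box (corner n0 z) (2^-1 ^+ n0)%R z
  by rewrite -cell_parabolic_box.
have m1 : (2^-1 ^+ n0 < e)%R by apply: Hn2; exact: leq_maxr.
set m := (2^-1 ^+ n0 : R)%R in m1 Hxc xt Hzc zt.
have m0 : (0 < m)%R by rewrite exprn_gt0.
move: m1; rewrite !lt_min => /and3P[_ m2 m3].
have msq : (m ^+ 2 <= m)%R by rewrite expr2 ler_piMr// ltW.
have xs := cs _ yx; have [Hxs /andP[xs1 xs2]] := xs.
have rho0 : (0 < r / 2)%R by rewrite divr_gt0.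
have lr : (12 * N%:R * l ^+ 2 <= (r / 2) ^+ 2)%R.
  have h : (8 * N%:R * l <= r)%R by move: l1; rewrite ltr_pdivlMr; lra.
  have h2 : ((8 * N%:R * l) ^+ 2 <= r ^+ 2)%R.
    by rewrite lerXn2r ?nnegrE ?mulr_ge0 ?ler0n ?(ltW l0) ?(ltW r0).
  have l20 : (0 <= l ^+ 2)%R by rewrite sqr_ge0.
  rewrite !expr2 in h2 l20 *; nra.
have KB : kernel_support x l (r / 2) `<=` parabolic_cyl z0 r.
  move=> w [Hw /andP[wt1 wt2]]; split => [i|].
    have := Hw i; have := Hxs i; rewrite /pole/=.
    rewrite ltr_norml ler_norml ltr_norml => /andP[? ?] /andP[? ?].
    by apply/andP; split; lra.
  have h : ((r / 2) ^+ 2 = r ^+ 2 / 4)%R by field.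
  move: wt1 wt2 xt zt; rewrite h /pole/= => wt1 wt2 /andP[xt1 xt2] /andP[zt3 zt4].
  have l20 := exprn_gt0 2 l0.
  by apply/andP; split; lra.
apply: le_trans (H _ _ _ S x l _ _ l0 rho0 lr KB (measurable_parabolic_cyl z0 r)
  KQ) _.
apply: (@le_trans _ _ ((C * (l / (r / 2)) ^+ N.+2)%:E * B%:E)).
  by apply: lee_wpmul2l => //; rewrite lee_fin mulr_ge0 ?exprn_ge0 ?divr_ge0 ?ltW.
rewrite -!EFinM lee_fin le_eqVlt; apply/orP; left; apply/eqP.
rewrite !expr_div_n; have rr := exprn_gt0 N.+2 r0.
have tt := exprn_gt0 N.+2 (ltr0Sn R 1).
move: rr tt; move: (r ^+ _)%R (2 ^+ _)%R (l ^+ _)%R => a b w a0 b0.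
by field; rewrite !gt_eqF.
Qed.

End mean_value.

(** * Mean value inequality from a power of the solution *)

Section bounds.
Context (R : realType) (N : nat).
Local Notation ST := ('rV[R]_N * R)%type.
Local Notation mu := (spacetime_measure R N).
Local Notation M A := (measurable (A : set (measurableST R N))).
Implicit Types (z y : ST) (A B E U Q : set ST) (u v w f g : ST -> R).
Local Open Scope ereal_scope.

Definition ae_bound A w (m : R) := {ae mu, forall z, A z -> (w z <= m)%R}.

Lemma ae_boundS A B w m : A `<=` B -> ae_bound B w m -> ae_bound A w m.
Proof. by move=> AB; apply: ae_imply => z H /AB; exact: H. Qed.

Lemma ae_bound_le A w m m' : (m <= m')%R -> ae_bound A w m -> ae_bound A w m'.
Proof. by move=> mm'; apply: ae_imply => z H /H /le_trans; apply. Qed.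

Lemma mu_parabolic_cyl_le z0 (r : R) : (0 <= r)%R -> mu (parabolic_cyl z0 r) <=
    ((2 * r) ^+ N.+2)%:E.
Proof.
move=> r0; pose x : ST := (\row_i (z0.1 ord0 i - r), z0.2 - r ^+ 2)%R.
have r20 : (0 <= 2 * r)%R by rewrite mulr_ge0.
rewrite -(mu_parabolic_box x r20); apply: le_measure; rewrite ?inE.
- exact: measurable_parabolic_cyl.
- exact: measurable_parabolic_box.
move=> z [Hx /andP[t1 t2]]; split => [i|].
  by have := Hx i; rewrite mxE ltr_distl => /andP[x1 x2]; apply/andP; split; lra.
rewrite /x/=; have := sqr_ge0 r => h; rewrite exprMn; apply/andP; split; lra.
Qed.

Lemma integral_ae_bound A w (m : R) : M A ->
    measurable_fun (A : set (measurableST R N)) w ->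
  (forall z, A z -> 0 <= w z)%R -> (0 <= m)%R -> ae_bound A w m ->
  \int[mu]_(z in A) (w z)%:E <= m%:E * mu A.
Proof.
move=> mA mw w0 m0 wm; rewrite -integral_cst//; apply: ae_ge0_le_integral => //.
  exact/measurable_EFinP.
Qed.

(** Compare [w] with the threshold [l]. For [e >= 1] this is a form of the
    inequality of Young; for [e < 1] the missing power of [w] is paid for with
    the known bound [W]. *)
Lemma powR_interpolate (w W l e : R) : (0 <= w)%R -> (w <= W)%R -> (0 < W)%R ->
  (0 < l)%R -> (0 < e)%R -> let rho := Num.min e 1%R in
  (w <= W `^ (1 - rho) * (l `^ rho + l `^ (rho - e) * w `^ e))%R.
Proof.
move=> w0 wW W0 l0 e0 /=; set rho := Num.min e 1%R.
have rho0 : (0 < rho)%R by rewrite lt_min e0 ltr01.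
have rho1 : (rho <= 1)%R by rewrite ge_min lexx orbT.
have rhoe : (rho <= e)%R by rewrite ge_min lexx.
have [->|wn0] := eqVneq w 0%R.
  by rewrite mulr_ge0 ?addr_ge0 ?mulr_ge0 ?powR_ge0.
have wp : (0 < w)%R by rewrite lt_neqAle eq_sym wn0.
apply: (@le_trans _ _ (W `^ (1 - rho) * w `^ rho)%R).
  have E : (w `^ (1 - rho) * w `^ rho)%R = w by rewrite -powRD ?wn0 ?implybT//
    subrK powRr1.
  by rewrite -{1}E ler_wpM2r ?powR_ge0// ge0_ler_powR ?nnegrE ?subr_ge0// ltW.
rewrite ler_wpM2l ?powR_ge0//.
have [wl|lw] := leP w l.
  rewrite (@le_trans _ _ (l `^ rho)%R)//; last by rewrite lerDl mulr_ge0 ?powR_ge0.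
  by rewrite ge0_ler_powR ?nnegrE ?(ltW rho0) ?(ltW l0).
rewrite (@le_trans _ _ (l `^ (rho - e) * w `^ e)%R)//;
  last by rewrite lerDr powR_ge0.
have -> : (w `^ rho = w `^ (rho - e) * w `^ e)%R by rewrite -powRD ?wn0
  ?implybT// subrK.
rewrite ler_wpM2r ?powR_ge0//.
rewrite -opprB !powRN lef_pV2 ?posrE ?powR_gt0//.
by rewrite ge0_ler_powR ?nnegrE ?subr_ge0// ltW.
Qed.

(** The threshold [l = A^(1/e)] in [powR_interpolate] balances its two terms. *)
Lemma mean_value_powR : (1 <= N)%N -> exists2 C : R, (0 < C)%R &
  forall Q w g, heat_absorption Q w g -> forall z0 (r e W A : R), (0 < r)%R ->
    (0 < e)%R ->
  (0 < W)%R -> (0 < A)%R -> parabolic_cyl z0 r `<=` Q ->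
    ae_bound (parabolic_cyl z0 r) w W ->
  measurable_fun (parabolic_cyl z0 r : set (measurableST R N))
    (fun z => w z `^ e)%R ->
  \int[mu]_(z in parabolic_cyl z0 r) (w z `^ e)%:E <= (A * (2 * r) ^+ N.+2)%:E ->
  let rho := Num.min e 1%R in
  ae_bound (parabolic_cyl z0 (r / (4 * N%:R))%R) w
    (C * W `^ (1 - rho) * A `^ (rho / e))%R.
Proof.
move=> N1; have [C C0 H] := @mean_value_le R N N1.
exists (C * 2 * 2 ^+ N.+2)%R;
  first by apply: mulr_gt0; [exact: mulr_gt0|exact: exprn_gt0].
move=> Q w g S z0 r e W A r0 e0 W0 A0 KQ wW mwe HA rho.
have [mw _ w0 _] := absorption_restrict S KQ.
set l := (A `^ (e^-1))%R; have l0 : (0 < l)%R by rewrite powR_gt0.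
have mO := @measurable_parabolic_cyl R N z0 r.
set V := ((2 * r) ^+ N.+2)%R in HA *; have V0 : (0 < V)%R by rewrite exprn_gt0//
  mulr_gt0.
have lA : (l `^ (rho - e) * A = l `^ rho)%R.
  have -> : A = (l `^ e)%R by rewrite /l -powRrM mulVf ?gt_eqF// powRr1// ltW.
  by rewrite -powRD ?(gt_eqF l0) ?implybT// subrK.
have lrho : (l `^ rho = A `^ (rho / e))%R by rewrite /l -powRrM mulrC.
set D := (W `^ (1 - rho))%R; have D0 : (0 <= D)%R by rewrite powR_ge0.
have I1 : \int[mu]_(z in parabolic_cyl z0 r) (w z)%:E <= (2 * D * l `^ rho * V)%:E.
  apply: (@le_trans _ _ (\int[mu]_(z in parabolic_cyl z0 r)
     ((D * l `^ rho)%:E + (D * l `^ (rho - e) * w z `^ e)%:E))).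
    apply: ae_ge0_le_integral => //.
    - exact/measurable_EFinP.
    - by move=> z zr; rewrite -EFinD lee_fin addr_ge0 ?mulr_ge0 ?powR_ge0.
    - apply: emeasurable_funD; first exact: measurable_cst.
      by apply/measurable_EFinP; apply: measurable_funM.
    apply: ae_imply wW => z zW zr; rewrite -EFinD lee_fin.
    have /= := powR_interpolate (w0 _ zr) (zW zr) W0 l0 e0.
    by rewrite -/rho -/D mulrDr mulrA.
  rewrite ge0_integralD//; last 3 first.
  - by move=> z zr; rewrite lee_fin mulr_ge0 ?powR_ge0.
  - by move=> z zr; rewrite lee_fin !mulr_ge0 ?powR_ge0.
  - by apply/measurable_EFinP; apply: measurable_funM.
  rewrite integral_cst// (integralZ_fin mO mwe) ?mulr_ge0 ?powR_ge0//; last first.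
    by move=> z zr; exact: powR_ge0.
  have -> : (2 * D * l `^ rho * V = D * l `^ rho * V + D * l `^ (rho - e)
    * (A * V))%R.
    have -> : (D * l `^ (rho - e) * (A * V) = D * (l `^ (rho - e) * A) * V)%R
      by ring.
    by rewrite lA; ring.
  rewrite EFinD; apply: leeD.
    rewrite [leRHS]EFinM; apply: lee_wpmul2l;
      first by rewrite lee_fin mulr_ge0 ?powR_ge0.
    exact: mu_parabolic_cyl_le (ltW r0).
  by rewrite [leRHS]EFinM; apply: lee_wpmul2l => //;
    rewrite lee_fin mulr_ge0 ?powR_ge0.
have := H _ _ _ S z0 r _ r0 KQ I1; apply: ae_bound_le.
rewrite le_eqVlt; apply/orP; left; apply/eqP; rewrite -lrho /V exprMn.
have := exprn_gt0 N.+2 r0; move: (r ^+ _)%R (2 ^+ _)%R => a b a0.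
by field; rewrite gt_eqF.
Qed.

End bounds.

(** * Improvement of bounds for the system *)

Section improve.
Context (R : realType) (N : nat).
Local Notation ST := ('rV[R]_N * R)%type.
Local Notation mu := (spacetime_measure R N).
Implicit Types (z y : ST) (A B E U Q : set ST) (u v w f g : ST -> R).
Local Open Scope ereal_scope.

(** [absorption_integral_le] in the equation of [v] controls the integral of
    [w^e], and [mean_value_powR] in the equation of [w] converts it into a
    bound of [w]. *)
Lemma system_step : (1 <= N)%N -> exists2 C : R, (0 < C)%R &
  forall Q v w g (e : R), heat_absorption Q v (fun z => w z `^ e)%R ->
    heat_absorption Q w g ->
  forall z0 (r m W : R), (0 < r)%R -> (0 < e)%R -> (0 < m)%R -> (0 < W)%R ->
  parabolic_cyl z0 r `<=` Q -> ae_bound (parabolic_cyl z0 r) v m ->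
    ae_bound (parabolic_cyl z0 r) w W ->
  ae_bound (parabolic_cyl z0 (r / (4 * N%:R) / (4 * N%:R))%R) w
    (C * W `^ (1 - Num.min e 1) * (C * (m / r ^+ 2)) `^ (Num.min e 1 / e))%R.
Proof.
move=> N1; have [CB CB0 HB] := @absorption_integral_le R N N1.
have [CG CG0 HG] := @mean_value_powR R N N1.
set K := (4 * N%:R : R)%R.
have NR : (1 <= N%:R :> R)%R by rewrite ler1n.
have K1 : (1 <= K)%R by rewrite /K; lra.
have K0 : (0 < K)%R by lra.
pose D := (CB * K ^+ N.+2)%R; have D0 : (0 < D)%R by rewrite mulr_gt0 ?exprn_gt0.
exists (CG + D)%R; first exact: addr_gt0.
move=> Q v w g e Sv Sw z0 r m W r0 e0 m0 W0 KQ vm wW.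
have r20 : (0 < r ^+ 2)%R by rewrite exprn_gt0.
have rK0 : (0 < r / K)%R by rewrite divr_gt0.
have rK : (0 <= r / K <= r)%R by rewrite ltW//= ler_pdivrMr// ler_peMr// ltW.
have sub : parabolic_cyl z0 (r / K)%R `<=` parabolic_cyl z0 r
  by exact: parabolic_cyl_le.
have [mv _ v0 _] := absorption_restrict Sv KQ.
have [_ mwe _ we0] := absorption_restrict Sv (subset_trans sub KQ).
have I1 : \int[mu]_(z in parabolic_cyl z0 r) (v z)%:E <= (m * (2 * r) ^+ N.+2)%:E.
  apply: le_trans (integral_ae_bound (measurable_parabolic_cyl z0 r) mv v0
    (ltW m0) vm) _.
  rewrite [leRHS]EFinM; apply: lee_wpmul2l; first by rewrite lee_fin ltW.
  exact: mu_parabolic_cyl_le (ltW r0).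
have I2 := HB _ _ _ Sv z0 r r0 KQ; rewrite -/K in I2.
have A0 : (0 < D * (m / r ^+ 2))%R by rewrite mulr_gt0// divr_gt0.
have I3 : \int[mu]_(z in parabolic_cyl z0 (r / K)%R) (w z `^ e)%:E <=
    (D * (m / r ^+ 2) * (2 * (r / K)) ^+ N.+2)%:E.
  apply: (le_trans I2);
    apply: (@le_trans _ _ ((CB / r ^+ 2)%:E * (m * (2 * r) ^+ N.+2)%:E)).
    by apply: lee_wpmul2l => //; rewrite lee_fin divr_ge0 ?ltW.
  rewrite -EFinM lee_fin le_eqVlt; apply/orP; left; apply/eqP.
  have -> : ((2 * r) ^+ N.+2 = K ^+ N.+2 * (2 * (r / K)) ^+ N.+2)%R.
    by rewrite -exprMn; congr (_ ^+ _)%R; field; rewrite gt_eqF.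
  by rewrite /D; ring.
have := HG _ _ _ Sw z0 _ _ _ _ rK0 e0 W0 A0 (subset_trans sub KQ)
  (ae_boundS sub wW) mwe I3.
rewrite /= -/K; apply: ae_bound_le.
have p0 : (0 <= W `^ (1 - Num.min e 1))%R by rewrite powR_ge0.
apply: ler_pM; rewrite ?mulr_ge0 ?powR_ge0 ?(ltW CG0)//.
  by rewrite ler_wpM2r// lerDl ltW.
have h0 : (0 <= Num.min e 1 / e)%R by rewrite divr_ge0 ?le_min ?ler01 ?(ltW e0).
have mr0 : (0 <= m / r ^+ 2)%R by rewrite divr_ge0 ?ltW.
apply: ge0_ler_powR => //; rewrite ?nnegrE ?(ltW A0)//.
  by rewrite mulr_ge0// addr_ge0 ?ltW.
by rewrite ler_wpM2r// lerDr ltW.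
Qed.

(** One step from [v] to [u], where [q >= 1] makes the result independent of
    the a priori bound [W], and one step back from [u] to [v], where the bound
    [m] of [v] itself serves as the a priori bound. *)
Lemma system_improve (p q : R) : (1 <= N)%N -> (0 < p)%R -> (1 <= q)%R ->
  exists2 C : R, (0 < C)%R &
  forall Q u v, heat_absorption Q u (fun z => v z `^ p)%R ->
  heat_absorption Q v (fun z => u z `^ q)%R ->
  forall z0 (r m W : R), (0 < r)%R -> (0 < m)%R -> (0 < W)%R ->
  parabolic_cyl z0 r `<=` Q -> ae_bound (parabolic_cyl z0 r) v m ->
    ae_bound (parabolic_cyl z0 r) u W ->
  ae_bound (parabolic_cyl z0 (r / (4 * N%:R) ^+ 2)%R) u
    (C * (m / r ^+ 2) `^ q^-1)%R /\
  ae_bound (parabolic_cyl z0 (r / (4 * N%:R) ^+ 4)%R) v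
    (C * m `^ (1 - Num.min p 1) * ((m / r ^+ 2) `^ q^-1 / r ^+ 2)
      `^ (Num.min p 1 / p))%R.
Proof.
move=> N1 p0 q1; have [C C0 H] := system_step N1.
have q0 : (0 < q)%R by lra.
set K := (4 * N%:R : R)%R.
have NR : (1 <= N%:R :> R)%R by rewrite ler1n.
have K1 : (1 <= K)%R by rewrite /K; lra.
have K0 : (0 < K)%R by lra.
pose C1 := (C * C `^ q^-1)%R; have C10 : (0 < C1)%R by rewrite mulr_gt0 ?powR_gt0.
pose s := (Num.min p 1 / p)%R.
pose C2 := (C * (C * C1 * K ^+ 4) `^ s)%R.
have C20 : (0 < C2)%R.
  apply: mulr_gt0 => //; apply: powR_gt0; apply: mulr_gt0; first exact: mulr_gt0.
  exact: exprn_gt0.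
exists (C1 + C2)%R; first exact: addr_gt0.
move=> Q u v Su Sv z0 r m W r0 m0 W0 KQ vm uW.
have r20 : (0 < r ^+ 2)%R by rewrite exprn_gt0.
have mr0 : (0 < m / r ^+ 2)%R by rewrite divr_gt0.
set X := ((m / r ^+ 2) `^ q^-1)%R; have X0 : (0 < X)%R by rewrite powR_gt0.
have B1 : ae_bound (parabolic_cyl z0 (r / K ^+ 2)%R) u (C1 * X)%R.
  have := H _ _ _ _ _ Sv Su z0 r m W r0 q0 m0 W0 KQ vm uW.
  rewrite -/K min_r// subrr powRr0 mulr1 div1r powRM ?(ltW C0) ?(ltW mr0)//.
  have -> : (r / K / K = r / K ^+ 2)%R by field; rewrite gt_eqF.
  by rewrite mulrA -/X -/C1.
have K20 : (0 < K ^+ 2)%R by rewrite exprn_gt0.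
have K21 : (1 <= K ^+ 2)%R by rewrite exprn_ege1.
split.
  apply: ae_bound_le B1; rewrite ler_wpM2r ?(ltW X0)// lerDl; exact: ltW.
set r2 := (r / K ^+ 2)%R in B1; have r20' : (0 < r2)%R by rewrite divr_gt0.
have sub : parabolic_cyl z0 r2 `<=` parabolic_cyl z0 r.
  by apply: parabolic_cyl_le; rewrite ltW//= ler_pdivrMr// ler_peMr// ltW.
have CX0 : (0 < C1 * X)%R by rewrite mulr_gt0.
have := H _ _ _ _ _ Su Sv z0 r2 _ m r20' p0 CX0 m0 (subset_trans sub KQ) B1
  (ae_boundS sub vm).
rewrite -/K -/s.
have -> : (r2 / K / K = r / K ^+ 4)%R by rewrite /r2; field; rewrite gt_eqF.
apply: ae_bound_le.
have -> : (C * (C1 * X / r2 ^+ 2) = C * C1 * K ^+ 4 * (X / r ^+ 2))%R.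
  by rewrite /r2; field; rewrite !gt_eqF.
rewrite powRM; last 2 first.
- apply: mulr_ge0; first by apply: mulr_ge0; exact: ltW.
  by apply: exprn_ge0; exact: ltW.
- by apply: divr_ge0; exact: ltW.
rewrite mulrA [X in (X * _)%R]mulrAC -/C2.
rewrite ler_wpM2r ?powR_ge0// ler_wpM2r ?powR_ge0// lerDr; exact: ltW.
Qed.

End improve.

(** * Sublinear iteration and local boundedness *)

Section real_lemmas.
Context (R : realType).

(** Let [i] be the infimum of the admissible constants. Since [C m^theta] is
    admissible whenever [m] is, [i <= C i^theta], that is [i <=
    C^(1/(1-theta))]; the factor [2] leaves room for an infimum that is not
    attained. *)
Lemma sublinear_iteration (P : R -> Prop) (C theta : R) :
  0 < C -> 0 < theta < 1 -> (forall m m', m <= m' -> P m -> P m') ->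
  (exists2 m, 0 < m & P m) -> (forall m, 0 < m -> P m -> P (C * m `^ theta)) ->
  P (2 * C `^ (1 - theta)^-1).
Proof.
move=> C0 /andP[th0 th1] Pmono [m0 m00 Pm0] Pstep.
set D := C `^ (1 - theta)^-1; have D0 : 0 < D by rewrite powR_gt0.
pose S := [set m : R | 0 < m /\ P m].
have S0 : S !=set0 by exists m0.
have lS : has_lbound S by exists 0 => m [/ltW].
have hS : has_inf S by [].
set i := inf S.
have [i2|i2] := ltP i (2 * D).
  have [m [_ Pm] mi] := inf_lt S0 i2.
  by apply: Pmono Pm; exact: ltW.
have i0 : 0 < i by apply: lt_le_trans i2; rewrite mulr_gt0.
have key m : S m -> (i / C) `^ theta^-1 <= m.
  move=> [m0' Pm]; have Sm : S (C * m `^ theta).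
    by split; [rewrite mulr_gt0 ?powR_gt0|exact: Pstep].
  have : i <= C * m `^ theta by exact: (ge_inf lS).
  rewrite mulrC -ler_pdivrMr// => h.
  have -> : m = (m `^ theta) `^ theta^-1.
    by rewrite -powRrM divff ?gt_eqF// powRr1// ltW.
  by apply: ge0_ler_powR => //; rewrite ?nnegrE ?powR_ge0 ?invr_ge0 ?divr_ge0 ?ltW.
have : (i / C) `^ theta^-1 <= i by apply: lb_le_inf => // m; exact: key.
move=> h; exfalso.
have iC : 0 <= i / C by rewrite divr_ge0 ?ltW.
have : i / C <= i `^ theta.
  have -> : i / C = ((i / C) `^ theta^-1) `^ theta.
    by rewrite -powRrM mulVf ?gt_eqF// powRr1.
  by apply: ge0_ler_powR => //; rewrite ?nnegrE ?powR_ge0 ?ltW.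
rewrite ler_pdivrMr// mulrC -ler_pdivrMr ?powR_gt0// -powRN => h2.
have {}h2 : i `^ (1 - theta) <= C.
  rewrite powRD ?powRr1 ?(ltW i0)// ?(gt_eqF i0) ?implybT//.
have : i <= D.
  have -> : i = (i `^ (1 - theta)) `^ (1 - theta)^-1.
    by rewrite -powRrM divff ?powRr1 ?(ltW i0)// gt_eqF// subr_gt0.
  by apply: ge0_ler_powR => //; rewrite ?nnegrE ?powR_ge0 ?invr_ge0 ?subr_ge0 ?ltW.
by lra.
Qed.

Lemma powR_scale (m s x y e : R) : 0 < m -> 0 < s ->
  ((m * s `^ x) / s ^+ 2) `^ e = m `^ e * s `^ ((x - 2) * e).
Proof.
move=> m0 s0; rewrite -powR_mulrn ?(ltW s0)// -powRN -mulrA -powRD ?(gt_eqF s0)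
  ?implybT//.
by rewrite powRM ?powR_ge0 ?(ltW m0)// -powRrM.
Qed.

End real_lemmas.

Section local_bound.
Context (R : realType) (N : nat).
Local Notation ST := ('rV[R]_N * R)%type.
Local Notation mu := (spacetime_measure R N).
Implicit Types (z y : ST) (A B E U Q : set ST) (u v w f g : ST -> R).
Local Open Scope ereal_scope.

Lemma ball_cube z (e : R) y : (0 < e)%R ->
    (forall i, `|z.1 ord0 i - y.1 ord0 i| < e)%R ->
  (`|z.2 - y.2| < e)%R -> ball z e y.
Proof. by move=> e0 H1 H2; split => //; split => // i j; rewrite ord1;
  exact: H1. Qed.

(** [cell_integral_lty] makes [u] integrable around the point, and then the
    mean value inequality applies in a cylinder whose top lies slightly above
    the point. *)
Lemma absorption_locally_bounded Q u f : (1 <= N)%N -> heat_absorption Q u f ->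
    open Q ->
  (forall K, compact K -> K `<=` Q -> \int[mu]_(z in K) (f z)%:E < +oo) ->
  forall z, Q z -> exists2 U, nbhs z U & exists m, ae_bound U u m.
Proof.
move=> N1 S oQ fK z Qz.
have [C C0 Hmean] := @mean_value_le R N N1.
have NR : (1 <= N%:R :> R)%R by rewrite ler1n.
have /nbhs_ballP[e /= e0 eQ] := open_nbhs_nbhs (conj oQ Qz).
set K := (4 * N%:R : R)%R; have K1 : (4 <= K)%R by rewrite /K; lra.
pose rho := (Num.min 1 (e / 2))%R.
have rho0 : (0 < rho)%R by rewrite lt_min ltr01 divr_gt0.
have rho1 : (rho <= 1)%R by rewrite ge_min lexx.
have rhoe : (rho <= e / 2)%R by rewrite ge_min lexx orbT.
have K0 : (0 < K)%R by lra.
have [l lE] : exists l, l = (rho / K)%R by eexists.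
have l0 : (0 < l)%R by rewrite lE divr_gt0.
have lK : (l * K = rho)%R by rewrite lE divfK// gt_eqF.
have lrho : (4 * l <= rho)%R by rewrite -lK mulrC ler_pM2l.
have l20 : (0 < l ^+ 2)%R by rewrite exprn_gt0.
have rho2 : (rho ^+ 2 <= rho)%R by rewrite expr2 ler_piMr// ltW.
have l2 : (l ^+ 2 <= l)%R by rewrite expr2 ler_piMr ?(ltW l0)//; lra.
have lr : (12 * N%:R * l ^+ 2 <= rho ^+ 2)%R.
  have h : (12 * N%:R <= K ^+ 2 :> R)%R by rewrite /K expr2; nra.
  by rewrite -lK exprMn mulrC ler_pM2l.
pose x : ST := (\row_i (z.1 ord0 i - l / 2), z.2 - l ^+ 2 / 2)%R.
have supp : kernel_support x l rho `<=` Q.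
  move=> y [Hy /andP[y1 y2]]; apply: eQ; apply: ball_cube => //.
    move=> i; have := Hy i; rewrite /pole/= mxE ler_norml ltr_norml => /andP[? ?].
    by apply/andP; split; lra.
  by move: y1 y2; rewrite /pole/= => ? ?; rewrite ltr_norml; apply/andP; split; lra.
have Ifin : \int[mu]_(y in parabolic_box x l) (u y)%:E < +oo.
  by apply: (cell_integral_lty N1 S l0 rho0 lr supp); apply: fK supp;
    exact: closed_box_compact.
have pQ : parabolic_box x l `<=` Q.
  apply: subset_trans supp; apply: parabolic_box_kernel_support => //.
  by apply: le_trans lr; rewrite ler_pM2r//; lra.
have [k kE] : exists k, k = (l / 2)%R by eexists.
have k0 : (0 < k)%R by rewrite kE divr_gt0.
have k2 : (k ^+ 2 = l ^+ 2 / 4)%R by rewrite kE; field.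
(* The top of the cylinder is raised by [eta] so that [z] is interior. *)
pose eta := ((k / K) ^+ 2 / 2)%R.
have eta0 : (0 < eta)%R by rewrite divr_gt0// exprn_gt0// divr_gt0.
have etak : (eta <= k ^+ 2 / 2)%R.
  have kKk : (k / K <= k)%R by rewrite ler_pdivrMr// ler_peMr ?(ltW k0)//; lra.
  have kK' : (0 <= k / K)%R by rewrite divr_ge0 ?ltW.
  by rewrite /eta ler_pM2r// lerXn2r ?nnegrE// ltW.
pose z1 : ST := (z.1, z.2 + eta)%R.
have op : parabolic_cyl z1 k `<=` parabolic_box x l.
  move=> y [Hy /andP[y1 y2]]; split => [i|].
    have := Hy i; rewrite /z1/= mxE ltr_norml kE => /andP[? ?].
    by apply/andP; split; lra.
  by move: y1 y2; rewrite /z1/= k2 => ? ?; apply/andP; split; lra.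
have [mup _ up _] := absorption_restrict S pQ.
have [B HB] : exists B : R, \int[mu]_(y in parabolic_cyl z1 k) (u y)%:E <= B%:E.
  exists (fine (\int[mu]_(y in parabolic_box x l) (u y)%:E)); rewrite fineK;
    last first.
    by rewrite ge0_fin_numE// integral_ge0// => y py; rewrite lee_fin up.
  apply: ge0_subset_integral => //.
  - exact: measurable_parabolic_cyl.
  - exact: measurable_parabolic_box.
  - exact/measurable_EFinP.
have := Hmean _ _ _ S z1 k B k0 (subset_trans op pQ) HB; rewrite -/K => ub.
exists (parabolic_cyl z1 (k / K)%R); last by eexists; exact: ub.
apply: open_nbhs_nbhs; split; first exact: parabolic_cyl_open.
have kK : (0 < k / K)%R by rewrite divr_gt0.
split => [i|]; first by rewrite subrr normr0.
rewrite /z1/=; have : (0 < (k / K) ^+ 2)%R by rewrite exprn_gt0.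
by move: eta0; rewrite /eta => ? ?; apply/andP; split; lra.
Qed.

(** The open sets [O n] on which the bound [n] holds increase with [n], so one
    of them contains the compact set. *)
Lemma compact_ae_bounded Q u K :
  (forall z, Q z -> exists2 U, nbhs z U & exists m, ae_bound U u m) ->
  compact K -> K `<=` Q -> exists2 m, (0 < m)%R & ae_bound K u m.
Proof.
move=> loc cK KQ.
pose O n := \bigcup_(V in [set V : set ST | open V /\ ae_bound V u n%:R]) V.
have oO n : open (O n) by apply: bigcup_open => V [].
have bO n : ae_bound (O n) u n%:R.
  apply: ae_nbhs_cover => z [V [oV bV] Vz]; exists V => //.
  exact: open_nbhs_nbhs.
have Omono n n' : (n <= n')%N -> O n `<=` O n'.
  move=> nn' z [V [oV bV] Vz]; exists V => //; split => //.
  by apply: ae_bound_le bV; rewrite ler_nat.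
have [n _ Hn] : \forall n \near \oo, K `<=` O n.
  apply: (compact_near_coveringP K).1 cK _ _ (fun n z => O n z) _ _ => z Kz.
  have [U zU [m Um]] := loc z (KQ z Kz).
  have [n Hn] : exists n : nat, (m <= n%:R)%R.
    by exists (Num.trunc `|m|).+1; rewrite (le_trans (ler_norm m))// ltW//
      truncnS_gt.
  exists (interior U, [set k | (n <= k)%N]).
    by split; [apply: nbhs_interior|exists n].
  move=> [y k] [/= Uy nk]; apply: (Omono _ _ nk); exists (interior U) => //.
  split; first exact: open_interior.
  by apply: ae_bound_le Hn _; apply: ae_boundS Um; exact: interior_subset.
exists (n%:R + 1)%R; first by rewrite ltr_wpDl.
apply: (@ae_bound_le _ _ _ _ n%:R); first by rewrite lerDl.
by apply: ae_boundS (bO n); exact: (Hn n (leqnn n)).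
Qed.

End local_bound.

(** * Universal bounds inside a box *)

Section tube.
Context (R : realType) (N : nat).
Local Notation ST := ('rV[R]_N * R)%type.
Local Notation mu := (spacetime_measure R N).
Implicit Types (z y : ST) (A B E U Q : set ST) (u v w f g : ST -> R).

Definition finite_on_compacts Q f :=
  forall K, compact K -> K `<=` Q -> (\int[mu]_(z in K) (f z)%:E < +oo)%E.

(** The points of the box at parabolic distance at least [r] from its lateral
    boundary and from its bottom. *)
Definition inner_tube (x0 : ST) (rad t2 r : R) : set ST :=
  [set z : ST | (forall i, `|z.1 ord0 i - x0.1 ord0 i| <= rad - r) /\
                x0.2 + r ^+ 2 <= z.2 < t2].

(** Each point of [inner_tube r] is in a cylinder of radius [s = r / 2] that
    stays inside [inner_tube s]. There [system_improve] turns the bound [m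
    s^(-2b)] into [C m^theta s^(-2b)], and [s^(-2b)] is a constant multiple of
    [r^(-2b)]. The property of [m] to be admissible for all [r] simultaneously
    is thus stable under [m |-> C m^theta], and [sublinear_iteration] applies. *)
Lemma tube_estimate (p q : R) : (1 <= N)%N -> 0 < p -> 1 <= q -> 1 < p * q ->
  let a := (p + 1) / (p * q - 1) in
  let b := (q + 1) / (p * q - 1) in
  exists2 C, 0 < C & forall Q u v, open Q ->
    heat_absorption Q u (fun z => v z `^ p) ->
    heat_absorption Q v (fun z => u z `^ q) ->
    finite_on_compacts Q (fun z => v z `^ p) ->
    finite_on_compacts Q (fun z => u z `^ q) ->
  forall x0 rad t2, 0 < rad -> closed_box x0 rad x0.2 t2 `<=` Q ->
  forall r, 0 < r ->
    ae_bound (inner_tube x0 rad t2 r) u (C * r `^ (- 2 * a)) /\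
    ae_bound (inner_tube x0 rad t2 r) v (C * r `^ (- 2 * b)).
Proof.
move=> N1 p0 q1 pq a b.
have q0 : 0 < q by lra.
have pq0 : 0 < p * q - 1 by lra.
have a0 : 0 < a by rewrite divr_gt0//; lra.
have b0 : 0 < b by rewrite divr_gt0//; lra.
(* These two identities are the scaling of the system. *)
have aq : (- 2 * b - 2) * q^-1 = - 2 * a.
  by rewrite /a /b; field; rewrite !gt_eqF.
have bp : (- 2 * a - 2) / p = - 2 * b.
  by rewrite /a /b; field; rewrite !gt_eqF.
have [C C0 Himp] := @system_improve R N p q N1 p0 q1.
set K := 4 * N%:R in Himp.
have NR : 1 <= N%:R :> R by rewrite ler1n.
have K1 : 1 <= K by rewrite /K; lra.
have K0 : 0 < K by lra.
have K40 : 0 < K ^+ 4 by rewrite exprn_gt0.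
have K41 : 1 <= K ^+ 4 by rewrite exprn_ege1.
pose rho := Num.min p 1.
have rho0 : 0 < rho by rewrite lt_min p0 ltr01.
have rho1 : rho <= 1 by rewrite ge_min lexx orbT.
pose theta := 1 - rho + rho / (p * q).
have pq00 : 0 < p * q by rewrite mulr_gt0.
have th : 0 < theta < 1.
  have h1 : 0 < rho / (p * q) by rewrite divr_gt0.
  have h2 : rho / (p * q) < rho by rewrite ltr_pdivrMr// ltr_pMr.
  by rewrite /theta; apply/andP; split; lra.
have pow20 x : 0 < (2 : R) `^ x by rewrite powR_gt0.
pose C1 := C * 2 `^ (2 * b); have C10 : 0 < C1 by rewrite mulr_gt0.
pose D := 2 * C1 `^ (1 - theta)^-1.
have D0 : 0 < D by rewrite mulr_gt0// powR_gt0.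
pose E := C * D `^ q^-1 * 2 `^ (2 * a).
have E0 : 0 < E by rewrite !mulr_gt0 ?powR_gt0.
exists (D + E); first exact: addr_gt0.
move=> Q u v oQ Su Sv fv fu x0 rad t2 rad0 KQ.
set box := closed_box x0 rad x0.2 t2 in KQ.
have closed_box' : compact box by exact: closed_box_compact.
have [Mv Mv0 bv] := compact_ae_bounded (absorption_locally_bounded N1 Sv oQ fu)
  closed_box' KQ.
have [Mu Mu0 bu] := compact_ae_bounded (absorption_locally_bounded N1 Su oQ fv)
  closed_box' KQ.
pose S r := inner_tube x0 rad t2 r.
have Sbox r : 0 < r -> S r `<=` box.
  move=> r0 z [Hx /andP[z1 z2]]; split => [i|].
    by apply: le_trans (Hx i) _; lra.
  by have := sqr_ge0 r => ?; apply/andP; split; lra.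
pose P m := forall r, 0 < r -> ae_bound (S r) v (m * r `^ (- 2 * b)).
have step m : 0 < m -> P m -> forall r, 0 < r ->
    ae_bound (S r) u (C * m `^ q^-1 * 2 `^ (2 * a) * r `^ (- 2 * a)) /\
    ae_bound (S r) v (C1 * m `^ theta * r `^ (- 2 * b)).
  move=> m0 Pm r r0.
  have [s sE] : exists s, s = r / 2 by eexists.
  have s0 : 0 < s by rewrite sE divr_gt0.
  have r2s : r = 2 * s by rewrite sE; field.
  have sK0 : 0 < s / K ^+ 4 by rewrite divr_gt0.
  (* Halving the radius costs only a constant factor. *)
  have half x : 2 `^ (2 * x) * r `^ (- 2 * x) = s `^ (- 2 * x).
    rewrite r2s powRM ?(ltW s0)// mulrA -powRD ?pnatr_eq0 ?implybT//.
    by rewrite mulNr subrr powRr0 mul1r.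
  have sm0 : 0 < m * s `^ (- 2 * b) by rewrite mulr_gt0 ?powR_gt0.
  have main z : S r z -> exists2 U, nbhs z U &
      ae_bound U u (C * m `^ q^-1 * 2 `^ (2 * a) * r `^ (- 2 * a)) /\
      ae_bound U v (C1 * m `^ theta * r `^ (- 2 * b)).
    move=> [Hx /andP[zt1 zt2]].
    (* The top is raised by [eta] so that [z] is interior to the small
       cylinder, yet stays below [t2]. *)
    pose eta := Num.min ((s / K ^+ 4) ^+ 2 / 2) ((t2 - z.2) / 2).
    have sK20 : 0 < (s / K ^+ 4) ^+ 2 by rewrite exprn_gt0.
    have eta0 : 0 < eta by rewrite lt_min !divr_gt0// subr_gt0.
    have eta1 : eta <= (s / K ^+ 4) ^+ 2 / 2 by rewrite ge_min lexx.
    have eta2 : eta <= (t2 - z.2) / 2 by rewrite ge_min lexx orbT.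
    pose z1 : ST := (z.1, z.2 + eta).
    have s20 : 0 < s ^+ 2 by rewrite exprn_gt0.
    have sub : parabolic_cyl z1 s `<=` S s.
      move=> y [Hy /andP[y1 y2]]; split => [i|].
        have := Hy i; have := Hx i; rewrite /z1/= r2s.
        rewrite !ler_norml ltr_norml => /andP[? ?] /andP[? ?].
        by apply/andP; split; lra.
      move: y1 y2 zt1; rewrite /z1/= r2s exprMn => ? ? ?.
      by apply/andP; split; lra.
    have subQ : parabolic_cyl z1 s `<=` Q.
      by apply: subset_trans sub _; apply: subset_trans KQ; exact: Sbox.
    have [Bu Bv] := Himp _ _ _ Su Sv z1 s _ _ s0 sm0 Mu0 subQ
      (ae_boundS sub (Pm s s0))
      (ae_boundS (subset_trans sub (Sbox s s0)) bu).
    exists (parabolic_cyl z1 (s / K ^+ 4)).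
      apply: open_nbhs_nbhs; split; first exact: parabolic_cyl_open.
      split => [i|]; first by rewrite subrr normr0.
      by rewrite /z1/=; apply/andP; split; lra.
    split.
      have : ae_bound (parabolic_cyl z1 (s / K ^+ 4)) u
          (C * ((m * s `^ (- 2 * b)) / s ^+ 2) `^ q^-1).
        apply: ae_boundS Bu; apply: parabolic_cyl_le;
          rewrite ltW//= ler_wpM2l ?(ltW s0)//.
        by rewrite lef_pV2 ?posrE ?exprn_gt0// ler_weXn2l.
      rewrite powR_scale// aq -(half a).
      by apply: ae_bound_le; rewrite !mulrA.
    apply: ae_bound_le Bv; rewrite le_eqVlt; apply/orP; left; apply/eqP.
    rewrite powR_scale// aq powR_scale ?powR_gt0// -/rho.
    rewrite powRM ?powR_ge0 ?(ltW m0)//.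
    have -> : (- 2 * a - 2) * (rho / p) = - 2 * b * rho by rewrite -bp; ring.
    rewrite -!powRrM.
    have e1 : m `^ (1 - rho) * m `^ (q^-1 * (rho / p)) = m `^ theta.
      rewrite -powRD ?(gt_eqF m0) ?implybT//; congr (_ `^ _).
      by rewrite /theta invfM; ring.
    have e2 : s `^ (- 2 * b * (1 - rho)) * s `^ (- 2 * b * rho) = s `^ (- 2 * b).
      by rewrite -powRD ?(gt_eqF s0) ?implybT//; congr (_ `^ _); ring.
    rewrite /C1 -e1.
    have -> : C * 2 `^ (2 * b) * (m `^ (1 - rho) * m `^ (q^-1 * (rho / p))) * r
      `^ (- 2 * b) =
      C * (m `^ (1 - rho) * m `^ (q^-1 * (rho / p)))
        * (2 `^ (2 * b) * r `^ (- 2 * b)) by ring.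
    rewrite half -e2; ring.
  split; apply: ae_nbhs_cover => z /main[U zU [H1 H2]]; exists U => //.
have PD : P D.
  apply: (@sublinear_iteration R P C1 theta C10 th).
  - move=> m m' mm' Pm r r0; apply: ae_bound_le (Pm r r0).
    by rewrite ler_wpM2r ?powR_ge0.
  (* A finite constant exists: [v] is bounded on the box, and [inner_tube r]
     is empty unless [r <= rad]. *)
  - exists (Mv * rad `^ (2 * b)); first by rewrite mulr_gt0 ?powR_gt0.
    move=> r r0; apply: ae_imply bv => z bz Sz.
    apply: le_trans (bz (Sbox r r0 z Sz)) _.
    have rrad : r <= rad.
      have [Hx _] := Sz; have := le_trans (normr_ge0 _) (Hx (Ordinal N1)).
      by rewrite subr_ge0.
    rewrite -mulrA ler_peMr ?(ltW Mv0)// mulNr powRN.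
    rewrite ler_pdivlMr ?powR_gt0// mul1r.
    have b20 : 0 <= 2 * b by rewrite mulr_ge0 ?(ltW b0).
    by apply: (ge0_ler_powR b20) => //; rewrite nnegrE ltW.
  - by move=> m m0 Pm r r0; have [_] := step m m0 Pm r r0.
move=> r r0; split.
  have [+ _] := step D D0 PD r r0; apply: ae_bound_le.
  by rewrite -/E ler_wpM2r ?powR_ge0// lerDr ltW.
apply: ae_bound_le (PD r r0).
by rewrite ler_wpM2r ?powR_ge0// lerDl ltW.
Qed.

End tube.

(** * From the box to the cylinder *)

Section solution.
Context (R : realType) (N : nat).
Local Notation ST := ('rV[R]_N * R)%type.
Local Notation mu := (spacetime_measure R N).
Local Notation M A := (measurable (A : set (measurableST R N))).
Implicit Types (z y : ST) (A B E U Q : set ST) (u v w f g : ST -> R).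

(** The statement is symmetric under the exchange of [(u, p)] and [(v, q)],
    and [p * q > 1] makes the larger of the two exponents at least [1]. *)
Lemma tube_estimate_sym (p q : R) : (1 <= N)%N -> 0 < p -> 0 < q -> 1 < p * q ->
  let a := (p + 1) / (p * q - 1) in
  let b := (q + 1) / (p * q - 1) in
  exists2 C, 0 < C & forall Q u v, open Q ->
    heat_absorption Q u (fun z => v z `^ p) ->
    heat_absorption Q v (fun z => u z `^ q) ->
    finite_on_compacts Q (fun z => v z `^ p) ->
    finite_on_compacts Q (fun z => u z `^ q) ->
  forall x0 rad t2, 0 < rad -> closed_box x0 rad x0.2 t2 `<=` Q ->
  forall r, 0 < r ->
    ae_bound (inner_tube x0 rad t2 r) u (C * r `^ (- 2 * a)) /\
    ae_bound (inner_tube x0 rad t2 r) v (C * r `^ (- 2 * b)).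
Proof.
move=> N1 p0 q0 pq a b; have [pleq|qltp] := leP p q.
  have q1 : 1 <= q by nra.
  exact: (tube_estimate N1 p0 q1 pq).
have p1 : 1 <= p by nra.
have qp : 1 < q * p by rewrite mulrC.
have [C C0 H] := tube_estimate N1 q0 p1 qp.
exists C => // Q u v oQ Su Sv fv fu x0 rad t2 rad0 KQ r r0.
have := H Q v u oQ Sv Su fu fv x0 rad t2 rad0 KQ r r0.
by rewrite [q * p]mulrC => -[].
Qed.

Lemma cylinder_open (Omega : set 'rV[R]_N) (T : \bar R) : open Omega ->
  open (cylinder Omega T).
Proof.
move=> oO.
have cf : continuous (fun z : ST => z.1) by move=> x; exact: cvg_fst.
have ct : continuous (fun z : ST => z.2) by move=> x; exact: cvg_snd.
have -> : cylinder Omega T = (fun z : ST => z.1) @^-1` Omega `&`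
    ([set z : ST | 0 < z.2] `&` [set z : ST | (z.2%:E < T)%E]).
  by apply/seteqP; split => z; [move=> [? ? ?]|move=> [? [? ?]]].
apply: openI; first by apply: open_comp => // x _; exact: cf.
apply: openI; first exact: open_superlevel.
case: T => [t||].
- have -> : [set z : ST | (z.2%:E < t%:E)%E] = [set z : ST | z.2 < t].
    by apply/seteqP; split => z /=; rewrite lte_fin.
  exact: open_sublevel.
- have -> : [set z : ST | (z.2%:E < +oo)%E] = setT by apply/seteqP;
  split => z //= _; rewrite ltry.
  exact: openT.
- have -> : [set z : ST | (z.2%:E < -oo)%E] = set0 by apply/seteqP; split => z //=.
  exact: open0.
Qed.

Lemma locally_Lp_source (r : R) Q u : M Q -> (forall z, Q z -> 0 < u z) ->
    locally_Lp r Q u ->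
  [/\ measurable_fun (Q : set (measurableST R N)) u,
      measurable_fun (Q : set (measurableST R N)) (fun z => u z `^ r) &
      finite_on_compacts Q (fun z => u z `^ r)].
Proof.
move=> mQ u0 [mu' iu]; have mu'' : measurable_fun (Q : set (measurableST R N))
  u := mu'.
split => //.
  exact: (@measurableT_comp _ _ _ _ _ _ (@powR R ^~ r)).
move=> K cK KQ; have /integrableP[_] := iu K cK KQ.
congr (_ < _)%E; apply: eq_integral => z /set_mem Kz.
have uz := u0 z (KQ z Kz).
by rewrite /= ger0_norm ?powR_ge0// (gtr0_norm uz).
Qed.

Lemma positive_solution_absorption Omega T (p q : R) u v : open Omega ->
  positive_solution Omega T p q u v -> let Q := cylinder Omega T in
  [/\ heat_absorption Q u (fun z => v z `^ p),
      heat_absorption Q v (fun z => u z `^ q),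
      finite_on_compacts Q (fun z => v z `^ p) &
      finite_on_compacts Q (fun z => u z `^ q)].
Proof.
move=> oO [pos Lu Lv wu wv] Q.
have mQ : M Q by apply: open_measurable_st; exact: cylinder_open.
have [mu1 mu2 su] := locally_Lp_source mQ (fun z Qz => (pos z Qz).1) Lu.
have [mv1 mv2 sv] := locally_Lp_source mQ (fun z Qz => (pos z Qz).2) Lv.
have ge0 z : Q z -> 0 <= u z /\ 0 <= v z by move=> /pos[uz vz]; rewrite !ltW.
split; last 2 first; [exact: sv|exact: su| |].
  by split; [exact: mQ|exact: mu1|exact: mv2|move=> z /ge0[uz _];
    rewrite powR_ge0|exact: wu].
by split; [exact: mQ|exact: mv1|exact: mu2|move=> z /ge0[_ vz];
  rewrite powR_ge0|exact: wv].
Qed.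

(** The margins that work at a point work, halved, in a neighbourhood of it;
    compactness makes them uniform. *)
Lemma compact_margin (K Omega : set 'rV[R]_N) : compact K -> open Omega ->
    K `<=` Omega ->
  exists2 d : R, 0 < d & forall x y : 'rV[R]_N, K x ->
    (forall i, `|y ord0 i - x ord0 i| <= d) -> Omega y.
Proof.
move=> cK oO KO.
have [n _ Hn] : \forall n \near \oo, K `<=` [set x : 'rV[R]_N | forall y : 'rV[R]_N,
    (forall i, `|y ord0 i - x ord0 i| <= n.+1%:R^-1) -> Omega y].
  apply: (compact_near_coveringP K).1 cK _ _
    (fun n (x : 'rV[R]_N) => forall y : 'rV[R]_N,
    (forall i, `|y ord0 i - x ord0 i| <= n.+1%:R^-1) -> Omega y) _ _ => x Kx.
  have /nbhs_ballP[e /= e0 eO] := open_nbhs_nbhs (conj oO (KO x Kx)).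
  have e2 : 0 < e / 2 by rewrite divr_gt0.
  have [n _ Hn] := near_infty_natSinv_lt (PosNum e2).
  exists (ball x (e / 2), [set k | (n <= k)%N]).
    by split; [exact: nbhsx_ballx|exists n].
  move=> [x' k] [/= [_ bx] nk] y Hy; apply: eO; split => // i j.
  rewrite !ord1 /ball/=.
  have := bx ord0 j; rewrite /ball/= => h1; have h2 := Hy j; have h3 := Hn k nk.
  rewrite /= in h3; rewrite distrC in h2.
  have -> : x ord0 j - y ord0 j = (x ord0 j - x' ord0 j)
    + (x' ord0 j - y ord0 j) by ring.
  apply: le_lt_trans (ler_normD _ _) _.
  by rewrite (splitr e) ltrD// (le_lt_trans h2).
exists n.+1%:R^-1; first by rewrite invr_gt0.
by move=> x y Kx Hy; exact: (Hn n (leqnn n) x Kx).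
Qed.

(** For [Omega] the whole space any [c] works; otherwise times are bounded by
    a finite [tau], so [c sqrt t] stays below the distance from [omega] to the
    complement of [Omega]. *)
Lemma parabolic_margin (Omega omega : set 'rV[R]_N) (tau : \bar R) :
    open Omega -> (0 < tau)%E ->
  (compactly_contained omega Omega \/ (Omega = setT /\ omega = setT)) ->
  (tau < +oo)%E \/ Omega = setT ->
  exists2 c : R, 0 < c <= 1 & forall z y, cylinder omega tau z ->
    (forall i, `|y.1 ord0 i - z.1 ord0 i| <= c * Num.sqrt z.2) -> Omega y.1.
Proof.
move=> oO tau0 HO Htau.
have [OT|OnT] := pselect (Omega = setT).
  by exists 1; [rewrite ltr01 lexx|move=> z y _ _; rewrite OT].
case: Htau => // tauoo; case: HO => [[cK KO]|[]//].
have [d d0 Hd] := compact_margin cK oO KO.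
case: tau tau0 tauoo => // s; rewrite lte_fin => s0 _.
have ss0 : 0 < Num.sqrt s by rewrite sqrtr_gt0.
exists (Num.min 1 (d / Num.sqrt s)) => [|z y [oz z0 zs] Hy].
  by rewrite lt_min ltr01 divr_gt0//= ge_min lexx.
apply: (Hd z.1) => [|i]; first exact: subset_closure.
apply: le_trans (Hy i) _.
apply: (@le_trans _ _ (d / Num.sqrt s * Num.sqrt z.2)).
  by rewrite ler_wpM2r ?sqrtr_ge0// ge_min lexx orbT.
rewrite -mulrA ler_piMr ?(ltW d0)// mulrC ler_pdivrMr// mul1r.
by rewrite ler_sqrt ?(ltW s0)// ltW// -lte_fin.
Qed.

Lemma time_between (T : \bar R) (t : R) : (t%:E < T)%E ->
  exists2 t2, t < t2 & (t2%:E < T)%E.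
Proof.
case: T => [s||] //; last by exists (t + 1); [rewrite ltrDl|rewrite ltry].
by rewrite lte_fin => ts; exists ((t + s) / 2); rewrite ?lte_fin; lra.
Qed.

(** The tube has radius [c sqrt t] around [z] and starts at time [t / 4], so
    that points near [z = (x, t)] belong to the inner tube of half that
    radius. Nearby times [y.2] are below [2 t], and [(c sqrt t / 2)^2 = (c^2 /
    8) (2 t)] explains the constant. *)
Lemma parabolic_bound_near (c e C : R) w z t2 : 0 < c <= 1 -> 0 < e -> 0 < C ->
    0 < z.2 < t2 ->
  let x0 : ST := (z.1, z.2 / 4) in
  ae_bound (inner_tube x0 (c * Num.sqrt z.2) t2 (c * Num.sqrt z.2 / 2)) w
    (C * (c * Num.sqrt z.2 / 2) `^ (- 2 * e)) ->
  exists2 U, nbhs z U &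
    {ae mu, forall y, U y -> w y <= C * (c ^+ 2 / 8) `^ (- e) * y.2 `^ (- e)}.
Proof.
move=> /andP[c0 c1] e0 C0 /andP[t0 tt2] x0 H.
set t := z.2 in t0 tt2 H *; set s := Num.sqrt t in H *.
have s0 : 0 < s by rewrite sqrtr_gt0.
have s2 : s ^+ 2 = t by rewrite sqr_sqrtr// ltW.
have cs0 : 0 < c * s by rewrite mulr_gt0.
have c20 : 0 < c ^+ 2 by rewrite exprn_gt0.
have c21 : c ^+ 2 <= 1 by rewrite exprn_ile1// ltW.
pose d := Num.min (c * s / 2) (Num.min (t / 4) (t2 - t)).
have d0 : 0 < d by rewrite !lt_min divr_gt0//= divr_gt0//= subr_gt0.
have d1 : d <= c * s / 2 by rewrite ge_min lexx.
have d2 : d <= t / 4 by rewrite !ge_min lexx !orbT.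
have d3 : d <= t2 - t by rewrite !ge_min lexx !orbT.
exists (ball z d); first exact: nbhsx_ballx.
apply: ae_imply H => y Hy [[_ yx] yt].
have : ball z.2 d y.2 := yt; rewrite /ball/= -/t ltr_norml => /andP[y1 y2].
have e1 : (c * s / 2) `^ (- 2 * e) = (c ^+ 2 / 8) `^ (- e) * (2 * t) `^ (- e).
  rewrite -powRM; last 2 first.
  - by rewrite divr_ge0 ?ltW.
  - by rewrite mulr_ge0 ?ltW.
  have -> : c ^+ 2 / 8 * (2 * t) = (c * s / 2) ^+ 2 by rewrite -s2; field.
  by rewrite -powR_mulrn ?divr_ge0 ?(ltW cs0)// -powRrM mulrN mulNr.
apply: le_trans (Hy _) _.
  split => [i|].
    have := yx ord0 i; rewrite /ball/= distrC /x0/= => h.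
    by apply: le_trans (ltW h) _; lra.
  have -> : (c * s / 2) ^+ 2 = c ^+ 2 * t / 4 by rewrite -s2; field.
  have h : c ^+ 2 * t <= t by rewrite ler_piMl// ltW.
  by rewrite /x0/= -/t; apply/andP; split; lra.
rewrite e1 -mulrA; apply: ler_wpM2l; first exact: ltW.
apply: ler_wpM2l; first exact: powR_ge0.
rewrite !powRN lef_pV2 ?posrE ?powR_gt0//; [|lra|lra].
by apply: ge0_ler_powR; rewrite ?nnegrE; lra.
Qed.

(** A strict failure at one point would persist on a nonempty open set, which
    is not null. *)
Lemma ae_bounded_everywhere (A : set ST) w (h : ST -> R) : open A ->
  (forall z, A z -> {for z, continuous w} /\ {for z, continuous h}) ->
  {ae mu, forall z, A z -> w z <= h z} -> forall z, A z -> w z <= h z.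
Proof.
move=> oA cwh ae z Az; rewrite leNgt; apply/negP => hw.
have [cw ch] := cwh z Az.
have nz : \near z, h z < w z.
  have cd : (fun y => w y - h y) @ z --> w z - h z by apply: cvgB.
  have d0 : 0 < w z - h z by rewrite subr_gt0.
  have nd : \forall y \near z, 0 < w y - h y by apply: (cvgr_gt _ cd).
  by apply: filterS nd => y; rewrite subr_gt0.
pose U := interior ([set y | h y < w y] `&` A).
have zU : U z by apply: filterI => //; exact: open_nbhs_nbhs.
have [y Uy wh] : exists2 y, U y & w y <= h y.
  apply: (@ae_st_exists R N U); [exact: open_interior|by exists z|].
  apply: ae_imply ae => y wh /interior_subset[_ Ay]; exact: wh.
have [/= hw' _] := interior_subset Uy.
by move: wh; rewrite leNgt hw'.
Qed.

End solution.

Theorem theorem1p1 (R : realType) (N : nat) (N_ge1 : (1 <= N)%N)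
    (Omega : set 'rV[R]_N) (domain_Omega : domain Omega)
    (T : \bar R) (T_gt0 : (0 < T)%E)
    (p q : R) (p_gt0 : 0 < p) (q_gt0 : 0 < q) (pq_gt1 : 1 < p * q)
    (omega : set 'rV[R]_N) (domain_omega : domain omega)
    (omega_Omega : compactly_contained omega Omega \/
                   (Omega = setT /\ omega = setT))
    (tau : \bar R) (tau_gt0 : (0 < tau)%E) (tau_le_T : (tau <= T)%E)
    (tau_fin : (tau < +oo)%E \/ Omega = setT) :
  let a := (p + 1) / (p * q - 1) in
  let b := (q + 1) / (p * q - 1) in
  exists2 C : R, 0 < C & forall u v : 'rV[R]_N * R -> R,
    positive_solution Omega T p q u v ->
    let bounded z := u z <= C * z.2 `^ (- a) /\ v z <= C * z.2 `^ (- b) in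
    {ae @lebesgue_spacetime R N, forall z, cylinder omega tau z -> bounded z} /\
    ((forall z, cylinder Omega T z ->
        {for z, continuous u} /\ {for z, continuous v}) ->
     forall z, cylinder omega tau z -> bounded z).
Proof.
move=> a b.
have [oO _ _] := domain_Omega; have [oo _ _] := domain_omega.
have pq0 : 0 < p * q - 1 by lra.
have a0 : 0 < a by rewrite divr_gt0//; lra.
have b0 : 0 < b by rewrite divr_gt0//; lra.
have [C C0 Htube] := tube_estimate_sym N_ge1 p_gt0 q_gt0 pq_gt1.
have [c c01 Hc] := parabolic_margin oO tau_gt0 omega_Omega tau_fin.
have /andP[c0 c1] := c01.
have c20 : 0 < c ^+ 2 / 8 by rewrite divr_gt0// exprn_gt0.
pose Ca := C * (c ^+ 2 / 8) `^ (- a); pose Cb := C * (c ^+ 2 / 8) `^ (- b).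
have Ca0 : 0 < Ca by rewrite mulr_gt0// powR_gt0.
have Cb0 : 0 < Cb by rewrite mulr_gt0// powR_gt0.
exists (Ca + Cb); first exact: addr_gt0.
move=> u v sol bounded.
have [Su Sv fv fu] := positive_solution_absorption oO sol.
have oQ := @cylinder_open R N Omega T oO.
have omO : omega `<=` Omega.
  case: omega_Omega => [[_ KO]|[-> ->]//].
  by apply: subset_trans KO; exact: subset_closure.
have cylO : cylinder omega tau `<=` cylinder Omega T.
  by move=> z [oz z0 zt]; split => //; [exact: omO|exact: lt_le_trans tau_le_T].
have near_bound z : cylinder omega tau z -> exists2 U, nbhs z U &
    {ae spacetime_measure R N, forall y, U y -> u y <= Ca * y.2 `^ (- a) /\ v
      y <= Cb * y.2 `^ (- b)}.
  move=> cz; have [_ zt zT] := cylO z cz.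
  have [t2 zt2 t2T] := time_between zT.
  have s0 : 0 < Num.sqrt z.2 by rewrite sqrtr_gt0.
  have cs0 : 0 < c * Num.sqrt z.2 by rewrite mulr_gt0.
  pose x0 : 'rV[R]_N * R := (z.1, z.2 / 4).
  have KQ : closed_box x0 (c * Num.sqrt z.2) x0.2 t2 `<=` cylinder Omega T.
    move=> y [Hy /andP[y1 y2]]; split.
    - exact: Hc cz Hy.
    - by apply: lt_le_trans y1; rewrite divr_gt0.
    - by apply: le_lt_trans t2T; rewrite lee_fin.
  have r0 : 0 < c * Num.sqrt z.2 / 2 by rewrite divr_gt0.
  have [Bu Bv] := Htube _ _ _ oQ Su Sv fv fu x0 _ t2 cs0 KQ _ r0.
  have ztt : 0 < z.2 < t2 by rewrite zt.
  have [Ua za Ha] := parabolic_bound_near c01 a0 C0 ztt Bu.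
  have [Ub zb Hb] := parabolic_bound_near c01 b0 C0 ztt Bv.
  exists (Ua `&` Ub); first exact: filterI.
  by apply: ae_imply (ae_and Ha Hb) => y [ha hb] [ya yb]; split;
    [exact: ha|exact: hb].
have aeb : {ae spacetime_measure R N, forall z, cylinder omega tau z -> bounded z}.
  apply: ae_imply (ae_nbhs_cover near_bound) => z H /H[hu hv]; split.
    by apply: le_trans hu _; rewrite ler_wpM2r ?powR_ge0// lerDl ltW.
  by apply: le_trans hv _; rewrite ler_wpM2r ?powR_ge0// lerDr ltW.
split; first exact: aeb.
move=> cuv z cz.
have cpow (e : R) y : cylinder omega tau y ->
    {for y, continuous (fun z : 'rV[R]_N * R => (Ca + Cb) * z.2 `^ e)}.
  move=> [_ y0 _]; apply: cvgM; first exact: cvg_cst.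
  apply: (@continuous_comp _ _ _ (fun z : 'rV[R]_N * R => z.2) (fun t : R =>
    t `^ e)).
    exact: cvg_snd.
  apply/differentiable_continuous/derivable1_diffP.
  by have [] := @is_derive1_powR R e y.2 y0.
have oc := @cylinder_open R N omega tau oo.
split.
- apply: (@ae_bounded_everywhere R N _ u (fun y => (Ca + Cb) * y.2 `^ (- a)) oc
  _ _ z cz).
    by move=> y cy; split; [have [] := cuv y (cylO y cy)|exact: cpow].
  by apply: ae_imply aeb => y H /H[].
- apply: (@ae_bounded_everywhere R N _ v (fun y => (Ca + Cb) * y.2 `^ (- b)) oc
  _ _ z cz).
    by move=> y cy; split; [have [] := cuv y (cylO y cy)|exact: cpow].
  by apply: ae_imply aeb => y H /H[].
Qed.
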